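(* Let $N\in\mathbb Z_{\ge 2}$, $\bm\alpha=(s,u,t,v,\lambda_1,\dots,\lambda_N)$ with $s,u,t,v\in\mathbb C^\times$, $\lambda_j\in\mathbb R$, and $\bm x,\bm y\in(\mathbb C^\times)^N$; put $x_{N+1}=s$, $y_0=t$. The overlap coefficient $\Phi_{\bm\alpha}(\bm x,\bm y)=\langle f_{\bm x},\bar f^{\vartheta}_{\bar{\bm y}}\rangle$ satisfies: (i) $\displaystyle \Phi_{\bm\alpha}(\bm x,\bm y)=\prod_{j=1}^N\Phi_{(x_{j+1},u,y_{j-1},v,\lambda_j,0)}(x_j,y_j)$, where $\Phi_{(s,u,t,v,\lambda,\varepsilon)}(x,y)$ is the univariate overlap coefficient. (ii) $\overline{\Phi_{\bar{\bm\alpha}}(\bar{\bm x},\bar{\bm y})}=\Phi_{\bm\alpha^\vartheta}(\hat{\bm y},\hat{\bm x})$, with $\hat{\bm x}=(x_N,\dots,x_1)$, $\hat{\bm y}=(y_N,\dots,y_1)$, $\bm\alpha^\vartheta=(t,v,s,u,\lambda_N,\dots,\lambda_1)$. (iii) For $j=1,\dots,N$, $$\mu_{y_j}\Phi_{\bm\alpha}(\bm x,\bm y)=\sum_{\bm\nu\in\{-1,0,1\}^j}\mathcal C^{(j)}_{\bm\nu}(\bm x)\,[T_{\bm\nu}\Phi_{\bm\alpha}(\,\cdot\,,\bm y)](\bm x)+\frac{(u/v+v/u)(x_{j+1}+x_{j+1}^{-1})}{q^{-2}-q^2}\,\Phi_{\bm\alpha}(\bm x,\bm y).$$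
   Context: Fix $q\in(0,1)$. Notation: $(x;q)_\infty=\prod_{k\ge0}(1-xq^k)$, $\theta(x;q)=(x;q)_\infty(q/x;q)_\infty$; several arguments mean products, and $\pm$ in exponents means the product over all sign choices. $\mu_s=(s+s^{-1})/(q^{-1}-q)$. Bars denote complex conjugation: $\bar{\bm\alpha}=(\bar s,\bar u,\bar t,\bar v,\lambda_1,\dots,\lambda_N)$, $\bar{\bm x}=(\bar x_1,\dots,\bar x_N)$. Univariate functions. For $\lambda,\varepsilon\in\mathbb R$, $s,u,x\in\mathbb C^\times$, $$f_{x,s,u,\lambda,\varepsilon}(z)=\frac{(sq^{1-2i\lambda}x^{\pm1},uszq^{1+i\lambda};q^2)_\infty\,\theta(q^{2\varepsilon-i\lambda}uz/s;q^2)}{(uzq^{-i\lambda}x^{\pm1},sq^{1-i\lambda}/uz;q^2)_\infty},\qquad f_{x,s,u,\lambda}=f_{x,s,u,\lambda,0}.$$ The univariate overlap coefficient is $$\Phi_{(s,u,t,v,\lambda,\varepsilon)}(x,y)=(sq^{1-2i\lambda}x^{\pm1},tq^{1+2i\lambda}y^{\pm1};q^2)_\infty\frac1{2\pi i}\int_{\mathcal C}\frac{(uszq^{1+i\lambda},tvzq^{1-i\lambda};q^2)_\infty\,\theta(uzq^{2\varepsilon-i\lambda}/s,\,vzq^{-2\varepsilon+i\lambda}/t;q^2)}{(uzq^{-i\lambda}x^{\pm1},sq^{1-i\lambda}/uz,vzq^{i\lambda}y^{\pm1},tq^{1+i\lambda}/vz;q^2)_\infty}\frac{dz}{z},$$ where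 $\mathcal C$ is a deformation of the positively oriented unit circle such that the poles $u^{-1}sq^{1-i\lambda}q^{2k}$, $v^{-1}tq^{1+i\lambda}q^{2k}$ ($k\in\mathbb Z_{\ge0}$) are inside $\mathcal C$ and the poles $u^{-1}q^{i\lambda}x^{\pm1}q^{-2k}$, $v^{-1}q^{-i\lambda}y^{\pm1}q^{-2k}$ ($k\in\mathbb Z_{\ge0}$) are outside $\mathcal C$. Multivariate functions. With $x_{N+1}=s$, $y_0=t$, $$f_{\bm x}(\bm z)=\prod_{j=1}^Nf_{x_j,x_{j+1},u,\lambda_j}(z_j),\qquad f^{\vartheta}_{\bm y}(\bm z)=\prod_{j=1}^Nf_{y_j,y_{j-1},v,\lambda_j}(1/z_j),$$ and $\bar f^\vartheta_{\bar{\bm y}}$ is $f^\vartheta_{\bm y}$ with $\bm y,t,v$ replaced by $\bar{\bm y},\bar t,\bar v$. The pairing, which depends on $\bm\alpha$, $\bm x$ and $\bm y$, is $$\langle f,g\rangle=\frac1{(2\pi i)^N}\int_{\mathcal C_1}\cdots\int_{\mathcal C_N}f(\bm z)g^\star(\bm z)\frac{dz_N}{z_N}\cdots\frac{dz_1}{z_1},\qquad g^\star(\bm z)=\overline{g(\bar z_1^{-1},\dots,\bar z_N^{-1})},$$ where $\mathcal C_j$ is a deformation of the positively oriented unit circle such that the sequences $u^{-1}x_{j+1}q^{1-i\lambda_j}q^{2k}$, $v^{-1}y_{j-1}q^{1+i\lambda_j}q^{2k}$ ($k\in\mathbb Z_{\ge0}$) are inside $q^2\mathcal C_j$, and the sequences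 $u^{-1}q^{i\lambda_j}x_j^{\pm1}q^{-2k}$, $v^{-1}q^{-i\lambda_j}y_j^{\pm1}q^{-2k}$ ($k\in\mathbb Z_{\ge0}$) are outside $q^{-2}\mathcal C_j$. Difference operators. $[T_if](\bm x)=f(x_1,\dots,x_{i-1},x_iq^2,x_{i+1},\dots,x_N)$ and $T_{\bm\nu}=T_1^{\nu_1}\cdots T_j^{\nu_j}$ for $\bm\nu=(\nu_1,\dots,\nu_j)\in\{-1,0,1\}^j$. Coefficients. For $s\in\mathbb C^\times$, $\lambda\in\mathbb R$ let $$A_{s,\lambda}(x)=-\frac{x(1-sxq^{1-2i\lambda})(1-sxq^{1+2i\lambda})}{s(1-x^2)(1-q^2x^2)},\quad B_{s,\lambda}(x)=-A_{s,\lambda}(x)-A_{s,\lambda}(x^{-1}),$$ $$A^-_{s,\lambda}(x)=\frac{x^2q^2}{s^2(1-x^2)(1-q^2x^2)},\quad B^-_{s,\lambda}(x)=\frac{1}{s^2(1-x^2/q^2)(1-1/x^2q^2)},$$ $$A^+_{s,\lambda}(x)=\frac{(1-sxq^{1-2i\lambda})(1-sxq^{3-2i\lambda})(1-sxq^{1+2i\lambda})(1-sxq^{3+2i\lambda})}{(1-x^2)(1-q^2x^2)},$$ $$B^+_{s,\lambda}(x)=\frac{q^{-1}(q^{-1}+q)(1-sxq^{1-2i\lambda})(1-sq^{1-2i\lambda}/x)(1-sxq^{1+2i\lambda})(1-sq^{1+2i\lambda}/x)}{(1-x^2/q^2)(1-1/x^2q^2)}.$$ For $\bm\nu\in\{-1,0,1\}^j$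 put $\nu_{j+1}=0$, and for $1\le i\le j$ let $A_{\bm\nu,i}(x_i,x_{i+1})$ be $A^-_{x_{i+1},\lambda_i}(x_i)$, $A_{x_{i+1},\lambda_i}(x_i)$, $A^+_{x_{i+1},\lambda_i}(x_i)$ according to $\nu_{i+1}=-1,0,1$; define $B_{\bm\nu,i}(x_i,x_{i+1})$ likewise from $B^-,B,B^+$. Let $C^{(j)}_{\bm\nu,i}(\bm x)=A_{\bm\nu,i}(x_i^{\nu_i},x_{i+1})$ if $\nu_i\ne0$ and $C^{(j)}_{\bm\nu,i}(\bm x)=B_{\bm\nu,i}(x_i,x_{i+1})$ if $\nu_i=0$; $C^{(j)}_{\bm\nu}(\bm x)=\prod_{i=1}^jC^{(j)}_{\bm\nu,i}(\bm x)$. Finally $\mathcal C^{(j)}_{\bm\nu}(\bm x)$ is $C^{(j)}_{\bm\nu}(\bm x)$ times $$-\frac{ux_1^{-\nu_1}}{vq}\frac{(1-vqx_1^{\nu_1}/ut)(1-vqtx_1^{\nu_1}/u)}{q^{-1}-q}\ \ (\nu_1\neq0),\qquad \frac{(u/v+v/u)(x_1+x_1^{-1})+(q^{-1}+q)(t+t^{-1})}{q^{-2}-q^2}\ \ (\nu_1=0).$$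
   Formalization: In (iii) two misprinted coefficients are corrected: for ν_1=0 the factor of 𝒞^(j)_ν has −(u/v+v/u)(x_1+x_1^{-1}) instead of +(u/v+v/u)(x_1+x_1^{-1}), and B^- carries the additional factor q^{-1}(q^{-1}+q); as printed, (iii) is false. *)

(* Defs.v *)
From Stdlib Require Import Reals ZArith.
From mathcomp Require Import ssreflect ssrfun ssrbool eqtype ssrnat seq choice fintype finfun bigop.
From Coquelicot Require Import Coquelicot.

Set Implicit Arguments.
Unset Strict Implicit.
Unset Printing Implicit Defensive.

Open Scope R_scope.
Open Scope C_scope.

Definition Clim_seq (w : nat -> C) : C :=
  (real (Lim_seq (fun n => Re (w n))), real (Lim_seq (fun n => Im (w n)))).

(* The principal power q^w = exp (w ln q) of a positive real q. *)
Definition qpow (q : R) (w : C) : C :=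
  RtoC (exp (Re w * ln q)) * (cos (Im w * ln q), sin (Im w * ln q))%R.

Definition Cpowz (x : C) (n : Z) : C :=
  match n with
  | Z0 => 1
  | Zpos p => x ^ Pos.to_nat p
  | Zneg p => / (x ^ Pos.to_nat p)
  end.

Definition qpoch (p a : C) : C :=
  Clim_seq (fun n => \big[Cmult/RtoC 1]_(k < n) (1 - a * p ^ k)).

(* (a_1, ..., a_m; p)_oo *)
Definition qpochs (p : C) (s : seq C) : C := \big[Cmult/RtoC 1]_(a <- s) qpoch p a.

(* The argument list abbreviated as a x^{+-1}. *)
Definition pm (a x : C) : seq C := [:: a * x; a / x].

Definition theta (p x : C) : C := qpochs p [:: x; p / x].

Definition mu (q : R) (s : C) : C := (s + / s) / (/ q - q).

(* A curve is a map R -> C of which only the restriction to [0,1] matters. *)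
Definition curve := R -> C.

Definition velocity (g : curve) (tau : R) : C :=
  (Derive (fun a => Re (g a)) tau, Derive (fun a => Im (g a)) tau).

Definition C1_loop (g : curve) : Prop :=
  [/\ forall tau : R, ex_derive (fun a => Re (g a)) tau /\
                      ex_derive (fun a => Im (g a)) tau,
      forall tau : R, continuous (Derive (fun a => Re (g a))) tau /\
                      continuous (Derive (fun a => Im (g a))) tau
    & g 0%R = g 1%R].

Definition contour_int (g : curve) (F : C -> C) : C :=
  RInt (V := C_R_CompleteNormedModule) (fun tau => F (g tau) * velocity g tau) 0 1.

Definition winding (g : curve) (a : C) : C :=
  / (2 * PI * Ci) * contour_int g (fun z => / (z - a)).

Definition on_curve (g : curve) (a : C) : Prop :=
  exists tau : R, (0 <= tau <= 1)%R /\ g tau = a.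

(* For a positively oriented simple closed curve these are the usual interior
   and exterior. *)
Definition inside (g : curve) (a : C) : Prop := ~ on_curve g a /\ winding g a = 1.
Definition outside (g : curve) (a : C) : Prop := ~ on_curve g a /\ winding g a = 0.

Definition unit_circle : curve := fun tau => (cos (2 * PI * tau), sin (2 * PI * tau))%R.

(* Free homotopy of closed curves in C \ {0}, from the unit circle to g. *)
Definition deformed_circle (g : curve) : Prop :=
  C1_loop g /\
  exists H : R -> R -> C,
    [/\ forall p : R * R, continuous (fun p' : R * R => H p'.1 p'.2) p,
        forall sigma tau : R, (0 <= sigma <= 1)%R -> (0 <= tau <= 1)%R -> H sigma tau <> 0,
        forall sigma : R, (0 <= sigma <= 1)%R -> H sigma 0%R = H sigma 1%R,
        forall tau : R, (0 <= tau <= 1)%R -> H 0%R tau = unit_circle tau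
      & forall tau : R, (0 <= tau <= 1)%R -> H 1%R tau = g tau].

Definition scale_curve (c : C) (g : curve) : curve := fun tau => c * g tau.

Definition f1 (q : R) (x s u : C) (lam eps : R) (z : C) : C :=
  qpochs (q ^ 2) (pm (s * qpow q (1 - 2 * Ci * lam)) x ++
                  [:: u * s * z * qpow q (1 + Ci * lam)])
  * theta (q ^ 2) (qpow q (2 * eps - Ci * lam) * u * z / s)
  / qpochs (q ^ 2) (pm (u * z * qpow q (- (Ci * lam))) x ++
                    [:: s * qpow q (1 - Ci * lam) / (u * z)]).

Record uparams := UParams {
  us : C; uu : C; ut : C; uv : C; ulam : R; ueps : R
}.

Definition ucontour (q : R) (a : uparams) (x y : C) (g : curve) : Prop :=
  [/\ deformed_circle g,
      forall k : nat,
        inside g (/ uu a * us a * qpow q (1 - Ci * ulam a) * q ^ (2 * k)) /\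
        inside g (/ uv a * ut a * qpow q (1 + Ci * ulam a) * q ^ (2 * k))
    & forall k : nat,
        [/\ outside g (/ uu a * qpow q (Ci * ulam a) * x * / q ^ (2 * k)),
            outside g (/ uu a * qpow q (Ci * ulam a) * / x * / q ^ (2 * k)),
            outside g (/ uv a * qpow q (- (Ci * ulam a)) * y * / q ^ (2 * k))
          & outside g (/ uv a * qpow q (- (Ci * ulam a)) * / y * / q ^ (2 * k))]].

Definition uintegrand (q : R) (a : uparams) (x y : C) (z : C) : C :=
  let: UParams s u t v lam eps := a in
  qpochs (q ^ 2) [:: u * s * z * qpow q (1 + Ci * lam); t * v * z * qpow q (1 - Ci * lam)]
  * theta (q ^ 2) (u * z * qpow q (2 * eps - Ci * lam) / s)
  * theta (q ^ 2) (v * z * qpow q (- (2 * eps) + Ci * lam) / t)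
  / qpochs (q ^ 2) (pm (u * z * qpow q (- (Ci * lam))) x ++
                    [:: s * qpow q (1 - Ci * lam) / (u * z)] ++
                    pm (v * z * qpow q (Ci * lam)) y ++
                    [:: t * qpow q (1 + Ci * lam) / (v * z)]).

(* The overlap coefficients take a choice of contours as an argument; a contour
   selection is an arbitrary choice which is admissible whenever some
   admissible contour exists. *)
Definition uselection := uparams -> C -> C -> curve.

Definition uselection_ok (q : R) (k : uselection) : Prop :=
  forall a x y, (exists g, ucontour q a x y g) -> ucontour q a x y (k a x y).

(* Phi_{(s,u,t,v,lambda,eps)}(x,y) *)
Definition uPhi (q : R) (k : uselection) (a : uparams) (x y : C) : C :=
  qpochs (q ^ 2) (pm (us a * qpow q (1 - 2 * Ci * ulam a)) x ++
                  pm (ut a * qpow q (1 + 2 * Ci * ulam a)) y)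
  * (/ (2 * PI * Ci) * contour_int (k a x y) (fun z => uintegrand q a x y z / z)).

(* Indices are 0-based: x i, for i : 'I_N, is the variable x_{i+1}. *)
Definition vec N := 'I_N -> C.

Record params N := Params {
  ps : C; pu : C; pt : C; pv : C; plam : 'I_N -> R
}.

(* vext x s i = x_i for i < N and s for i >= N, so that x_{N+1} = s. *)
Definition vext N (x : vec N) (s : C) (i : nat) : C :=
  if insub i is Some k then x k else s.

(* The entry which precedes index i in y, where t precedes the first one. *)
Definition vprev N (y : vec N) (t : C) (i : nat) : C :=
  if i is i'.+1 then vext y t i' else t.

Definition vconj N (x : vec N) : vec N := fun i => Cconj (x i).
Definition vrev N (x : vec N) : vec N := fun i => x (rev_ord i).

Definition pconj N (a : params N) : params N :=
  Params (Cconj (ps a)) (Cconj (pu a)) (Cconj (pt a)) (Cconj (pv a)) (plam a).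

(* alpha^theta = (t, v, s, u, lambda_N, ..., lambda_1) *)
Definition ptheta N (a : params N) : params N :=
  Params (pt a) (pv a) (ps a) (pu a) (fun i => plam a (rev_ord i)).

Definition fN (q : R) N (a : params N) (x : vec N) (z : vec N) : C :=
  \big[Cmult/RtoC 1]_(j < N) f1 q (x j) (vext x (ps a) j.+1) (pu a) (plam a j) 0 (z j).

Definition fNtheta (q : R) N (a : params N) (y : vec N) (z : vec N) : C :=
  \big[Cmult/RtoC 1]_(j < N) f1 q (y j) (vprev y (pt a) j) (pv a) (plam a j) 0 (/ z j).

Definition star N (g : vec N -> C) : vec N -> C :=
  fun z => Cconj (g (fun j => / Cconj (z j))).

Definition vcons N (z : C) (w : vec N) : vec N.+1 :=
  fun i => if unlift ord0 i is Some k then w k else z.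

(* int_{C_1} ... int_{C_N} F(z) dz_N/z_N ... dz_1/z_1 *)
Fixpoint iter_int N : ('I_N -> curve) -> (vec N -> C) -> C :=
  match N with
  | 0%N => fun _ F => F (fun _ => 0)
  | N'.+1 => fun G F =>
      contour_int (G ord0) (fun z =>
        iter_int (fun i : 'I_N' => G (lift ord0 i)) (fun w => F (vcons z w)) / z)
  end.

Definition pairing N (G : 'I_N -> curve) (f g : vec N -> C) : C :=
  / ((2 * PI * Ci) ^ N) * iter_int G (fun z => f z * star g z).

Definition contours (q : R) N (a : params N) (x y : vec N) (G : 'I_N -> curve) : Prop :=
  forall j : 'I_N,
  [/\ deformed_circle (G j),
      forall k : nat,
        inside (scale_curve (q ^ 2) (G j))
          (/ pu a * vext x (ps a) j.+1 * qpow q (1 - Ci * plam a j) * q ^ (2 * k)) /\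
        inside (scale_curve (q ^ 2) (G j))
          (/ pv a * vprev y (pt a) j * qpow q (1 + Ci * plam a j) * q ^ (2 * k))
    & forall k : nat,
        [/\ outside (scale_curve (/ q ^ 2) (G j))
              (/ pu a * qpow q (Ci * plam a j) * x j * / q ^ (2 * k)),
            outside (scale_curve (/ q ^ 2) (G j))
              (/ pu a * qpow q (Ci * plam a j) * / x j * / q ^ (2 * k)),
            outside (scale_curve (/ q ^ 2) (G j))
              (/ pv a * qpow q (- (Ci * plam a j)) * y j * / q ^ (2 * k))
          & outside (scale_curve (/ q ^ 2) (G j))
              (/ pv a * qpow q (- (Ci * plam a j)) * / y j * / q ^ (2 * k))]].

Definition selection N := params N -> vec N -> vec N -> 'I_N -> curve.

Definition Phi_defined (q : R) N (a : params N) (x y : vec N) : Prop :=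
  exists G, contours q a x y G.

Definition selection_ok (q : R) N (K : selection N) : Prop :=
  forall a x y, Phi_defined q a x y -> contours q a x y (K a x y).

(* Phi_alpha(x,y) = < f_x , conj(f)^theta_{conj y} > *)
Definition Phi (q : R) N (K : selection N) (a : params N) (x y : vec N) : C :=
  pairing (K a x y) (fN q a x) (fNtheta q (pconj a) (vconj y)).

(* An element of {-1,0,1}^j; the value e : 'I_3 stands for e - 1. *)
Definition signs j := {ffun 'I_j -> 'I_3}.

(* nuat nu i = nu_i for i < j and 0 for i >= j, so that nu_{j+1} = 0. *)
Definition nuat j (nu : signs j) (i : nat) : Z :=
  if insub i is Some k then (Z.of_nat (nu k) - 1)%Z else 0%Z.

Definition vshift (q : R) N j (nu : signs j) (x : vec N) : vec N :=
  fun i => x i * Cpowz q (2 * nuat nu i).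

Definition Tshift (q : R) N j (nu : signs j) (F : vec N -> C) : vec N -> C :=
  fun x => F (vshift q nu x).

Definition A0 (q : R) (s : C) (lam : R) (x : C) : C :=
  - (x * (1 - s * x * qpow q (1 - 2 * Ci * lam)) * (1 - s * x * qpow q (1 + 2 * Ci * lam))
     / (s * (1 - x ^ 2) * (1 - q ^ 2 * x ^ 2))).

Definition B0 (q : R) (s : C) (lam : R) (x : C) : C :=
  - A0 q s lam x - A0 q s lam (/ x).

Definition Aminus (q : R) (s : C) (lam : R) (x : C) : C :=
  x ^ 2 * q ^ 2 / (s ^ 2 * (1 - x ^ 2) * (1 - q ^ 2 * x ^ 2)).

(* The factor q^{-1} (q^{-1} + q), the same as in Bplus, is needed: it makes the
   pole at x = q of Aminus (1/x), weighted by Mfactor with nu_1 = -1, cancel the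
   one of Bminus x, weighted by Mfactor with nu_1 = 0. *)
Definition Bminus (q : R) (s : C) (lam : R) (x : C) : C :=
  / q * (/ q + q) / (s ^ 2 * (1 - x ^ 2 / q ^ 2) * (1 - / (x ^ 2 * q ^ 2))).

Definition Aplus (q : R) (s : C) (lam : R) (x : C) : C :=
  (1 - s * x * qpow q (1 - 2 * Ci * lam)) * (1 - s * x * qpow q (3 - 2 * Ci * lam))
  * (1 - s * x * qpow q (1 + 2 * Ci * lam)) * (1 - s * x * qpow q (3 + 2 * Ci * lam))
  / ((1 - x ^ 2) * (1 - q ^ 2 * x ^ 2)).

Definition Bplus (q : R) (s : C) (lam : R) (x : C) : C :=
  / q * (/ q + q)
  * (1 - s * x * qpow q (1 - 2 * Ci * lam)) * (1 - s * qpow q (1 - 2 * Ci * lam) / x)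
  * (1 - s * x * qpow q (1 + 2 * Ci * lam)) * (1 - s * qpow q (1 + 2 * Ci * lam) / x)
  / ((1 - x ^ 2 / q ^ 2) * (1 - / (x ^ 2 * q ^ 2))).

Definition Asel (n : Z) : R -> C -> R -> C -> C :=
  match n with Zneg _ => Aminus | Z0 => A0 | Zpos _ => Aplus end.

Definition Bsel (n : Z) : R -> C -> R -> C -> C :=
  match n with Zneg _ => Bminus | Z0 => B0 | Zpos _ => Bplus end.

Definition Cfactor (q : R) N (a : params N) (x : vec N) j (nu : signs j) (i : 'I_N) : C :=
  let s := vext x (ps a) i.+1 in
  let n := nuat nu i in
  if (n =? 0)%Z then Bsel (nuat nu i.+1) q s (plam a i) (x i)
  else Asel (nuat nu i.+1) q s (plam a i) (Cpowz (x i) n).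

(* The factor which depends on nu_1 = n and x_1 = x only. The minus sign for
   n = 0 is forced by the invariance of Phi under x_1 -> 1/x_1: at x = q the
   value must agree with the one for n = -1. *)
Definition Mfactor (q : R) N (a : params N) (n : Z) (x : C) : C :=
  let u := pu a in let t := pt a in let v := pv a in
  if (n =? 0)%Z then
    (- ((u / v + v / u) * (x + / x)) + (/ q + q) * (t + / t)) / (/ q ^ 2 - q ^ 2)
  else
    - (u * Cpowz x (- n) / (v * q))
    * ((1 - v * q * Cpowz x n / (u * t)) * (1 - v * q * t * Cpowz x n / u) / (/ q - q)).

(* The product runs over the first j indices. *)
Definition Ccoef (q : R) N (a : params N) (x : vec N) j (nu : signs j) : C :=
  (\big[Cmult/RtoC 1]_(i < N | (i < j)%N) Cfactor q a x nu i)
  * Mfactor q a (nuat nu 0) (vext x (ps a) 0).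

(* Main.v *)
Require Import Defs.
From HB Require Import structures.
From Stdlib Require Import Reals ZArith Lra FunctionalExtensionality.
From mathcomp Require Import ssreflect ssrfun ssrbool eqtype ssrnat seq choice fintype finfun bigop.
From Coquelicot Require Import Coquelicot.

(** Put p = q^2 and xi x = x + 1 / x. Both functions in the pairing are products of
   functions of one variable each, so the iterated integral is a product of
   univariate integrals of f(z) g(z) dz / z, where f is f_{x_j, x_{j+1}, u, lambda_j} and
   g is the conjugate of f^theta_{y_j, y_{j-1}, v, lambda_j} (lemma [Phi_prod]). Everything
   then rests on three facts.

   Contours. An integral does not depend on the choice of an admissible contour
   ([bracket_contour_indep]). On the curves, the infinite products are uniform limits
   of finite ones, so the integrand is a uniform limit of rational functions whose
   poles are at 0 and among its own poles. For rational functions, two loops with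
   the same winding numbers around the poles give the same integral, by partial
   fractions ([same_int_rational]), and equality passes to the limit
   ([tame_same_int]). The winding number around 0 is the limit of those around the
   poles which accumulate at 0 ([same_winding_zero]). Part (i) follows; so does part
   (ii), because conjugating the integrand exchanges f and g, and conjugating and
   reversing a contour yields an admissible one. The room of a factor q^2 around
   the contours allows one also to compare the curve with its multiple by p, which
   gives the adjunction of f(z) g(p z) and f(z / p) g(z) ([contour_shift]).

   Contiguity. The function f satisfies a first order difference equation in z with
   eigenvalue xi x_j ([fw_eigen]), and f(z / p) is a combination of the three functions
   f_{x_j p^nu, x_{j+1} p^sigma}(z), nu = -1, 0, 1, for each sigma = -1, 0, 1
   ([fw_recurrences]). The coefficients of these combinations are the A's and B's.

   Telescoping. Let a_j and b_j be the integrals of f(z) g(z) and of f(z / p) g(z). The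
   eigenvalue equation of g gives
     xi y_j * a_j = r_j + xi y_{j-1} * b_j,
   that of f gives
     xi x_j * b_j = rho_j + xi x_{j+1} * a_j,
   and the recurrences weighted with the eigenvalues xi (x_j p^nu) give
     rho'_j + xi (x_{j+1} p^sigma) * a_j,
   with r_j = alpha rho_j + gamma rho'_j for constants alpha and gamma depending on
   q, u and v. For the same constants the factor of the coefficients depending on
   nu_1 is, up to the factor 1 / q - q, equal to
     xi t + alpha * xi x_1 + gamma * xi (x_1 p^nu_1)
   ([Mfactor_xi]). Summing over nu_1, then nu_2, and so on, each sum turns the
   eigenvalue in x_i into the one in x_{i+1}, and the remainders rho and rho' add up
   to the r's ([chain_telescope]). This is part (iii). *)

Set Implicit Arguments.
Unset Strict Implicit.
Unset Printing Implicit Defensive.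
Local Open Scope C_scope.

(** * Complex-valued functions of a real variable *)

Lemma C_ext (z w : C) : Re z = Re w -> Im z = Im w -> z = w.
Proof. by case: z => a b; case: w => c d /= -> ->. Qed.

(** Continuity and differentiability are taken componentwise, as in [C1_loop]. *)
Definition ccont (f : R -> C) (t : R) : Prop :=
  continuous (fun r => Re (f r)) t /\ continuous (fun r => Im (f r)) t.

Definition cderiv (f : R -> C) (t : R) (d : C) : Prop :=
  is_derive (fun r => Re (f r)) t (Re d) /\ is_derive (fun r => Im (f r)) t (Im d).

Lemma cont_plusR (f g : R -> R) t :
  continuous f t -> continuous g t -> continuous (fun r => (f r + g r)%R) t.
Proof. exact: (@continuous_plus _ _ R_NormedModule). Qed.

Lemma cont_multR (f g : R -> R) t :
  continuous f t -> continuous g t -> continuous (fun r => (f r * g r)%R) t.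
Proof. exact: (@continuous_mult _ R_AbsRing). Qed.

Lemma cont_oppR (f : R -> R) t : continuous f t -> continuous (fun r => (- f r)%R) t.
Proof. exact: (@continuous_opp _ _ R_NormedModule). Qed.

Lemma cont_invR (f : R -> R) t :
  continuous f t -> f t <> 0%R -> continuous (fun r => (/ f r)%R) t.
Proof.
move=> hf h0; apply: (continuous_comp f Rinv) => //.
exact: continuous_Rinv.
Qed.

Lemma ccont_const c t : ccont (fun _ => c) t.
Proof. by split; apply: continuous_const. Qed.

Lemma ccont_ext f g t : (forall r, f r = g r) -> ccont f t -> ccont g t.
Proof. by move=> h; have -> : f = g by apply: functional_extensionality. Qed.

Lemma ccont_plus f g t : ccont f t -> ccont g t -> ccont (fun r => f r + g r) t.
Proof. by case=> [a b] [c d]; split=> /=; apply: cont_plusR. Qed.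

Lemma ccont_mult f g t : ccont f t -> ccont g t -> ccont (fun r => f r * g r) t.
Proof.
case=> [a b] [c d]; split=> /=.
  by apply: cont_plusR; [|apply: cont_oppR]; apply: cont_multR.
by apply: cont_plusR; apply: cont_multR.
Qed.

Lemma normsq_neq0 (z : C) : z <> 0 -> (Re z ^ 2 + Im z ^ 2)%R <> 0%R.
Proof.
case: z => a b /= h h1; apply: h.
have : (a ^ 2 = 0)%R by nra.
have : (b ^ 2 = 0)%R by nra.
by move=> hb ha; apply: C_ext => /=; nra.
Qed.

Lemma ccont_inv f t : ccont f t -> f t <> 0 -> ccont (fun r => / f r) t.
Proof.
case=> [a b] h0.
have hn : continuous (fun r => (/ (Re (f r) ^ 2 + Im (f r) ^ 2))%R) t.
  apply: cont_invR; last exact: normsq_neq0.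
  by apply: cont_plusR => /=; apply: cont_multR => //; apply: cont_multR => //; apply: continuous_const.
split; apply: cont_multR => //; exact: cont_oppR.
Qed.

Lemma ccont_opp f t : ccont f t -> ccont (fun r => - f r) t.
Proof. by case=> a b; split; apply: cont_oppR. Qed.

Lemma ccont_minus f g t : ccont f t -> ccont g t -> ccont (fun r => f r - g r) t.
Proof. by move=> a b; apply: ccont_plus => //; apply: ccont_opp. Qed.

Lemma ccont_pow f n t : ccont f t -> ccont (fun r => f r ^ n) t.
Proof.
move=> h; elim: n => [|n IH] /=; first exact: ccont_const.
exact: ccont_mult.
Qed.

Lemma cderiv_ccont f t d : cderiv f t d -> ccont f t.
Proof.
by case=> a b; split; apply: ex_derive_continuous; [exists (Re d)|exists (Im d)].
Qed.

Lemma cderiv_const c t : cderiv (fun _ => c) t 0.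
Proof. by split; apply: (@is_derive_const R_AbsRing R_NormedModule). Qed.

Lemma cderiv_plus f g t df dg :
  cderiv f t df -> cderiv g t dg -> cderiv (fun r => f r + g r) t (df + dg).
Proof.
by case=> a b [c d]; split; apply: (@is_derive_plus R_AbsRing R_NormedModule).
Qed.

Lemma cderiv_mult f g t df dg :
  cderiv f t df -> cderiv g t dg ->
  cderiv (fun r => f r * g r) t (df * g t + f t * dg).
Proof.
case=> a b [c d].
have M u v du dv (hu : is_derive u t du) (hv : is_derive v t dv) :
  is_derive (fun r : R => (u r * v r)%R) t (du * v t + u t * dv)%R.
  exact: (is_derive_mult u v t du dv hu hv Rmult_comm).
split => /=.
  evar_last.
    exact: (is_derive_minus (fun r => (Re (f r) * Re (g r))%R)
              (fun r => (Im (f r) * Im (g r))%R) _ _ _ (M _ _ _ _ a c) (M _ _ _ _ b d)).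
  by rewrite /minus /plus /opp /Re /Im /=; ring.
evar_last.
  exact: (is_derive_plus (fun r => (Re (f r) * Im (g r))%R)
            (fun r => (Im (f r) * Re (g r))%R) _ _ _ (M _ _ _ _ a d) (M _ _ _ _ b c)).
by rewrite /plus /Re /Im /=; ring.
Qed.

Lemma cderiv_inv f t df :
  cderiv f t df -> f t <> 0 -> cderiv (fun r => / f r) t (- df * (/ f t) ^ 2).
Proof.
case=> a b h0.
have hn := normsq_neq0 h0.
have M u v du dv (hu : is_derive u t du) (hv : is_derive v t dv) :
  is_derive (fun r : R => (u r * v r)%R) t (du * v t + u t * dv)%R.
  exact: (is_derive_mult u v t du dv hu hv Rmult_comm).
have hN : is_derive (fun r => (Re (f r) ^ 2 + Im (f r) ^ 2)%R) t
   (2 * Re (f t) * Re df + 2 * Im (f t) * Im df)%R.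
  evar_last; first by apply: (is_derive_plus (fun r => (Re (f r) ^ 2)%R) (fun r => (Im (f r) ^ 2)%R));
    apply: is_derive_pow; eassumption.
  by rewrite /plus /=; ring.
split => /=.
  evar_last; first exact: (is_derive_div _ _ _ _ _ a hN hn).
  move: hn; case: (f t) => x y /= hn; case: df a b hN => dx dy a b hN /=.
  by field; move: hn => /=; rewrite !Rmult_1_r.
have b' : is_derive (fun r => (- Im (f r))%R) t (- Im df)%R.
  exact: (is_derive_opp _ _ _ b).
evar_last; first exact: (is_derive_div _ _ _ _ _ b' hN hn).
move: hn; case: (f t) => x y /= hn; case: df a b hN b' => dx dy a b hN b' /=.
by field; move: hn => /=; rewrite !Rmult_1_r.
Qed.

Lemma cderiv_pow f t df n :
  cderiv f t df -> cderiv (fun r => f r ^ n.+1) t (INR n.+1 * f t ^ n * df).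
Proof.
move=> h; elim: n => [|n IH].
  have -> : (fun r => f r ^ 1) = f by apply: functional_extensionality => r /=; ring.
  have -> : INR 1 * f t ^ 0 * df = df by rewrite /=; ring.
  exact: h.
have := cderiv_mult h IH.
have -> : df * f t ^ n.+1 + f t * (INR n.+1 * f t ^ n * df) = INR n.+2 * f t ^ n.+1 * df.
  by rewrite (S_INR n.+1) RtoC_plus /=; ring.
by [].
Qed.

(** * Integration on the unit interval *)

(** Componentwise again, so that real integration applies to each part. *)
Definition is_cint (f : R -> C) (I : C) : Prop :=
  is_RInt (fun r => Re (f r)) 0 1 (Re I) /\ is_RInt (fun r => Im (f r)) 0 1 (Im I).

Definition cint (f : R -> C) : C := RInt (V := C_R_CompleteNormedModule) f 0 1.

Lemma is_cint_unique f I : is_cint f I -> cint f = I.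
Proof.
case=> a b; rewrite /cint.
apply: (@is_RInt_unique C_R_CompleteNormedModule).
rewrite (surjective_pairing I).
exact: (@is_RInt_fct_extend_pair R_NormedModule R_NormedModule f 0 1).
Qed.

Lemma is_cint_cint f : (forall t, (0 <= t <= 1)%R -> ccont f t) -> is_cint f (cint f).
Proof.
move=> h.
have h1 : ex_RInt (fun r => Re (f r)) 0 1.
  apply: (@ex_RInt_continuous R_CompleteNormedModule) => z; rewrite Rmin_left ?Rmax_right; try lra.
  by case/h.
have h2 : ex_RInt (fun r => Im (f r)) 0 1.
  apply: (@ex_RInt_continuous R_CompleteNormedModule) => z; rewrite Rmin_left ?Rmax_right; try lra.
  by case/h.
case: h1 => a ha; case: h2 => b hb.
have hI : is_cint f (a, b) by [].
by rewrite (is_cint_unique hI).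
Qed.

Lemma cint_ext f g : (forall t, (0 <= t <= 1)%R -> f t = g t) -> cint f = cint g.
Proof.
move=> h; apply: (@RInt_ext C_R_CompleteNormedModule) => t; rewrite Rmin_left ?Rmax_right; try lra.
by move=> ht; apply: h; lra.
Qed.

Lemma is_cint_plus f g I J : is_cint f I -> is_cint g J -> is_cint (fun r => f r + g r) (I + J).
Proof. by case=> a b [c d]; split; apply: (@is_RInt_plus R_NormedModule). Qed.

Lemma is_cint_scal c f I : is_cint f I -> is_cint (fun r => c * f r) (c * I).
Proof.
case=> a b; split => /=.
  apply: (@is_RInt_minus R_NormedModule); exact: (@is_RInt_scal R_NormedModule).
apply: (@is_RInt_plus R_NormedModule); exact: (@is_RInt_scal R_NormedModule).
Qed.

(** The bound is obtained from those of the two components, whence the factor 2. *)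
Lemma cint_bound f I M : is_cint f I ->
  (forall t, (0 <= t <= 1)%R -> Cmod (f t) <= M)%R -> (Cmod I <= 2 * M)%R.
Proof.
case=> a b h.
have h1 : (Rabs (Re I) <= (1 - 0) * M)%R.
  apply: (@norm_RInt_le_const R_NormedModule (fun r => Re (f r)) 0 1 (Re I) M _ _ a); first lra.
  move=> t ht; apply: Rle_trans (h t ht); apply: Rle_trans (Rmax_Cmod (f t)).
  exact: Rmax_l.
have h2 : (Rabs (Im I) <= (1 - 0) * M)%R.
  apply: (@norm_RInt_le_const R_NormedModule (fun r => Im (f r)) 0 1 (Im I) M _ _ b); first lra.
  move=> t ht; apply: Rle_trans (h t ht); apply: Rle_trans (Rmax_Cmod (f t)).
  exact: Rmax_r.
have -> : I = RtoC (Re I) + RtoC (Im I) * Ci by apply: C_ext => /=; ring.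
apply: Rle_trans (Cmod_triangle _ _) _.
rewrite Cmod_mult !Cmod_R.
have -> : Cmod Ci = 1%R by rewrite /Cmod /= -[RHS]sqrt_1; congr sqrt; ring.
lra.
Qed.

Lemma is_cint_deriv f df :
  (forall t, (0 <= t <= 1)%R -> cderiv f t (df t)) ->
  (forall t, (0 <= t <= 1)%R -> ccont df t) -> is_cint df (f 1%R - f 0%R).
Proof.
move=> h1 h2.
split; [apply: (@is_RInt_derive R_CompleteNormedModule (fun r => Re (f r)))
       |apply: (@is_RInt_derive R_CompleteNormedModule (fun r => Im (f r)))]
  => t; rewrite Rmin_left ?Rmax_right; try lra; move=> ht; first [by case: (h1 t ht)|by case: (h2 t ht)].
Qed.

(** * Arithmetic of complex numbers *)

Lemma Cmult_lawA : associative Cmult.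
Proof. by move=> x y z; ring. Qed.
Lemma Cmult_lawC : commutative Cmult.
Proof. by move=> x y; ring. Qed.
Lemma Cmult_law1 : left_id (RtoC 1) Cmult.
Proof. by move=> x; ring. Qed.
Lemma Cplus_lawA : associative Cplus.
Proof. by move=> x y z; ring. Qed.
Lemma Cplus_lawC : commutative Cplus.
Proof. by move=> x y; ring. Qed.
Lemma Cplus_law0 : left_id (RtoC 0) Cplus.
Proof. by move=> x; ring. Qed.
Lemma Cmult_law0l : left_zero (RtoC 0) Cmult.
Proof. by move=> x; ring. Qed.
Lemma Cmult_law0r : right_zero (RtoC 0) Cmult.
Proof. by move=> x; ring. Qed.
Lemma Cmult_lawDl : left_distributive Cmult Cplus.
Proof. by move=> x y z; ring. Qed.
Lemma Cmult_lawDr : right_distributive Cmult Cplus.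
Proof. by move=> x y z; ring. Qed.
HB.instance Definition _ :=
  Monoid.isComLaw.Build C (RtoC 1) Cmult Cmult_lawA Cmult_lawC Cmult_law1.
HB.instance Definition _ :=
  Monoid.isComLaw.Build C (RtoC 0) Cplus Cplus_lawA Cplus_lawC Cplus_law0.
HB.instance Definition _ := Monoid.isMulLaw.Build C (RtoC 0) Cmult Cmult_law0l Cmult_law0r.
HB.instance Definition _ := Monoid.isAddLaw.Build C Cmult Cplus Cmult_lawDl Cmult_lawDr.

Lemma RtoC_neq0 (r : R) : r <> 0%R -> RtoC r <> 0.
Proof. by move=> h e; apply: h; apply: RtoC_inj. Qed.

Lemma Cinv_neq0 (z : C) : z <> 0 -> / z <> 0.
Proof.
move=> h e; have := Cinv_r z h; rewrite e Cmult_0_r => /RtoC_inj; lra.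
Qed.

Lemma Cinv_0 : / (RtoC 0) = 0.
Proof. by apply: C_ext => /=; rewrite /Rdiv ?Ropp_0 Rmult_0_l. Qed.

(** Also for zero factors, as the inverse of 0 is 0. *)
Lemma Cinv_mult_total (a b : C) : / (a * b) = / a * / b.
Proof.
case: (Ceq_dec a 0) => [->|ha]; first by rewrite Cmult_0_l Cinv_0 Cmult_0_l.
case: (Ceq_dec b 0) => [->|hb]; last by field.
by rewrite Cmult_0_r Cinv_0 Cmult_0_r.
Qed.

Lemma Csub_neq0 (a b : C) : a <> b -> a - b <> 0.
Proof. exact: Cminus_eq_contra. Qed.

(** * Contour integrals *)

Definition cont_on (g : curve) (F : C -> C) : Prop :=
  forall t, (0 <= t <= 1)%R -> ccont (fun r => F (g r)) t.

Lemma loop_cderiv g t : C1_loop g -> cderiv g t (velocity g t).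
Proof. by case=> h _ _; case: (h t) => a b; split; apply: Derive_correct. Qed.

Lemma loop_ccont g t : C1_loop g -> ccont g t.
Proof. by move=> h; apply: cderiv_ccont; apply: loop_cderiv. Qed.

Lemma velocity_ccont g t : C1_loop g -> ccont (velocity g) t.
Proof. by case=> _ h _; case: (h t). Qed.

Lemma not_on_curve g b t : ~ on_curve g b -> (0 <= t <= 1)%R -> g t - b <> 0.
Proof. by move=> h ht e; apply: h; exists t; split=> //; apply/Ceq_minus. Qed.

Lemma is_contour_int g F : C1_loop g -> cont_on g F ->
  is_cint (fun t => F (g t) * velocity g t) (contour_int g F).
Proof.
move=> hg hF; apply: is_cint_cint => t ht; apply: ccont_mult; first exact: hF.
exact: velocity_ccont.
Qed.

Lemma contour_int_ext g F G : (forall t, (0 <= t <= 1)%R -> F (g t) = G (g t)) ->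
  contour_int g F = contour_int g G.
Proof. by move=> h; apply: cint_ext => t ht; rewrite h. Qed.

Lemma contour_int_plus g F G : C1_loop g -> cont_on g F -> cont_on g G ->
  contour_int g (fun z => F z + G z) = contour_int g F + contour_int g G.
Proof.
move=> hg hF hG.
rewrite -(is_cint_unique (is_cint_plus (is_contour_int hg hF) (is_contour_int hg hG))).
by apply: cint_ext => t _; ring.
Qed.

Lemma contour_int_scal g c F : C1_loop g -> cont_on g F ->
  contour_int g (fun z => c * F z) = c * contour_int g F.
Proof.
move=> hg hF.
rewrite -(is_cint_unique (is_cint_scal c (is_contour_int hg hF))).
by apply: cint_ext => t _; ring.
Qed.

Lemma cont_on_const g c : cont_on g (fun _ => c).
Proof. by move=> t _; apply: ccont_const. Qed.

Lemma cont_on_id g : C1_loop g -> cont_on g (fun z => z).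
Proof. by move=> h t _; apply: loop_ccont. Qed.

Lemma cont_on_plus g F G : cont_on g F -> cont_on g G -> cont_on g (fun z => F z + G z).
Proof. by move=> a b t ht; apply: ccont_plus; [apply: a|apply: b]. Qed.

Lemma cont_on_mult g F G : cont_on g F -> cont_on g G -> cont_on g (fun z => F z * G z).
Proof. by move=> a b t ht; apply: ccont_mult; [apply: a|apply: b]. Qed.

Lemma cont_on_inv g F : cont_on g F -> (forall t, (0 <= t <= 1)%R -> F (g t) <> 0) ->
  cont_on g (fun z => / F z).
Proof. by move=> a b t ht; apply: ccont_inv; [apply: a|apply: b]. Qed.

Lemma cont_on_pow g F n : cont_on g F -> cont_on g (fun z => F z ^ n).
Proof. by move=> a t ht; apply: (@ccont_pow (fun r => F (g r))); apply: a. Qed.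

Lemma cont_on_sub g b : C1_loop g -> cont_on g (fun z => z - b).
Proof. by move=> h; apply: cont_on_plus; [apply: cont_on_id|apply: cont_on_const]. Qed.

Lemma cont_on_pole g b : C1_loop g -> ~ on_curve g b -> cont_on g (fun z => / (z - b)).
Proof.
move=> h hb; apply: cont_on_inv; first exact: cont_on_sub.
by move=> t; apply: not_on_curve.
Qed.

(** Powers of z, and the powers of 1 / (z - b) of order at least 2, have primitives. *)
Lemma contour_int_pow g n : C1_loop g -> contour_int g (fun z => z ^ n) = 0.
Proof.
move=> hg.
have h0 : INR n.+1 * contour_int g (fun z => z ^ n) = 0.
  rewrite -contour_int_scal //; last exact: cont_on_pow (cont_on_id hg).
  transitivity (g 1%R ^ n.+1 - g 0%R ^ n.+1); last by case: hg => _ _ ->; ring.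
  apply: is_cint_unique; apply: (@is_cint_deriv (fun r => g r ^ n.+1)) => t ht.
    by apply: cderiv_pow; apply: loop_cderiv.
  apply: ccont_mult; last exact: velocity_ccont.
  apply: ccont_mult; first exact: ccont_const.
  by apply: ccont_pow; apply: loop_ccont.
have h1 : RtoC (INR n.+1) <> 0 by apply: RtoC_neq0; exact: not_0_INR.
by case: (Ceq_dec (contour_int g (fun z => z ^ n)) 0) => // h2; case: (Cmult_neq_0 _ _ h1 h2).
Qed.

Lemma contour_int_invpow g b n : C1_loop g -> ~ on_curve g b ->
  contour_int g (fun z => (/ (z - b)) ^ n.+2) = 0.
Proof.
move=> hg hb.
have hc := cont_on_pole hg hb.
have h0 : - INR n.+1 * contour_int g (fun z => (/ (z - b)) ^ n.+2) = 0.
  rewrite -contour_int_scal //; last exact: cont_on_pow.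
  transitivity ((/ (g 1%R - b)) ^ n.+1 - (/ (g 0%R - b)) ^ n.+1);
    last by case: hg => _ _ ->; ring.
  apply: is_cint_unique; apply: (@is_cint_deriv (fun r => (/ (g r - b)) ^ n.+1)) => t ht; last first.
    apply: ccont_mult; last exact: velocity_ccont.
    apply: ccont_mult; first exact: ccont_const.
    by apply: (cont_on_pow n.+2 hc).
  have hd : cderiv (fun r => / (g r - b)) t (- velocity g t * (/ (g t - b)) ^ 2).
    apply: cderiv_inv; last exact: not_on_curve.
    have := cderiv_plus (loop_cderiv t hg) (cderiv_const (- b) t).
    by rewrite (_ : velocity g t + 0 = velocity g t); last by ring.
  have := cderiv_pow n hd.
  rewrite (_ : INR n.+1 * (/ (g t - b)) ^ n * (- velocity g t * (/ (g t - b)) ^ 2) =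
    - INR n.+1 * (/ (g t - b)) ^ n.+2 * velocity g t) //.
  by rewrite /=; ring.
have h1 : - RtoC (INR n.+1) <> 0.
  by rewrite -RtoC_opp; apply: RtoC_neq0; apply: Ropp_neq_0_compat; exact: not_0_INR.
case: (Ceq_dec (contour_int g (fun z => (/ (z - b)) ^ n.+2)) 0) => // h2.
by case: (Cmult_neq_0 _ _ h1 h2).
Qed.

(** * Rational functions and winding numbers *)

Definition same_winding (g1 g2 : curve) (b : C) : Prop :=
  [/\ ~ on_curve g1 b, ~ on_curve g2 b & winding g1 b = winding g2 b].

Definition same_int (g1 g2 : curve) (F : C -> C) : Prop :=
  contour_int g1 F = contour_int g2 F.

Definition cont_on2 (g1 g2 : curve) (F : C -> C) : Prop := cont_on g1 F /\ cont_on g2 F.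

Definition poleprod (l : seq C) (z : C) : C := \big[Cmult/RtoC 1]_(b <- l) / (z - b).
Definition zeroprod (l : seq C) (z : C) : C := \big[Cmult/RtoC 1]_(b <- l) (z - b).

Fixpoint all_same_winding (g1 g2 : curve) (l : seq C) : Prop :=
  if l is b :: l' then same_winding g1 g2 b /\ all_same_winding g1 g2 l' else True.

Lemma same_int_lin g1 g2 c d F G :
  C1_loop g1 -> C1_loop g2 -> cont_on2 g1 g2 F -> cont_on2 g1 g2 G ->
  same_int g1 g2 F -> same_int g1 g2 G -> same_int g1 g2 (fun z => c * F z + d * G z).
Proof.
move=> h1 h2 [F1 F2] [G1 G2] eF eG; rewrite /same_int.
have A g (hg : C1_loop g) (hF : cont_on g F) (hG : cont_on g G) :
  contour_int g (fun z => c * F z + d * G z) = c * contour_int g F + d * contour_int g G.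
  rewrite contour_int_plus ?contour_int_scal //; apply: cont_on_mult => //; exact: cont_on_const.
by rewrite !A // eF eG.
Qed.

Lemma same_int_ext g1 g2 F G :
  (forall z, on_curve g1 z \/ on_curve g2 z -> F z = G z) ->
  same_int g1 g2 F -> same_int g1 g2 G.
Proof.
move=> h; rewrite /same_int => e.
rewrite -(@contour_int_ext g1 F) -1?(@contour_int_ext g2 F) //.
- by move=> t ht; apply: h; right; exists t.
- by move=> t ht; apply: h; left; exists t.
Qed.

Lemma same_winding_int g1 g2 b : same_winding g1 g2 b -> same_int g1 g2 (fun z => / (z - b)).
Proof.
case=> _ _; rewrite /winding /same_int => h.
have h2 : / (2 * PI * Ci) <> 0.
  apply: Cinv_neq0; apply: Cmult_neq_0; last by case; lra.
  apply: Cmult_neq_0; first by case; lra.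
  by apply: RtoC_neq0; have := PI_RGT_0; lra.
have : / (2 * PI * Ci) * (contour_int g1 (fun z => / (z - b)) - contour_int g2 (fun z => / (z - b))) = 0.
  by rewrite Cmult_plus_distr_l h; ring.
move=> e; apply/Ceq_minus.
case: (Ceq_dec (contour_int g1 (fun z => / (z - b)) - contour_int g2 (fun z => / (z - b))) 0) => // h3.
by case: (Cmult_neq_0 _ _ h2 h3).
Qed.

Lemma same_winding_neq g1 g2 b z : same_winding g1 g2 b -> on_curve g1 z \/ on_curve g2 z -> z - b <> 0.
Proof.
case=> a1 a2 _ [] [t [ht <-]]; exact: not_on_curve.
Qed.

Lemma cont_pole2 g1 g2 b : C1_loop g1 -> C1_loop g2 -> same_winding g1 g2 b ->
  cont_on2 g1 g2 (fun z => / (z - b)).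
Proof. by move=> h1 h2 [a1 a2 _]; split; apply: cont_on_pole. Qed.

Lemma cont_mult2 g1 g2 F G : cont_on2 g1 g2 F -> cont_on2 g1 g2 G ->
  cont_on2 g1 g2 (fun z => F z * G z).
Proof. by case=> a b [c d]; split; apply: cont_on_mult. Qed.

Lemma cont_poleprod g1 g2 l : C1_loop g1 -> C1_loop g2 -> all_same_winding g1 g2 l ->
  cont_on2 g1 g2 (poleprod l).
Proof.
move=> h1 h2; elim: l => [|b l IH] /=.
  move=> _; have -> : poleprod [::] = fun _ => 1.
    by apply: functional_extensionality => z; rewrite /poleprod big_nil.
  by split; apply: cont_on_const.
case=> hb /IH hl.
have -> : poleprod (b :: l) = fun z => / (z - b) * poleprod l z.
  by apply: functional_extensionality => z; rewrite /poleprod big_cons.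
by apply: cont_mult2 => //; apply: cont_pole2.
Qed.

Lemma cont_zeroprod g1 g2 l : C1_loop g1 -> C1_loop g2 -> cont_on2 g1 g2 (zeroprod l).
Proof.
move=> h1 h2; elim: l => [|b l IH] /=.
  have -> : zeroprod [::] = fun _ => 1.
    by apply: functional_extensionality => z; rewrite /zeroprod big_nil.
  by split; apply: cont_on_const.
have -> : zeroprod (b :: l) = fun z => (z - b) * zeroprod l z.
  by apply: functional_extensionality => z; rewrite /zeroprod big_cons.
by apply: cont_mult2 => //; split; apply: cont_on_sub.
Qed.

Lemma cont_pow2 g1 g2 F n : cont_on2 g1 g2 F -> cont_on2 g1 g2 (fun z => F z ^ n).
Proof. by case=> a b; split; apply: cont_on_pow. Qed.

(** Partial fractions. Two distinct factors are separated by
   1 / ((z - b) (z - c)) = (1 / (z - b) - 1 / (z - c)) / (b - c), which lowers the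
   number of factors. When all factors are equal, either there is a primitive or
   there is a single factor, whose integral is a winding number. *)
Lemma same_int_poles g1 g2 : C1_loop g1 -> C1_loop g2 ->
  forall m l b n, (n + size l <= m)%N -> same_winding g1 g2 b -> all_same_winding g1 g2 l ->
  same_int g1 g2 (fun z => (/ (z - b)) ^ n * poleprod l z).
Proof.
move=> h1 h2; elim=> [|m IHm].
  move=> l b n; rewrite leqn0 addn_eq0 => /andP[/eqP-> /nilP->] _ _.
  apply: (@same_int_ext _ _ (fun z => z ^ 0)); last by rewrite /same_int !contour_int_pow.
  by move=> z _; rewrite /poleprod big_nil /=; ring.
elim=> [|c l IHl] b n hm hb /=.
  move=> _; apply: (@same_int_ext _ _ (fun z => (/ (z - b)) ^ n)).
    by move=> z _; rewrite /poleprod big_nil /=; ring.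
  case: n {hm} => [|[|n]].
  - apply: (@same_int_ext _ _ (fun z => z ^ 0)); first by [].
    by rewrite /same_int !contour_int_pow.
  - apply: (@same_int_ext _ _ (fun z => / (z - b))); first by move=> z _ /=; ring.
    exact: same_winding_int.
  - by case: hb => a1 a2 _; rewrite /same_int !contour_int_invpow.
case=> hc hl.
have E z : poleprod (c :: l) z = / (z - c) * poleprod l z by rewrite /poleprod big_cons.
case: (Ceq_dec b c) => [ebc|nbc].
  apply: (@same_int_ext _ _ (fun z => (/ (z - b)) ^ n.+1 * poleprod l z)).
    by move=> z _; rewrite E ebc /=; ring.
  by apply: IHl => //; rewrite addSnnS.
case: n hm => [|n] hm.
  apply: (@same_int_ext _ _ (fun z => (/ (z - c)) ^ 1 * poleprod l z)).
    by move=> z _; rewrite E /=; ring.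
  exact: IHl.
apply: (@same_int_ext _ _ (fun z => (/ (b - c)) * ((/ (z - b)) ^ n.+1 * poleprod l z) +
   (- / (b - c)) * ((/ (z - b)) ^ n * poleprod (c :: l) z))).
  move=> z hz; rewrite E /=.
  have z1 := same_winding_neq hb hz; have z2 := same_winding_neq hc hz; have z3 := Csub_neq0 nbc.
  have {}E' : / (z - b) * / (z - c) = / (b - c) * / (z - b) - / (b - c) * / (z - c) by field.
  transitivity ((/ (z - b)) ^ n * poleprod l z * (/ (z - b) * / (z - c))); last by ring.
  by rewrite E'; ring.
apply: same_int_lin => //.
- by apply: cont_mult2; [apply: cont_pow2; apply: cont_pole2|apply: cont_poleprod].
- apply: cont_mult2; [apply: cont_pow2; apply: cont_pole2|apply: cont_poleprod] => //.
- by apply: IHm => //; rewrite -ltnS -addnS.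
- by apply: IHm => //; rewrite -ltnS.
Qed.

Lemma same_int_poly g1 g2 l n : C1_loop g1 -> C1_loop g2 ->
  same_int g1 g2 (fun z => z ^ n * zeroprod l z).
Proof.
move=> h1 h2; elim: l n => [|a l IH] n.
  apply: (@same_int_ext _ _ (fun z => z ^ n)); last by rewrite /same_int !contour_int_pow.
  by move=> z _; rewrite /zeroprod big_nil; ring.
apply: (@same_int_ext _ _ (fun z => 1 * (z ^ n.+1 * zeroprod l z) + (- a) * (z ^ n * zeroprod l z))).
  by move=> z _; rewrite /zeroprod big_cons /=; ring.
have hc k : cont_on2 g1 g2 (fun z => z ^ k * zeroprod l z).
  apply: cont_mult2; last exact: cont_zeroprod.
  by split; apply: cont_on_pow; apply: cont_on_id.
by apply: same_int_lin.
Qed.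

(** Cauchy's theorem for rational functions: a factor
   (z - a) / (z - b) = 1 + (b - a) / (z - b) is removed at each step. *)
Lemma same_int_rational g1 g2 l2 l1 : C1_loop g1 -> C1_loop g2 -> all_same_winding g1 g2 l2 ->
  same_int g1 g2 (fun z => zeroprod l1 z * poleprod l2 z).
Proof.
move=> h1 h2.
elim: l2 l1 => [|b l2 IH2].
  move=> l1 _; apply: (@same_int_ext _ _ (fun z => z ^ 0 * zeroprod l1 z)); last exact: same_int_poly.
  by move=> z _; rewrite /poleprod big_nil /=; ring.
elim=> [|a l1 IH1] [hb hl].
  apply: (@same_int_ext _ _ (fun z => (/ (z - b)) ^ 1 * poleprod l2 z)).
    by move=> z _; rewrite /zeroprod big_nil /poleprod big_cons /=; ring.
  by apply: (@same_int_poles _ _ h1 h2 (1 + size l2)).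
apply: (@same_int_ext _ _ (fun z => 1 * (zeroprod l1 z * poleprod l2 z) +
           (b - a) * (zeroprod l1 z * poleprod (b :: l2) z))).
  move=> z hz; have z1 := same_winding_neq hb hz.
  rewrite /zeroprod /poleprod !big_cons -/(zeroprod l1 z) -/(poleprod l2 z).
  by field.
apply: same_int_lin => //.
- by apply: cont_mult2; [apply: cont_zeroprod|apply: cont_poleprod].
- by apply: cont_mult2; [apply: cont_zeroprod|apply: cont_poleprod].
- exact: IH2.
- exact: IH1.
Qed.

(** * Uniform limits *)

Lemma ccont_Cmod f t : ccont f t -> continuous (fun r => Cmod (f r)) t.
Proof.
case=> a b; apply: (continuous_comp (fun r => (Re (f r) ^ 2 + Im (f r) ^ 2)%R) sqrt).
  apply: cont_plusR => /=; do 2![apply: cont_multR => //]; exact: continuous_const.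
exact: continuous_sqrt.
Qed.

Lemma ccont_bounded f : (forall t, (0 <= t <= 1)%R -> ccont f t) ->
  exists M, (0 < M)%R /\ forall t, (0 <= t <= 1)%R -> (Cmod (f t) <= M)%R.
Proof.
move=> h.
have [] := @continuity_ab_maj (fun r => Cmod (f r)) 0 1; first lra.
  by move=> c hc; apply/continuity_pt_filterlim; apply: ccont_Cmod; apply: h.
move=> m [hm _]; exists (Cmod (f m) + 1)%R; split; first by have := Cmod_ge_0 (f m); lra.
by move=> t /hm; lra.
Qed.

Lemma ccont_bounded_below f : (forall t, (0 <= t <= 1)%R -> ccont f t /\ f t <> 0) ->
  exists d, (0 < d)%R /\ forall t, (0 <= t <= 1)%R -> (d <= Cmod (f t))%R.
Proof.
move=> h.
have [] := @continuity_ab_min (fun r => Cmod (f r)) 0 1; first lra.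
  by move=> c hc; apply/continuity_pt_filterlim; apply: ccont_Cmod; case: (h c hc).
move=> m [hm hm1]; exists (Cmod (f m)); split=> //.
by apply/Cmod_gt_0; case: (h m hm1).
Qed.

Definition on2 (g1 g2 : curve) (z : C) : Prop := on_curve g1 z \/ on_curve g2 z.

Lemma bounded2 g1 g2 F : cont_on2 g1 g2 F ->
  exists M, (0 < M)%R /\ forall z, on2 g1 g2 z -> (Cmod (F z) <= M)%R.
Proof.
case=> /ccont_bounded [M1 [h1 b1]] /ccont_bounded [M2 [h2 b2]].
exists (M1 + M2)%R; split; first lra.
by move=> z [] [t [ht <-]]; [have := b1 t ht|have := b2 t ht]; lra.
Qed.

Lemma bounded_below2 g1 g2 F : cont_on2 g1 g2 F -> (forall z, on2 g1 g2 z -> F z <> 0) ->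
  exists d, (0 < d)%R /\ forall z, on2 g1 g2 z -> (d <= Cmod (F z))%R.
Proof.
case=> c1 c2 hF.
have [d1 [h1 b1]] := @ccont_bounded_below (fun t => F (g1 t)) (fun t ht =>
   conj (c1 t ht) (hF _ (or_introl (ex_intro _ t (conj ht erefl))))).
have [d2 [h2 b2]] := @ccont_bounded_below (fun t => F (g2 t)) (fun t ht =>
   conj (c2 t ht) (hF _ (or_intror (ex_intro _ t (conj ht erefl))))).
exists (Rmin d1 d2); split; first exact: Rmin_pos.
move=> z [] [t [ht <-]].
  by apply: Rle_trans (Rmin_l _ _) _; apply: b1.
by apply: Rle_trans (Rmin_r _ _) _; apply: b2.
Qed.

Lemma contour_int_close g F G e : C1_loop g -> cont_on g F -> cont_on g G -> (0 <= e)%R ->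
  (forall z, on_curve g z -> Cmod (F z - G z) <= e)%R ->
  forall M, (forall t, (0 <= t <= 1)%R -> (Cmod (velocity g t) <= M)%R) ->
  (Cmod (contour_int g F - contour_int g G) <= 2 * (e * M))%R.
Proof.
move=> hg hF hG he h M hM.
have hI := is_cint_plus (is_contour_int hg hF) (is_cint_scal (-1) (is_contour_int hg hG)).
have -> : contour_int g F - contour_int g G = contour_int g F + -1 * contour_int g G by ring.
apply: cint_bound hI _ => t ht.
have -> : F (g t) * velocity g t + -1 * (G (g t) * velocity g t) =
          (F (g t) - G (g t)) * velocity g t by ring.
rewrite Cmod_mult; apply: Rmult_le_compat; try exact: Cmod_ge_0.
  by apply: h; exists t.
exact: hM.
Qed.

Lemma Cmod_small_eq0 z M : (forall e, (0 < e)%R -> (Cmod z <= e * M)%R) -> z = 0.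
Proof.
move=> h; apply: Cmod_eq_0.
have h0 := Cmod_ge_0 z; have h1 := Rabs_pos M; have h2 := Rle_abs M.
case: (Rle_lt_dec (Cmod z) 0) => hz; first lra.
have he : (0 < Cmod z / (2 * (Rabs M + 1)))%R by apply: Rdiv_lt_0_compat; lra.
have := h _ he.
have : (Cmod z / (2 * (Rabs M + 1)) * M <= Cmod z / (2 * (Rabs M + 1)) * (Rabs M + 1))%R.
  by apply: Rmult_le_compat_l; lra.
have -> : (Cmod z / (2 * (Rabs M + 1)) * (Rabs M + 1) = Cmod z / 2)%R by field; lra.
lra.
Qed.

(** The velocities are bounded, so uniform convergence on the curves is enough. *)
Lemma same_int_limit g1 g2 F : C1_loop g1 -> C1_loop g2 -> cont_on2 g1 g2 F ->
  (forall e, (0 < e)%R -> exists G, [/\ cont_on2 g1 g2 G, same_int g1 g2 G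
      & forall z, on2 g1 g2 z -> (Cmod (F z - G z) <= e)%R]) ->
  same_int g1 g2 F.
Proof.
move=> hg1 hg2 [F1 F2] h.
have [M1 [_ m1]] := @ccont_bounded (velocity g1) (fun t _ => velocity_ccont t hg1).
have [M2 [_ m2]] := @ccont_bounded (velocity g2) (fun t _ => velocity_ccont t hg2).
apply/Ceq_minus; apply: (@Cmod_small_eq0 _ (2 * M1 + 2 * M2)) => e he.
have [G [[G1 G2] eG hG]] := h e he.
have b1 := contour_int_close hg1 F1 G1 (Rlt_le _ _ he) (fun z hz => hG z (or_introl hz)) m1.
have b2 := contour_int_close hg2 F2 G2 (Rlt_le _ _ he) (fun z hz => hG z (or_intror hz)) m2.
have -> : contour_int g1 F - contour_int g2 F =
  (contour_int g1 F - contour_int g1 G) + - (contour_int g2 F - contour_int g2 G).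
  by rewrite eG; ring.
by apply: Rle_trans (Cmod_triangle _ _) _; rewrite Cmod_opp; lra.
Qed.

(** * Functions approximated by rational functions *)

Definition ratfun c l1 l2 (z : C) : C := c * (zeroprod l1 z * poleprod l2 z).

Definition rat_on (g1 g2 : curve) (F : C -> C) : Prop :=
  exists c l1 l2, all_same_winding g1 g2 l2 /\ forall z, on2 g1 g2 z -> F z = ratfun c l1 l2 z.

(** The rational approximants may have poles only at points around which the two
   curves have the same winding number. Such functions form an algebra under
   products, and Cauchy's theorem passes to them by uniform convergence. *)
Definition tame (g1 g2 : curve) (F : C -> C) : Prop :=
  cont_on2 g1 g2 F /\
  forall e, (0 < e)%R -> exists R, rat_on g1 g2 R /\
     forall z, on2 g1 g2 z -> (Cmod (F z - R z) <= e)%R.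

Lemma cont_const2 g1 g2 c : cont_on2 g1 g2 (fun _ => c).
Proof. by split; apply: cont_on_const. Qed.

Lemma tame_same_int g1 g2 F : C1_loop g1 -> C1_loop g2 -> tame g1 g2 F -> same_int g1 g2 F.
Proof.
move=> h1 h2 [hc h]; apply: same_int_limit => // e he.
have [R [[c [l1 [l2 [hl hR]]]] hd]] := h e he.
have hz : cont_on2 g1 g2 (fun z => zeroprod l1 z * poleprod l2 z).
  by apply: cont_mult2; [apply: cont_zeroprod|apply: cont_poleprod].
exists (ratfun c l1 l2); split.
- by apply: cont_mult2 => //; apply: cont_const2.
- apply: (@same_int_ext _ _ (fun z => c * (zeroprod l1 z * poleprod l2 z) + 0 * (zeroprod l1 z * poleprod l2 z))).
    by move=> z _; rewrite /ratfun; ring.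
  by apply: same_int_lin => //; apply: same_int_rational.
- by move=> z hz'; rewrite -hR //; apply: hd.
Qed.

Lemma all_same_winding_cat g1 g2 l l' : all_same_winding g1 g2 l -> all_same_winding g1 g2 l' -> all_same_winding g1 g2 (l ++ l').
Proof. by elim: l => [|b l IH] //= [hb hl] hl'; split=> //; apply: IH. Qed.

Lemma rat_on_const g1 g2 c : rat_on g1 g2 (fun _ => c).
Proof.
by exists c, [::], [::]; split=> // z _; rewrite /ratfun /zeroprod /poleprod !big_nil; ring.
Qed.

Lemma rat_on_mult g1 g2 F G : rat_on g1 g2 F -> rat_on g1 g2 G ->
  rat_on g1 g2 (fun z => F z * G z).
Proof.
case=> c [l1 [l2 [hl e]]] [c' [l1' [l2' [hl' e']]]].
exists (c * c'), (l1 ++ l1'), (l2 ++ l2'); split; first exact: all_same_winding_cat.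
move=> z hz; rewrite e // e' // /ratfun /zeroprod /poleprod !big_cat /=; ring.
Qed.

Lemma rat_on_sub g1 g2 a : rat_on g1 g2 (fun z => z - a).
Proof.
by exists 1, [:: a], [::]; split=> // z _; rewrite /ratfun /zeroprod /poleprod big_seq1 big_nil; ring.
Qed.

Lemma rat_on_pole g1 g2 b : same_winding g1 g2 b -> rat_on g1 g2 (fun z => / (z - b)).
Proof.
move=> hb; exists 1, [::], [:: b]; split=> // z _; rewrite /ratfun /zeroprod /poleprod big_seq1 big_nil; ring.
Qed.

Lemma rat_on_ext g1 g2 F G : (forall z, on2 g1 g2 z -> F z = G z) -> rat_on g1 g2 F -> rat_on g1 g2 G.
Proof.
move=> h [c [l1 [l2 [hl e]]]]; exists c, l1, l2; split=> // z hz; rewrite -h //; exact: e.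
Qed.

Lemma rat_on_prod g1 g2 (F : nat -> C -> C) n : (forall k, rat_on g1 g2 (F k)) ->
  rat_on g1 g2 (fun z => \big[Cmult/RtoC 1]_(k < n) F k z).
Proof.
move=> h; elim: n => [|n IH].
  by apply: rat_on_ext (rat_on_const _ _ 1) => z _; rewrite big_ord0.
apply: rat_on_ext (rat_on_mult IH (h n)) => z _; by rewrite big_ord_recr.
Qed.

Lemma tame_ratcont g1 g2 F : cont_on2 g1 g2 F -> rat_on g1 g2 F -> tame g1 g2 F.
Proof.
move=> hc hr; split=> // e he; exists F; split=> // z _.
have -> : F z - F z = 0 by ring.
by rewrite Cmod_0; lra.
Qed.

Lemma tame_const g1 g2 c : tame g1 g2 (fun _ => c).
Proof. by apply: tame_ratcont; [apply: cont_const2|apply: rat_on_const]. Qed.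

Lemma tame_id g1 g2 : C1_loop g1 -> C1_loop g2 -> tame g1 g2 (fun z => z).
Proof.
move=> h1 h2; apply: tame_ratcont; first by split; apply: cont_on_id.
by apply: rat_on_ext (rat_on_sub g1 g2 0) => z _; ring.
Qed.

Lemma tame_pole g1 g2 b : C1_loop g1 -> C1_loop g2 -> same_winding g1 g2 b ->
  tame g1 g2 (fun z => / (z - b)).
Proof. by move=> h1 h2 hb; apply: tame_ratcont; [apply: cont_pole2|apply: rat_on_pole]. Qed.

Lemma tame_mult g1 g2 F G : tame g1 g2 F -> tame g1 g2 G -> tame g1 g2 (fun z => F z * G z).
Proof.
case=> cF hF [cG hG]; split; first exact: cont_mult2.
have [M [M0 hM]] := bounded2 cF; have [L [L0 hL]] := bounded2 cG.
move=> e he.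
have d0 : (0 < Rmin 1 (e / (M + L + 1)))%R.
  by apply: Rmin_pos; [lra|apply: Rdiv_lt_0_compat; lra].
have [R [rR dR]] := hF _ d0; have [S [rS dS]] := hG _ d0.
exists (fun z => R z * S z); split; first exact: rat_on_mult.
move=> z hz.
have -> : F z * G z - R z * S z = F z * (G z - S z) + (F z - R z) * (G z + - (G z - S z)) by ring.
apply: Rle_trans (Cmod_triangle _ _) _; rewrite !Cmod_mult.
set d := Rmin 1 _ in d0 dR dS.
have d1 : (d <= 1)%R by apply: Rmin_l.
have d2 : (d * (M + L + 1) <= e)%R.
  have : (d <= e / (M + L + 1))%R by apply: Rmin_r.
  move=> h; apply: Rle_trans (Rmult_le_compat_r (M + L + 1) _ _ _ h) _; first lra.
  by right; field; lra.
have t1 : (Cmod (G z + - (G z - S z)) <= L + 1)%R.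
  apply: Rle_trans (Cmod_triangle _ _) _; rewrite Cmod_opp.
  by have := hL z hz; have := dS z hz; lra.
have a1 : (Cmod (F z) * Cmod (G z - S z) <= M * d)%R.
  by apply: Rmult_le_compat; try exact: Cmod_ge_0; [apply: hM|apply: dS].
have a2 : (Cmod (F z - R z) * Cmod (G z + - (G z - S z)) <= d * (L + 1))%R.
  by apply: Rmult_le_compat; try exact: Cmod_ge_0; [apply: dR|].
by apply: Rle_trans (Rplus_le_compat _ _ _ _ a1 a2) _; lra.
Qed.

(** * The infinite product (a;p)_oo *)

Definition pprod (p : R) (a : C) (n : nat) : C := \big[Cmult/RtoC 1]_(k < n) (1 - a * p ^ k).

Lemma pprodS p a n : pprod p a n.+1 = pprod p a n * (1 - a * p ^ n).
Proof. by rewrite /pprod big_ord_recr. Qed.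

Lemma pprodSl p a n : pprod p a n.+1 = (1 - a) * pprod p (a * p) n.
Proof.
rewrite /pprod big_ord_recl; congr Cmult; first by rewrite Cmult_1_r.
by apply: eq_bigr => i _; rewrite lift0 /=; ring.
Qed.

(** Since exp (M / (1 - p)) bounds all partial products (a;p)_n with |a| <= M, the
   tail of their telescoping series is at most a geometric series with this constant. *)
Definition qconst (p M : R) : R := (exp (M / (1 - p)) * M / (1 - p))%R.

Lemma Cmod_powR (p : R) n : (0 < p)%R -> Cmod (p ^ n) = (p ^ n)%R.
Proof. by move=> hp; rewrite Cmod_pow Cmod_R Rabs_right //; lra. Qed.

Lemma pprod_bound p a M n : (0 < p < 1)%R -> (Cmod a <= M)%R ->
  (Cmod (pprod p a n) <= exp (M * (1 - p ^ n) / (1 - p)))%R.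
Proof.
move=> hp ha; elim: n => [|n IH].
  rewrite /pprod big_ord0 Cmod_1 /=.
  rewrite (_ : (M * (1 - 1) / (1 - p) = 0)%R); last by field; lra.
  by rewrite exp_0; lra.
rewrite pprodS Cmod_mult.
have -> : (M * (1 - p ^ n.+1) / (1 - p) = M * (1 - p ^ n) / (1 - p) + M * p ^ n)%R.
  by rewrite /=; field; lra.
rewrite exp_plus; apply: Rmult_le_compat; try exact: Cmod_ge_0; first exact: IH.
have hpn : (0 < p ^ n)%R by apply: pow_lt; lra.
apply: Rle_trans (Cmod_triangle _ _) _.
rewrite Cmod_opp Cmod_1 Cmod_mult Cmod_powR; last lra.
have := exp_ineq1_le (M * p ^ n)%R.
have : (Cmod a * p ^ n <= M * p ^ n)%R by apply: Rmult_le_compat_r; lra.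
lra.
Qed.

Lemma pprod_cauchy p a M n m : (0 < p < 1)%R -> (Cmod a <= M)%R ->
  (Cmod (pprod p a (n + m) - pprod p a n) <= qconst p M * p ^ n)%R.
Proof.
move=> hp ha.
have hM : (0 <= M)%R by have := Cmod_ge_0 a; lra.
have hpn k : (0 < p ^ k)%R by apply: pow_lt; lra.
have hE : (0 < exp (M / (1 - p)))%R by apply: exp_pos.
suff h : (Cmod (pprod p a (n + m) - pprod p a n) <= qconst p M * (p ^ n - p ^ (n + m)))%R.
  apply: Rle_trans h _; apply: Rmult_le_compat_l; last by have := hpn (n + m)%N; lra.
  by apply: Rmult_le_pos; [apply: Rmult_le_pos; lra|left; apply: Rinv_0_lt_compat; lra].
elim: m => [|m IH].
  rewrite addn0 (_ : pprod p a n - pprod p a n = 0); last by ring.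
  by rewrite Cmod_0; right; ring.
have -> : pprod p a (n + m.+1) - pprod p a n =
  (pprod p a (n + m) - pprod p a n) + - (pprod p a (n + m) * (a * p ^ (n + m))).
  by rewrite addnS pprodS; ring.
apply: Rle_trans (Cmod_triangle _ _) _.
rewrite Cmod_opp !Cmod_mult Cmod_powR; last lra.
have b1 : (Cmod (pprod p a (n + m)) <= exp (M / (1 - p)))%R.
  apply: Rle_trans (pprod_bound _ hp ha) _.
  have : (M * (1 - p ^ (n + m)) / (1 - p) <= M / (1 - p))%R.
    apply: Rmult_le_compat_r; first by left; apply: Rinv_0_lt_compat; lra.
    have := Rmult_le_compat_l M _ _ hM (Rlt_le _ _ (hpn (n + m)%N)); lra.
  by case=> [/exp_increasing|->]; lra.
have b2 : (Cmod (pprod p a (n + m)) * (Cmod a * p ^ (n + m)) <= exp (M / (1 - p)) * (M * p ^ (n + m)))%R.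
  have := hpn (n + m)%N => hh.
  apply: Rmult_le_compat => //; first exact: Cmod_ge_0.
    by apply: Rmult_le_pos; [exact: Cmod_ge_0|lra].
  by apply: Rmult_le_compat_r; lra.
have -> : (qconst p M * (p ^ n - p ^ (n + m.+1)) =
  qconst p M * (p ^ n - p ^ (n + m)) + exp (M / (1 - p)) * (M * p ^ (n + m)))%R.
  by rewrite /qconst addnS /=; field; lra.
lra.
Qed.

Lemma qconst_ge0 p M : (0 < p < 1)%R -> (0 <= M)%R -> (0 <= qconst p M)%R.
Proof.
move=> hp hM; rewrite /qconst /Rdiv.
have := exp_pos (M * / (1 - p))%R => hE.
by apply: Rmult_le_pos; [apply: Rmult_le_pos; lra|left; apply: Rinv_0_lt_compat; lra].
Qed.

Lemma geom_small p K e : (0 < p < 1)%R -> (0 <= K)%R -> (0 < e)%R ->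
  exists n, forall m, (n <= m)%N -> (K * p ^ m < e)%R.
Proof.
move=> hp hK he.
have [n hn] := pow_lt_1_zero p ltac:(rewrite Rabs_right; lra) (e / (K + 1)) ltac:(apply: Rdiv_lt_0_compat; lra).
exists n => m hm; have := hn m (leP hm).
have hpm : (0 < p ^ m)%R by apply: pow_lt; lra.
rewrite Rabs_right; last lra.
move=> h; have : (p ^ m * (K + 1) < e / (K + 1) * (K + 1))%R by apply: Rmult_lt_compat_r; lra.
have -> : (e / (K + 1) * (K + 1) = e)%R by field; lra.
lra.
Qed.

Lemma Clim_seq_cauchy (w : nat -> C) p K : (0 < p < 1)%R -> (0 <= K)%R ->
  (forall n m, Cmod (w (n + m)%N - w n) <= K * p ^ n)%R ->
  forall n, (Cmod (Clim_seq w - w n) <= 2 * (K * p ^ n))%R.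
Proof.
move=> hp hK hw.
have key (u : nat -> R) : (forall n m, Rabs (u (n + m)%N - u n) <= K * p ^ n)%R ->
    forall n, (Rabs (real (Lim_seq u) - u n) <= K * p ^ n)%R.
  move=> hu.
  have [l hl] : ex_finite_lim_seq u.
    apply/ex_lim_seq_cauchy_corr => e.
    have [n hn] := @geom_small p (2 * K) e hp ltac:(lra) (cond_pos e).
    exists n => i j /leP hi /leP hj.
    have h1 := hu n (i - n)%N; have h2 := hu n (j - n)%N.
    rewrite !subnKC // in h1 h2.
    have := hn n (leqnn n) => h3.
    have -> : (u i - u j = (u i - u n) + - (u j - u n))%R by ring.
    apply: Rle_lt_trans (Rabs_triang _ _) _; rewrite Rabs_Ropp; lra.
  rewrite (is_lim_seq_unique _ _ hl) /= => n.
  have h1 : is_lim_seq (fun m => Rabs (u (n + m)%N - u n)) (Rabs (l - u n)).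
    apply: (is_lim_seq_abs _ (Finite (l - u n))).
    apply: is_lim_seq_minus'; last exact: is_lim_seq_const.
    apply: (is_lim_seq_ext (fun m => u (m + n)%N)); first by move=> m; rewrite addnC.
    exact/(is_lim_seq_incr_n u n).
  exact: (is_lim_seq_le _ _ (Rabs (l - u n)) (K * p ^ n)%R (hu n) h1 (is_lim_seq_const _)).
move=> n.
have h1 := key (fun n => Re (w n)) (fun n m => Rle_trans _ _ _
   (Rle_trans _ _ _ (Rmax_l _ _) (Rmax_Cmod (w (n + m)%N - w n))) (hw n m)) n.
have h2 := key (fun n => Im (w n)) (fun n m => Rle_trans _ _ _
   (Rle_trans _ _ _ (Rmax_r _ _) (Rmax_Cmod (w (n + m)%N - w n))) (hw n m)) n.
set z := Clim_seq w - w n.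
have -> : z = RtoC (Re z) + RtoC (Im z) * Ci by apply: C_ext => /=; ring.
apply: Rle_trans (Cmod_triangle _ _) _.
rewrite Cmod_mult !Cmod_R.
have -> : Cmod Ci = 1%R by rewrite /Cmod /= -[RHS]sqrt_1; congr sqrt; ring.
rewrite Rmult_1_r; change (Re z) with (Lim_seq (fun n => Re (w n)) - Re (w n))%R.
change (Im z) with (Lim_seq (fun n => Im (w n)) - Im (w n))%R.
lra.
Qed.

(** The constant depends on a bound M for a only: convergence is locally uniform. *)
Lemma qpoch_close p a M n : (0 < p < 1)%R -> (Cmod a <= M)%R ->
  (Cmod (qpoch p a - pprod p a n) <= 2 * (qconst p M * p ^ n))%R.
Proof.
move=> hp ha.
have hM : (0 <= M)%R by have := Cmod_ge_0 a; lra.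
apply: (Clim_seq_cauchy hp (qconst_ge0 hp hM)) => i j.
exact: pprod_cauchy.
Qed.

Lemma qpoch_unique p a l K : (0 < p < 1)%R -> (0 <= K)%R ->
  (forall n, Cmod (l - pprod p a n.+1) <= K * p ^ n)%R -> qpoch p a = l.
Proof.
move=> hp hK hl.
have hM := Cmod_ge_0 a; have hQ := qconst_ge0 hp hM.
apply/Ceq_minus; apply: (@Cmod_small_eq0 _ 1) => e he.
have [n hn] := @geom_small p (2 * qconst p (Cmod a) + K) e hp ltac:(lra) he.
have -> : qpoch p a - l = (qpoch p a - pprod p a n.+1) + - (l - pprod p a n.+1) by ring.
apply: Rle_trans (Cmod_triangle _ _) _; rewrite Cmod_opp.
have h1 := hn n (leqnn n); have h2 := @qpoch_close p a _ n.+1 hp (Rle_refl _); have h3 := hl n.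
have : (qconst p (Cmod a) * p ^ n.+1 <= qconst p (Cmod a) * p ^ n)%R.
  apply: Rmult_le_compat_l => //=; have : (0 < p ^ n)%R by apply: pow_lt; lra.
  by nra.
lra.
Qed.

Lemma qpoch_shift p a : (0 < p < 1)%R -> qpoch p a = (1 - a) * qpoch p (a * p).
Proof.
move=> hp.
have hM := Cmod_ge_0 (a * p); have h1 := Cmod_ge_0 (1 - a).
apply: (@qpoch_unique p a _ (Cmod (1 - a) * (2 * qconst p (Cmod (a * p))))) => //.
  by apply: Rmult_le_pos => //; have := qconst_ge0 hp hM; lra.
move=> n; rewrite pprodSl.
have -> : (1 - a) * qpoch p (a * p) - (1 - a) * pprod p (a * p) n =
  (1 - a) * (qpoch p (a * p) - pprod p (a * p) n) by ring.
rewrite Cmod_mult Rmult_assoc.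
apply: Rmult_le_compat_l => //; rewrite Rmult_assoc; exact: (qpoch_close n hp (Rle_refl _)).
Qed.

Lemma qpoch_down p a n : (0 < p < 1)%R -> qpoch p a = pprod p a n * qpoch p (a * p ^ n).
Proof.
move=> hp; elim: n => [|n IH].
  by rewrite /pprod big_ord0 /= (_ : a * 1 = a); [ring|ring].
rewrite IH (qpoch_shift _ hp) pprodS.
rewrite (_ : a * p ^ n * p = a * p ^ n.+1); last by rewrite /=; ring.
ring.
Qed.

Lemma Cconj_prod (I : Type) (r : seq I) (F : I -> C) :
  Cconj (\big[Cmult/RtoC 1]_(i <- r) F i) = \big[Cmult/RtoC 1]_(i <- r) Cconj (F i).
Proof.
apply: (big_morph Cconj); first by move=> a b; rewrite Cmult_conj.
by apply: C_ext => /=; ring.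
Qed.

Lemma Cconj_R (r : R) : Cconj r = r.
Proof. by apply: C_ext => /=; ring. Qed.

Lemma qpoch_conj p a : (0 < p < 1)%R -> Cconj (qpoch p a) = qpoch p (Cconj a).
Proof.
move=> hp; symmetry.
have hM := Cmod_ge_0 a; have hQ := qconst_ge0 hp hM.
apply: (@qpoch_unique p _ _ (2 * qconst p (Cmod a))) => //; first lra.
move=> n.
have -> : pprod p (Cconj a) n.+1 = Cconj (pprod p a n.+1).
  by rewrite /pprod Cconj_prod; apply: eq_bigr => i _;
    rewrite Cminus_conj Cmult_conj Cpow_conj !Cconj_R.
rewrite -Cminus_conj Cmod_conj.
apply: Rle_trans (@qpoch_close p a _ n.+1 hp (Rle_refl _)) _.
have : (qconst p (Cmod a) * p ^ n.+1 <= qconst p (Cmod a) * p ^ n)%R.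
  apply: Rmult_le_compat_l => //=; have : (0 < p ^ n)%R by apply: pow_lt; lra.
  by nra.
lra.
Qed.

Lemma Cmod_sub_ge (z w : C) : (Cmod z - Cmod w <= Cmod (z - w))%R.
Proof.
have := Cmod_triangle (z - w) w.
by rewrite (_ : z - w + w = z); [lra|ring].
Qed.

(** The Weierstrass product inequality: a product of factors 1 - b_k is at least 1 - sum b_k. *)
Lemma pprod_lower p a n : (0 < p < 1)%R -> (Cmod a <= (1 - p) / 2)%R ->
  (1 - Cmod a * (1 - p ^ n) / (1 - p) <= Cmod (pprod p a n))%R.
Proof.
move=> hp ha; have ha0 := Cmod_ge_0 a.
have hS k : (Cmod a * (1 - p ^ k) / (1 - p) <= / 2)%R.
  have hpk : (0 < p ^ k)%R by apply: pow_lt; lra.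
  have : (Cmod a * (1 - p ^ k) <= (1 - p) / 2)%R by nra.
  move=> /(Rmult_le_compat_r (/ (1 - p)) _ _ (Rlt_le _ _ (Rinv_0_lt_compat (1 - p) ltac:(lra)))).
  by have -> : ((1 - p) / 2 * / (1 - p) = / 2)%R by field; lra.
elim: n => [|n IH].
  rewrite /pprod big_ord0 Cmod_1 /=.
  rewrite (_ : (Cmod a * (1 - 1) / (1 - p) = 0)%R); last by field; lra.
  lra.
rewrite pprodS Cmod_mult.
have hpn : (0 < p ^ n)%R by apply: pow_lt; lra.
have hpn1 : (p ^ n <= 1)%R by rewrite -(pow1 n); apply: pow_incr; lra.
have h1 : (1 - Cmod a * p ^ n <= Cmod (1 - a * p ^ n))%R.
  by have := Cmod_sub_ge 1 (a * p ^ n); rewrite Cmod_mult Cmod_1 Cmod_powR //; lra.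
have -> : (Cmod a * (1 - p ^ n.+1) / (1 - p) = Cmod a * (1 - p ^ n) / (1 - p) + Cmod a * p ^ n)%R.
  by rewrite /=; field; lra.
move: IH (hS n); set S := (Cmod a * (1 - p ^ n) / (1 - p))%R => IH hSn.
have hS0 : (0 <= S)%R.
  by apply: Rmult_le_pos; [apply: Rmult_le_pos; lra|left; apply: Rinv_0_lt_compat; lra].
set d := (Cmod a * p ^ n)%R in h1 *.
have hd : (0 <= d <= 1)%R by rewrite /d; nra.
have : ((1 - S) * (1 - d) <= Cmod (pprod p a n) * Cmod (1 - a * p ^ n))%R.
  by apply: Rmult_le_compat; lra.
nra.
Qed.

(** Finitely many factors are split off; the remaining b = a p^n is so small that the
   Weierstrass inequality keeps the modulus of all its partial products at least 1/2. *)
Lemma qpoch_neq0 p a : (0 < p < 1)%R -> (forall k, a * p ^ k <> 1) -> qpoch p a <> 0.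
Proof.
move=> hp ha.
have [n hn] := @geom_small p (Cmod a) ((1 - p) / 2) hp (Cmod_ge_0 a) ltac:(lra).
rewrite (qpoch_down a n hp); apply: Cmult_neq_0.
  elim: (n) => [|k IH]; first by rewrite /pprod big_ord0 => /RtoC_inj; lra.
  by rewrite pprodS; apply: Cmult_neq_0 => //; apply: Csub_neq0 => e; apply: (ha k).
set b := a * p ^ n.
have hb : (Cmod b <= (1 - p) / 2)%R.
  by rewrite /b Cmod_mult Cmod_powR; [left; apply: hn|lra].
have hQ := qconst_ge0 hp (Cmod_ge_0 b).
have [m hm] := @geom_small p (2 * qconst p (Cmod b)) (/ 4) hp ltac:(lra) ltac:(lra).
move=> e0.
have h1 := @qpoch_close p b _ m hp (Rle_refl _).
have h2 := pprod_lower m hp hb.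
have h3 := hm m (leqnn m).
rewrite e0 (_ : 0 - pprod p b m = - pprod p b m) in h1; last by ring.
rewrite Cmod_opp in h1.
have hpm : (0 < p ^ m)%R by apply: pow_lt; lra.
have : (Cmod b * (1 - p ^ m) / (1 - p) <= / 2)%R.
  have : (Cmod b * (1 - p ^ m) <= (1 - p) / 2)%R by have := Cmod_ge_0 b; nra.
  move=> /(Rmult_le_compat_r (/ (1 - p)) _ _ (Rlt_le _ _ (Rinv_0_lt_compat (1 - p) ltac:(lra)))).
  by have -> : ((1 - p) / 2 * / (1 - p) = / 2)%R by field; lra.
lra.
Qed.

(** * Rational approximation of infinite products *)

Lemma cont_unifR (u : R -> R) t :
  (forall e, (0 < e)%R -> exists v, continuous v t /\ locally t (fun r => (Rabs (u r - v r) <= e)%R)) ->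
  continuous u t.
Proof.
move=> h; apply/filterlim_locally => eps.
have he : (0 < eps / 4)%R by have := cond_pos eps; lra.
have [v [hv hl]] := h _ he.
have h0 := locally_singleton _ _ hl.
have hb := (proj1 (@filterlim_locally _ _ (locally t) (@filter_filter _ _ (locally_filter t)) v (v t)) hv (mkposreal _ he)).
apply: (@filter_imp _ _ (@filter_filter _ _ (locally_filter t)) _ _ _ (@filter_and _ _ (@filter_filter _ _ (locally_filter t)) _ _ hl hb)) => r [h1 h2].
rewrite /ball /= /AbsRing_ball /= /abs /minus /plus /opp /= in h2 *.
have -> : (u r + - u t = (u r - v r) + (v r + - v t) + - (u t - v t))%R by ring.
apply: Rle_lt_trans (Rabs_triang _ _) _.
have := Rabs_triang (u r - v r) (v r + - v t).
rewrite Rabs_Ropp; have := cond_pos eps; lra.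
Qed.

Lemma ccont_unif (F : R -> C) t :
  (forall e, (0 < e)%R -> exists G, ccont G t /\ locally t (fun r => (Cmod (F r - G r) <= e)%R)) ->
  ccont F t.
Proof.
move=> h; split; apply: cont_unifR => e /h [G [[c1 c2] hl]].
  exists (fun r => Re (G r)); split=> //; apply: (@filter_imp _ _ (@filter_filter _ _ (locally_filter t)) _ _ _ hl) => r.
  by apply: Rle_trans; apply: Rle_trans (Rmax_Cmod _); apply: Rmax_l.
exists (fun r => Im (G r)); split=> //; apply: (@filter_imp _ _ (@filter_filter _ _ (locally_filter t)) _ _ _ hl) => r.
by apply: Rle_trans; apply: Rle_trans (Rmax_Cmod _); apply: Rmax_r.
Qed.

Lemma ccont_pprod p f n t : ccont f t -> ccont (fun r => pprod p (f r) n) t.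
Proof.
move=> hf; elim: n => [|n IH].
  by apply: ccont_ext (ccont_const 1 t) => r; rewrite /pprod big_ord0.
apply: (@ccont_ext (fun r => pprod p (f r) n * (1 - f r * p ^ n))).
  by move=> r; rewrite pprodS.
apply: ccont_mult => //; apply: ccont_minus; first exact: ccont_const.
by apply: ccont_mult => //; apply: ccont_const.
Qed.

Lemma ccont_qpoch p f t : (0 < p < 1)%R -> ccont f t -> ccont (fun r => qpoch p (f r)) t.
Proof.
move=> hp hf; apply: ccont_unif => e he.
have hM := Cmod_ge_0 (f t).
have hQ : (0 <= qconst p (Cmod (f t) + 1))%R by apply: qconst_ge0 => //; lra.
have [n hn] := @geom_small p (2 * qconst p (Cmod (f t) + 1)) e hp ltac:(lra) he.
exists (fun r => pprod p (f r) n); split; first exact: ccont_pprod.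
have hl := proj1 (@filterlim_locally _ _ (locally t) (@filter_filter _ _ (locally_filter t)) _ _) (ccont_Cmod hf) (mkposreal 1 Rlt_0_1).
apply: (@filter_imp _ _ (@filter_filter _ _ (locally_filter t)) _ _ _ hl) => r; rewrite /ball /= /AbsRing_ball /= /abs /minus /plus /opp /= => hb.
have hr : (Cmod (f r) <= Cmod (f t) + 1)%R by have := Rle_abs (Cmod (f r) + - Cmod (f t)); lra.
have := qpoch_close n hp hr; have := hn n (leqnn n); lra.
Qed.

Lemma cont_qpoch2 g1 g2 p h : (0 < p < 1)%R -> cont_on2 g1 g2 h ->
  cont_on2 g1 g2 (fun z => qpoch p (h z)).
Proof.
move=> hp [a b]; split=> t ht; apply: (@ccont_qpoch p (fun r => h _)) => //; [exact: a|exact: b].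
Qed.

Lemma qpoch_unif g1 g2 p h e : (0 < p < 1)%R -> cont_on2 g1 g2 h -> (0 < e)%R ->
  exists n, forall z, on2 g1 g2 z -> (Cmod (qpoch p (h z) - pprod p (h z) n) <= e)%R.
Proof.
move=> hp hc he.
have [M [M0 hM]] := bounded2 hc.
have hQ : (0 <= qconst p M)%R by apply: qconst_ge0 => //; lra.
have [n hn] := @geom_small p (2 * qconst p M) e hp ltac:(lra) he.
exists n => z hz.
by have := qpoch_close n hp (hM z hz); have := hn n (leqnn n); lra.
Qed.

Lemma tame_qpoch g1 g2 p h : (0 < p < 1)%R -> cont_on2 g1 g2 h ->
  (forall k, rat_on g1 g2 (fun z => 1 - h z * p ^ k)) ->
  tame g1 g2 (fun z => qpoch p (h z)).
Proof.
move=> hp hc hr; split; first exact: cont_qpoch2.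
move=> e /(qpoch_unif hp hc) [n hn].
exists (fun z => pprod p (h z) n); split=> //.
exact: (rat_on_prod (F := fun k z => 1 - h z * p ^ k)).
Qed.

Lemma on2_cont_inv g1 g2 F : cont_on2 g1 g2 F -> (forall z, on2 g1 g2 z -> F z <> 0) ->
  cont_on2 g1 g2 (fun z => / F z).
Proof.
case=> a b h; split; apply: cont_on_inv => // t ht; apply: h; [left|right]; by exists t.
Qed.

Lemma Cmod_inv_close (z w : C) d e : (0 < d)%R -> (0 < e)%R -> (d <= Cmod z)%R ->
  (Cmod (z - w) <= Rmin (d / 2) (e * (d * d / 2)))%R -> (Cmod (/ z - / w) <= e)%R.
Proof.
move=> hd he hz hw.
have w1 : (Cmod (z - w) <= d / 2)%R := Rle_trans _ _ _ hw (Rmin_l _ _).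
have w2 : (Cmod (z - w) <= e * (d * d / 2))%R := Rle_trans _ _ _ hw (Rmin_r _ _).
have hw' : (d / 2 <= Cmod w)%R.
  have := Cmod_sub_ge z (z - w); rewrite (_ : z - (z - w) = w); [lra|ring].
have z0 : z <> 0 by apply/Cmod_gt_0; lra.
have w0 : w <> 0 by apply/Cmod_gt_0; lra.
have -> : / z - / w = - ((z - w) * / (z * w)) by field.
have zw0 : z * w <> 0 by apply: Cmult_neq_0.
rewrite Cmod_opp Cmod_mult Cmod_inv // Cmod_mult.
have h1 : (d * (d / 2) <= Cmod z * Cmod w)%R by apply: Rmult_le_compat; lra.
have h2 : (0 < d * (d / 2))%R by apply: Rmult_lt_0_compat; lra.
apply: (Rmult_le_reg_r (Cmod z * Cmod w)); first lra.
rewrite Rmult_assoc Rinv_l; last lra.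
rewrite Rmult_1_r; apply: Rle_trans w2 _; apply: Rmult_le_compat_l; lra.
Qed.

Lemma pprod_inv (p : R) (a : C) n :
  / pprod p a n = \big[Cmult/RtoC 1]_(k < n) / (1 - a * p ^ k).
Proof.
elim: n => [|n IH]; last by rewrite pprodS big_ord_recr /= Cinv_mult_total IH.
by rewrite /pprod !big_ord0; field; apply: RtoC_neq0; lra.
Qed.

Lemma tame_inv_qpoch g1 g2 p h : (0 < p < 1)%R -> cont_on2 g1 g2 h ->
  (forall k z, on2 g1 g2 z -> h z * p ^ k <> 1) ->
  (forall k, rat_on g1 g2 (fun z => / (1 - h z * p ^ k))) ->
  tame g1 g2 (fun z => / qpoch p (h z)).
Proof.
move=> hp hc hn hr.
have hcq := cont_qpoch2 hp hc.
have h0 z : on2 g1 g2 z -> qpoch p (h z) <> 0.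
  by move=> hz; apply: qpoch_neq0 => // k; apply: hn.
split; first exact: on2_cont_inv.
have [d [d0 hd]] := bounded_below2 hcq h0.
move=> e he.
have he' : (0 < Rmin (d / 2) (e * (d * d / 2)))%R.
  by apply: Rmin_pos; [lra|apply: Rmult_lt_0_compat => //; apply: Rdiv_lt_0_compat; [apply: Rmult_lt_0_compat|lra]].
have [n hu] := qpoch_unif hp hc he'.
exists (fun z => / pprod p (h z) n); split.
  apply: rat_on_ext (rat_on_prod n hr) => z hz.
  by rewrite pprod_inv.
by move=> z hz; apply: Cmod_inv_close (hd z hz) (hu z hz).
Qed.

Lemma RtoC_pow_neq0 (p : R) k : (0 < p)%R -> RtoC p ^ k <> 0.
Proof. by move=> hp; apply: Cpow_nz; apply: RtoC_neq0; lra. Qed.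

Lemma cont_id2 g1 g2 : C1_loop g1 -> C1_loop g2 -> cont_on2 g1 g2 (fun z => z).
Proof. by move=> h1 h2; split; apply: cont_on_id. Qed.

(** The truncations of the products (a z;p)_oo, (b / z;p)_oo and of their inverses are
   rational, with poles at 0 and at the poles of the untruncated functions. *)
Lemma tame_qpoch_lin g1 g2 p (a : C) : C1_loop g1 -> C1_loop g2 -> (0 < p < 1)%R ->
  tame g1 g2 (fun z => qpoch p (a * z)).
Proof.
move=> h1 h2 hp; apply: tame_qpoch => //.
  by apply: cont_mult2; [apply: cont_const2|apply: cont_id2].
move=> k; case: (Ceq_dec a 0) => [->|ha].
  by apply: rat_on_ext (rat_on_const _ _ 1) => z _; ring.
have hpk := @RtoC_pow_neq0 p k ltac:(lra).
apply: rat_on_ext (rat_on_mult (rat_on_const _ _ (- (a * p ^ k))) (rat_on_sub _ _ (/ (a * p ^ k)))).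
by move=> z _; field.
Qed.

Lemma tame_iqpoch_lin g1 g2 p (a : C) : C1_loop g1 -> C1_loop g2 -> (0 < p < 1)%R -> a <> 0 ->
  (forall k : nat, same_winding g1 g2 (/ (a * p ^ k))) ->
  tame g1 g2 (fun z => / qpoch p (a * z)).
Proof.
move=> h1 h2 hp ha hw.
have hpk k : RtoC p ^ k <> 0 by apply: RtoC_pow_neq0; lra.
have hn k z : on2 g1 g2 z -> a * z * p ^ k <> 1.
  move=> hz e; apply: (same_winding_neq (hw k) hz).
  have -> : z - / (a * p ^ k) = (a * z * p ^ k - 1) * / (a * p ^ k).
    by field; split=> //; apply: hpk.
  by rewrite e; ring.
apply: tame_inv_qpoch => //.
  by apply: cont_mult2; [apply: cont_const2|apply: cont_id2].
move=> k.
apply: rat_on_ext (rat_on_mult (rat_on_const _ _ (- / (a * p ^ k))) (rat_on_pole (hw k))).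
move=> z hz.
have hac : a * p ^ k <> 0 by apply: Cmult_neq_0; [|apply: hpk].
have := same_winding_neq (hw k) hz.
have -> : 1 - a * z * p ^ k = - (a * p ^ k) * (z - / (a * p ^ k)).
  by field; split=> //; apply: hpk.
by move: hac; set c := a * p ^ k; set y := z - / c => hac hy; field; split.
Qed.

Lemma tame_qpoch_div g1 g2 p (b : C) : C1_loop g1 -> C1_loop g2 -> (0 < p < 1)%R ->
  same_winding g1 g2 0 -> tame g1 g2 (fun z => qpoch p (b / z)).
Proof.
move=> h1 h2 hp hw.
have hz0 z : on2 g1 g2 z -> z <> 0.
  by move=> /(same_winding_neq hw); rewrite (_ : z - 0 = z); last by ring.
apply: tame_qpoch => //.
  by apply: cont_mult2; [apply: cont_const2|apply: on2_cont_inv => //; apply: cont_id2].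
move=> k.
apply: rat_on_ext (rat_on_mult (rat_on_sub _ _ (b * p ^ k)) (rat_on_pole hw)).
move=> z hz; have := hz0 z hz => zn.
by rewrite (_ : z - 0 = z); [field|ring].
Qed.

Lemma tame_iqpoch_div g1 g2 p (b : C) : C1_loop g1 -> C1_loop g2 -> (0 < p < 1)%R ->
  same_winding g1 g2 0 -> (forall k : nat, same_winding g1 g2 (b * p ^ k)) ->
  tame g1 g2 (fun z => / qpoch p (b / z)).
Proof.
move=> h1 h2 hp hw hb.
have hz0 z : on2 g1 g2 z -> z <> 0.
  by move=> /(same_winding_neq hw); rewrite (_ : z - 0 = z); last by ring.
apply: tame_inv_qpoch => //.
- by apply: cont_mult2; [apply: cont_const2|apply: on2_cont_inv => //; apply: cont_id2].
- move=> k z hz e; apply: (same_winding_neq (hb k) hz); have := hz0 z hz => zn.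
  have -> : z - b * p ^ k = z * (1 - b / z * p ^ k) by field.
  by rewrite e; ring.
move=> k.
apply: rat_on_ext (rat_on_mult (rat_on_sub _ _ 0) (rat_on_pole (hb k))).
move=> z hz; have := hz0 z hz => zn; have := same_winding_neq (hb k) hz => zb.
by field; split.
Qed.

(** * The univariate function and its contiguous relations *)

(** The function f_{x,s,u,lambda} in the variable w = u z q^(-i lambda), for p = q^2
   and M = q^(1 - 2 i lambda), so that q^(1 + 2 i lambda) = p / M. The conjugate of
   f^theta is the same function, with t and y in place of s and x, in the variable
   v z q^(i lambda) and for M = q^(1 + 2 i lambda). *)
Definition fw (p : R) (M s x w : C) : C :=
  qpoch p (s * M * x) * qpoch p (s * M / x) * qpoch p (w * (s * p / M))
  * (qpoch p (w / s) * qpoch p (p * s / w))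
  * (/ qpoch p (w * x) * / qpoch p (w / x) * / qpoch p (s * M / w)).

Lemma one_sub_neq0 (a : C) : a <> 1 -> 1 - a <> 0.
Proof. by move=> h; apply: Csub_neq0 => e; apply: h. Qed.

Lemma inv_qpoch_shift p (a : C) : (0 < p < 1)%R ->
  / qpoch p a = / (1 - a) * / qpoch p (a * p).
Proof.
move=> hp; rewrite (qpoch_shift a hp).
by rewrite Cinv_mult_total.
Qed.

Lemma fw_invx (p : R) (M s x w : C) : x <> 0 -> fw p M s (/ x) w = fw p M s x w.
Proof.
move=> hx; have e : / / x = x by field.
by rewrite /fw /Cdiv e; ring.
Qed.

Lemma div_neq_swap (a b : C) : b <> 0 -> a / b <> 1 -> b - a <> 0.
Proof.
move=> hb h; apply: Csub_neq0 => e; apply: h; rewrite e; field.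
by rewrite -e.
Qed.

(** Multiplying x, s or w by p multiplies [fw] by a rational function, because
   (a;p)_oo = (1 - a) (a p;p)_oo. *)
Lemma fw_shift_x (p : R) (M s x w : C) : (0 < p < 1)%R -> x <> 0 -> s * M * x <> 1 -> w / (x * p) <> 1 ->
  w * x <> 1 ->
  fw p M s (x * p) w =
  (1 - s * M / (x * p)) * (1 - w * x) / ((1 - s * M * x) * (1 - w / (x * p))) * fw p M s x w.
Proof.
move=> hp hx h1 h2 h3.
have p0 : RtoC p <> 0 by apply: RtoC_neq0; lra.
rewrite /fw.
rewrite (qpoch_shift (s * M * x) hp) (qpoch_shift (s * M / (x * p)) hp).
rewrite (inv_qpoch_shift (w * x) hp) (inv_qpoch_shift (w / (x * p)) hp).
rewrite (_ : s * M * (x * p) = s * M * x * p); last by ring.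
rewrite (_ : s * M / (x * p) * p = s * M / x); last by field.
rewrite (_ : w * (x * p) = w * x * p); last by ring.
rewrite (_ : w / (x * p) * p = w / x); last by field.
have := one_sub_neq0 h1; have := one_sub_neq0 h2; have := one_sub_neq0 h3.
set u1 := 1 - w * x; set u2 := 1 - w / (x * p); set u3 := 1 - s * M * x => n1 n2 n3.
set i1 := / qpoch p _; set i2 := / qpoch p _; set i3 := / qpoch p _.
by field.
Qed.

Lemma fw_shift_s (p : R) (M s x w : C) : (0 < p < 1)%R -> x <> 0 -> s <> 0 -> w <> 0 -> M <> 0 ->
  s * M / w <> 1 ->
  fw p M s x w = - (s * p / w) * (1 - s * M * x) * (1 - s * M / x) * (1 - w * (s * p / M)) /
     (1 - s * M / w) * fw p M (s * p) x w.
Proof.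
move=> hp hx hs hw hM h3.
have p0 : RtoC p <> 0 by apply: RtoC_neq0; lra.
rewrite /fw.
rewrite (qpoch_shift (s * M * x) hp) (qpoch_shift (s * M / x) hp).
rewrite (inv_qpoch_shift (s * M / w) hp) (qpoch_shift (w * (s * p / M)) hp).
rewrite (qpoch_shift (w / (s * p)) hp) (qpoch_shift (p * s / w) hp).
rewrite (_ : s * p * M * x = s * M * x * p); last by ring.
rewrite (_ : s * p * M / x = s * M / x * p); last by field.
rewrite (_ : s * p * M / w = s * M / w * p); last by field.
rewrite (_ : w * (s * p * p / M) = w * (s * p / M) * p); last by field.
rewrite (_ : w / (s * p) * p = w / s); last by field.
rewrite (_ : p * (s * p) / w = p * s / w * p); last by field.
have := one_sub_neq0 h3.
set u1 := 1 - s * M / w => n1.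
set i1 := / qpoch p _; set i2 := / qpoch p _; set i3 := / qpoch p _.
by field.
Qed.

Lemma fw_shift_w (p : R) (M s x w : C) : (0 < p < 1)%R -> x <> 0 -> s <> 0 -> w <> 0 -> M <> 0 ->
  w * x <> 1 -> w / x <> 1 -> s * M / (p * w) <> 1 ->
  fw p M s x w = - (w / s) * (1 - w * (s * p / M)) * (1 - s * M / (p * w)) /
     ((1 - w * x) * (1 - w / x)) * fw p M s x (p * w).
Proof.
move=> hp hx hs hw hM h1 h2 h3.
have p0 : RtoC p <> 0 by apply: RtoC_neq0; lra.
rewrite /fw.
rewrite (inv_qpoch_shift (w * x) hp) (inv_qpoch_shift (w / x) hp).
rewrite (inv_qpoch_shift (s * M / (p * w)) hp) (qpoch_shift (w * (s * p / M)) hp).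
rewrite (qpoch_shift (w / s) hp) (qpoch_shift (p * s / (p * w)) hp).
rewrite (_ : p * w * x = w * x * p); last by ring.
rewrite (_ : p * w / x = w / x * p); last by field.
rewrite (_ : s * M / (p * w) * p = s * M / w); last by field.
rewrite (_ : p * w * (s * p / M) = w * (s * p / M) * p); last by field.
rewrite (_ : p * w / s = w / s * p); last by field.
rewrite (_ : p * s / (p * w) * p = p * s / w); last by field.
have := one_sub_neq0 h1; have := one_sub_neq0 h2; have := one_sub_neq0 h3.
set u1 := 1 - w * x; set u2 := 1 - w / x; set u3 := 1 - s * M / (p * w) => n3 n2 n1.
set i1 := / qpoch p _; set i2 := / qpoch p _; set i3 := / qpoch p _.
by field.
Qed.

(** Up to a constant factor, the spectral parameter mu_x. *)
Definition xi (x : C) : C := x + / x.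

(** The eigenvalue equation of a twisted primitive element: the shift relation in w,
   solved for x + 1 / x. *)
Lemma fw_eigen (p : R) (M s x w : C) : (0 < p < 1)%R -> x <> 0 -> s <> 0 -> w <> 0 -> M <> 0 ->
  w * x <> 1 -> w / x <> 1 -> s * M / (p * w) <> 1 ->
  xi x * fw p M s x w =
  (w + / w) * fw p M s x w + (xi s - w * p / M - M / (p * w)) * fw p M s x (p * w).
Proof.
move=> hp hx hs hw hM h1 h2 h3.
have p0 : RtoC p <> 0 by apply: RtoC_neq0; lra.
have n1 := one_sub_neq0 h1; have n2 := div_neq_swap hx h2.
rewrite (fw_shift_w hp hx hs hw hM h1 h2 h3) /xi.
set H := fw _ _ _ _ _.
by field.
Qed.

(** The coefficients A and B of the difference operators, in terms of p and M; the
   integer is the shift of s. *)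
Definition coefA (p : R) (M : C) (sg : Z) (s x : C) : C :=
  match sg with
  | Z0 => - (x * (1 - s * M * x) * (1 - s * p / M * x) / (s * (1 - x ^ 2) * (1 - p * x ^ 2)))
  | Zpos _ => (1 - s * M * x) * (1 - s * M * p * x) * (1 - s * p / M * x) * (1 - s * p * p / M * x)
     / ((1 - x ^ 2) * (1 - p * x ^ 2))
  | Zneg _ => x ^ 2 * p / (s ^ 2 * (1 - x ^ 2) * (1 - p * x ^ 2))
  end.

Definition coefB (p : R) (M : C) (sg : Z) (s x : C) : C :=
  match sg with
  | Z0 => - coefA p M 0 s x - coefA p M 0 s (/ x)
  | Zpos _ => (1 + p) / p * (1 - s * M * x) * (1 - s * M / x) * (1 - s * p / M * x) * (1 - s * p / M / x)
     / ((1 - x ^ 2 / p) * (1 - / (x ^ 2 * p)))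
  | Zneg _ => (1 + p) / p / (s ^ 2 * (1 - x ^ 2 / p) * (1 - / (x ^ 2 * p)))
  end.

Lemma neq0_opp (a : C) : a <> 0 -> - a <> 0.
Proof. by move=> h e; apply: h; transitivity (- (- a)); [ring|rewrite e; ring]. Qed.

(** The side conditions of [field] are the denominators as polynomials, which agree with the
   hypotheses up to sign and the order of the monomials. *)
Ltac nz_one :=
  match goal with
  | |- ?X <> _ =>
    match goal with
    | h : ?A <> _ |- _ =>
      first [ exact h
            | (have -> : X = A by ring); exact h
            | (have -> : X = - A by ring); apply: neq0_opp; exact h ]
    end
  end.
Ltac nz := repeat split; nz_one.

Lemma fw_up (p : R) (M s x w : C) : (0 < p < 1)%R -> x <> 0 ->
  1 - s * M * x <> 0 -> p * x - w <> 0 -> 1 - w * x <> 0 ->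
  fw p M s (x * p) w =
  (p * x - s * M) * (1 - w * x) / ((1 - s * M * x) * (p * x - w)) * fw p M s x w.
Proof.
move=> hp hx h1 h2 h3.
have p0 : RtoC p <> 0 by apply: RtoC_neq0; lra.
rewrite fw_shift_x //.
- by congr (_ * _); field; nz.
- by move=> e; apply: h1; rewrite e; ring.
- move=> e; apply: h2; transitivity (p * x * (1 - w / (x * p))); first by field.
  by rewrite e; ring.
- by move=> e; apply: h3; rewrite e; ring.
Qed.

Lemma fw_down (p : R) (M s x w : C) : (0 < p < 1)%R -> x <> 0 ->
  x - s * M <> 0 -> p - w * x <> 0 -> x - w <> 0 ->
  fw p M s (x / p) w =
  (p - s * M * x) * (x - w) / ((x - s * M) * (p - w * x)) * fw p M s x w.
Proof.
move=> hp hx h1 h2 h3.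
have p0 : RtoC p <> 0 by apply: RtoC_neq0; lra.
have ix : / x <> 0 by apply: Cinv_neq0.
rewrite -(fw_invx _ _ _ _ hx) -fw_invx; last by apply: Cmult_neq_0 => //; apply: Cinv_neq0.
rewrite (_ : / (x / p) = / x * p); last by field.
rewrite (@fw_shift_x p M s (/ x)) //.
- by congr (_ * _); field; nz.
- move=> e; apply: h1; transitivity (x * (1 - s * M * / x)); first by field.
  by rewrite e; ring.
- move=> e; apply: h2; transitivity (p * (1 - w / (/ x * p))); first by field.
  by rewrite e; ring.
- move=> e; apply: h3; transitivity (x * (1 - w * / x)); first by field.
  by rewrite e; ring.
Qed.

Lemma fw_wdown (p : R) (M s x w : C) : (0 < p < 1)%R -> x <> 0 -> s <> 0 -> w <> 0 -> M <> 0 ->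
  p - w * x <> 0 -> p * x - w <> 0 -> w - s * M <> 0 ->
  fw p M s x (w / p) = - ((M - w * s) * (w - s * M) * p * x) /
     (s * M * (p - w * x) * (p * x - w)) * fw p M s x w.
Proof.
move=> hp hx hs hw hM h1 h2 h3.
have p0 : RtoC p <> 0 by apply: RtoC_neq0; lra.
rewrite (fw_shift_w (w := w / p) hp hx hs) //.
- rewrite (_ : p * (w / p) = w); last by field.
  by congr (_ * _); field; nz.
- by apply: Cmult_neq_0 => //; apply: Cinv_neq0.
- move=> e; apply: h1; transitivity (p * (1 - w / p * x)); first by field.
  by rewrite e; ring.
- move=> e; apply: h2; transitivity (p * x * (1 - w / p / x)); first by field.
  by rewrite e; ring.
- move=> e; apply: h3; transitivity (w * (1 - s * M / (p * (w / p)))); first by field.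
  by rewrite e; ring.
Qed.

(** Only the sign of the integer counts, as the exponents which occur are -1, 0 and 1. *)
Definition qshift (p : R) (sg : Z) : C :=
  match sg with Z0 => 1 | Zpos _ => RtoC p | Zneg _ => / RtoC p end.

(** The denominators which occur in the recurrences do not vanish. *)
Definition generic_point (p : R) (M s x w : C) : Prop :=
  (1 - w * x <> 0 /\ x - w <> 0 /\ p - w * x <> 0 /\ p * x - w <> 0) /\
  (w - s * M <> 0 /\ p * w - s * M <> 0).

Definition generic_pair (p : R) (M s x : C) : Prop :=
  (1 - x ^ 2 <> 0 /\ p - x ^ 2 <> 0 /\ 1 - p * x ^ 2 <> 0) /\
  forall sg, 1 - s * qshift p sg * M * x <> 0 /\ x - s * qshift p sg * M <> 0.

(** Over the common denominator (1 - w x / p) (1 - w / (p x)), the functions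
   f_{x p^nu, s'}(w) with nu = -1, 0, 1 are f_{x,s'}(w) times quadratic polynomials in w
   which in general form a basis; f_{x,s}(w / p) is of the same form for each of the
   three values of s'. The coefficients A and B are those of the expansion. The
   second identity combines this expansion with the eigenvalue equation of each
   f_{x p^nu, s'}: its right hand side is the eigenvalue operator applied to
   f_{x,s}(w / p). *)
Lemma fw_recurrences (p : R) (M s x w : C) sg : (0 < p < 1)%R ->
  x <> 0 -> s <> 0 -> w <> 0 -> M <> 0 -> generic_pair p M s x -> generic_point p M s x w ->
  let s' := s * qshift p sg in
  coefA p M sg s x * fw p M s' (x * p) w + coefB p M sg s x * fw p M s' x w
   + coefA p M sg s (/ x) * fw p M s' (x / p) w = fw p M s x (w / p) /\
  coefA p M sg s x * xi (x * p) * fw p M s' (x * p) w + coefB p M sg s x * xi x * fw p M s' x w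
   + coefA p M sg s (/ x) * xi (x / p) * fw p M s' (x / p) w =
  (w + / w) * fw p M s x (w / p) + (xi s' - (w * p / M + M / (p * w))) * fw p M s x w.
Proof.
move=> hp hx hs hw hM [[x1 [x2 x3]] hsg] [[h1 [h2 [h3 h4]]] [h5 h6]] s'.
have p0 : RtoC p <> 0 by apply: RtoC_neq0; lra.
have [g1 g2] := hsg sg.
rewrite (fw_up (s := s')) // (fw_down (s := s')) // fw_wdown // /xi.
rewrite /s' {s' hsg}; case: sg g1 g2 => [|n|n] g1 g2; rewrite /coefB /coefA /qshift in g1 g2 *.
- have e : s * 1 = s by ring.
  rewrite e in g1 g2 *.
  set H := fw _ _ _ _ _.
  by split; field; nz.
- rewrite (@fw_shift_s p M s x w) //; last first.
    move=> e; apply: h5; transitivity (w * (1 - s * M / w)); first by field.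
    by rewrite e; ring.
  set H := fw _ _ _ _ _.
  by split; field; nz.
rewrite (@fw_shift_s p M (s * / p) x w) //; last 2 first.
- by apply: Cmult_neq_0 => //; apply: Cinv_neq0.
- move=> e; apply: h6; transitivity (p * w * (1 - s * / p * M / w)); first by field.
  by rewrite e; ring.
rewrite (_ : s * / p * p = s); last by field.
have g1' : p - s * M * x <> 0.
  by move=> e; apply: g1; transitivity (/ p * (p - s * M * x)); [field|rewrite e; ring].
have g2' : p * x - s * M <> 0.
  by move=> e; apply: g2; transitivity (/ p * (p * x - s * M)); [field|rewrite e; ring].
set H := fw _ _ _ _ _.
split; field; nz.
Qed.

(** * Scaled curves and sequences of poles *)

Lemma Re_scaleR (r : R) (z : C) : Re (r * z) = (r * Re z)%R.
Proof. by rewrite /Re /Im /=; ring. Qed.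
Lemma Im_scaleR (r : R) (z : C) : Im (r * z) = (r * Im z)%R.
Proof. by rewrite /Re /Im /=; ring. Qed.

Lemma velocity_scale (r : R) g t : velocity (scale_curve r g) t = r * velocity g t.
Proof.
apply: C_ext; rewrite ?Re_scaleR ?Im_scaleR.
  rewrite -[LHS]/(Derive (fun a => Re (r * g a)) t) -[in RHS]Derive_scal.
  by apply: Derive_ext => a; rewrite Re_scaleR.
rewrite -[LHS]/(Derive (fun a => Im (r * g a)) t) -[in RHS]Derive_scal.
by apply: Derive_ext => a; rewrite Im_scaleR.
Qed.

Lemma C1_loop_scale (r : R) g : C1_loop g -> C1_loop (scale_curve r g).
Proof.
case=> h1 h2 h3; split.
- move=> t; have [a b] := h1 t; split.
    apply: (@ex_derive_ext R_AbsRing R_NormedModule (fun a => (r * Re (g a))%R)).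
      by move=> a'; rewrite /scale_curve Re_scaleR.
    exact: ex_derive_scal.
  apply: (@ex_derive_ext R_AbsRing R_NormedModule (fun a => (r * Im (g a))%R)).
    by move=> a'; rewrite /scale_curve Im_scaleR.
  exact: ex_derive_scal.
- move=> t; have [a b] := h2 t.
  have c : ccont (velocity (scale_curve r g)) t.
    apply: (@ccont_ext (fun a => r * velocity g a)).
      by move=> a'; rewrite velocity_scale.
    by apply: ccont_mult; [apply: ccont_const|].
  by case: c.
- by rewrite /scale_curve h3.
Qed.

Lemma contour_int_scale (r : R) g F :
  contour_int (scale_curve r g) F = contour_int g (fun z => r * F (r * z)).
Proof.
apply: cint_ext => t _; rewrite velocity_scale /scale_curve; ring.
Qed.

Lemma on_curve_scale (r : R) g (a : C) : r <> 0%R ->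
  on_curve (scale_curve r g) a <-> on_curve g (a / r).
Proof.
move=> hr; have hr' := RtoC_neq0 hr; split=> -[t [ht e]]; exists t; split=> //.
  by rewrite -e /scale_curve; field.
by rewrite /scale_curve e; field.
Qed.

Lemma winding_scale (r : R) g (a : C) : r <> 0%R -> ~ on_curve g (a / r) ->
  winding (scale_curve r g) a = winding g (a / r).
Proof.
move=> hr ha; have hr' := RtoC_neq0 hr.
rewrite /winding contour_int_scale; congr (_ * _).
apply: contour_int_ext => t ht.
have := not_on_curve ha ht => h.
have e : r * g t - a = r * (g t - a / r) by field.
rewrite e; move: h; set y := g t - a / r => h.
by field; split.
Qed.

Lemma inside_scale (r : R) g (a : C) : r <> 0%R ->
  inside (scale_curve r g) a <-> inside g (a / r).
Proof.
move=> hr; have hr' := RtoC_neq0 hr.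
split=> -[h1 h2].
  have h : ~ on_curve g (a / r) by move/(on_curve_scale g a hr).
  by split=> //; rewrite -(winding_scale hr h).
by split; [move/(on_curve_scale g a hr)|rewrite winding_scale].
Qed.

Lemma outside_scale (r : R) g (a : C) : r <> 0%R ->
  outside (scale_curve r g) a <-> outside g (a / r).
Proof.
move=> hr; have hr' := RtoC_neq0 hr.
split=> -[h1 h2].
  have h : ~ on_curve g (a / r) by move/(on_curve_scale g a hr).
  by split=> //; rewrite -(winding_scale hr h).
by split; [move/(on_curve_scale g a hr)|rewrite winding_scale].
Qed.

Definition inside_seq (p : R) (g : curve) (c : C) : Prop := forall k : nat, inside g (c * p ^ k).
Definition outside_seq (p : R) (g : curve) (c : C) : Prop := forall k : nat, outside g (c / p ^ k).

Lemma inside_seq_mul (p : R) g (c : C) n : inside_seq p g c -> inside_seq p g (c * p ^ n).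
Proof. by move=> h k; rewrite -Cmult_assoc -Cpow_add_r; apply: h. Qed.

Lemma outside_seq_div (p : R) g (c : C) n : (0 < p)%R ->
  outside_seq p g c -> outside_seq p g (c / p ^ n).
Proof.
move=> hp h k; have := h (n + k)%N.
rewrite Cpow_add_r (_ : c / (p ^ n * p ^ k) = c / p ^ n / p ^ k) //.
by field; split; apply: RtoC_pow_neq0.
Qed.

Lemma inside_seq_scale (p : R) g (c : C) : (0 < p)%R ->
  inside_seq p (scale_curve p g) c <-> inside_seq p g (c / p).
Proof.
move=> hp; have p0 : p <> 0%R by lra.
have p0' := RtoC_neq0 p0.
by split=> h k; [have /(inside_scale g _ p0) := h k|apply/(inside_scale g _ p0); have := h k];
  rewrite (_ : c * p ^ k / p = c / p * p ^ k) //; field.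
Qed.

Lemma outside_seq_scale (p : R) g (c : C) : (0 < p)%R ->
  outside_seq p (scale_curve p g) c <-> outside_seq p g (c / p).
Proof.
move=> hp; have p0 : p <> 0%R by lra.
have p0' := RtoC_neq0 p0; have pk k := @RtoC_pow_neq0 p k hp.
by split=> h k; [have /(outside_scale g _ p0) := h k|apply/(outside_scale g _ p0); have := h k];
  rewrite (_ : c / p ^ k / p = c / p / p ^ k) //; field; split=> //; apply: pk.
Qed.

Lemma inside_outside_neq g a b : inside g a -> outside g b -> a <> b.
Proof.
move=> [_ h1] [_ h2] e; rewrite e h2 in h1.
by have := RtoC_inj _ _ h1; lra.
Qed.

Lemma inside_same g1 g2 a : inside g1 a -> inside g2 a -> same_winding g1 g2 a.
Proof. by move=> [h1 e1] [h2 e2]; split=> //; rewrite e1 e2. Qed.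

Lemma outside_same g1 g2 a : outside g1 a -> outside g2 a -> same_winding g1 g2 a.
Proof. by move=> [h1 e1] [h2 e2]; split=> //; rewrite e1 e2. Qed.

(** The winding number is continuous off the curve, so its value at 0 is determined by
   points which converge to 0. *)
Lemma same_winding_zero (p : R) g1 g2 (c : C) : (0 < p < 1)%R ->
  C1_loop g1 -> C1_loop g2 -> ~ on_curve g1 0 -> ~ on_curve g2 0 ->
  (forall k : nat, same_winding g1 g2 (c * p ^ k)) -> same_winding g1 g2 0.
Proof.
move=> hp h1 h2 n1 n2 hc.
have hz z : on2 g1 g2 z -> z - 0 <> 0.
  by case=> -[t [ht <-]]; apply: not_on_curve.
have hi : cont_on2 g1 g2 (fun z => z - 0) by split; apply: cont_on_sub.
split=> //.
suff e : same_int g1 g2 (fun z => / (z - 0)) by rewrite /winding e.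
apply: same_int_limit => //; first by split; apply: cont_on_pole.
have [d [d0 hd]] := bounded_below2 hi hz.
move=> e he.
have hmin : (0 < Rmin (d / 2) (e * (d * d / 2)))%R.
  by apply: Rmin_pos; [lra|apply: Rmult_lt_0_compat => //; apply: Rdiv_lt_0_compat; [apply: Rmult_lt_0_compat|lra]].
have [n hn] := @geom_small p (Cmod c) _ hp (Cmod_ge_0 c) hmin.
exists (fun z => / (z - c * p ^ n)); split.
- exact: cont_pole2.
- exact: same_winding_int.
move=> z hzz; apply: Cmod_inv_close (hd z hzz) _ => //.
rewrite (_ : z - 0 - (z - c * p ^ n) = c * p ^ n); last by ring.
by rewrite Cmod_mult Cmod_powR; [left; apply: hn|lra].
Qed.

Definition pointed_loop (g : curve) : Prop := C1_loop g /\ ~ on_curve g 0.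

Lemma deformed_pointed g : deformed_circle g -> pointed_loop g.
Proof.
case=> h [H [_ h1 _ _ h2]]; split=> // -[t [ht e]].
by apply: (h1 1%R t) => //; [lra|rewrite h2].
Qed.

(** The poles of z |-> fw p M s x (c z) are on the right side of the curve. *)
Definition separates (p : R) (M s x c : C) (g : curve) : Prop :=
  inside_seq p g (s * M / c) /\ (outside_seq p g (x / c) /\ outside_seq p g (/ x / c)).

Lemma tame_fw (p : R) (M s x c : C) g1 g2 : (0 < p < 1)%R -> c <> 0 -> x <> 0 -> s <> 0 -> M <> 0 ->
  pointed_loop g1 -> pointed_loop g2 -> separates p M s x c g1 -> separates p M s x c g2 ->
  tame g1 g2 (fun z => fw p M s x (c * z)).
Proof.
move=> hp hc hx hs hM [h1 n1] [h2 n2] [i1 [o1 o1']] [i2 [o2 o2']].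
have w0 : same_winding g1 g2 0.
  by apply: (@same_winding_zero p _ _ (s * M / c)) => // k; apply: inside_same.
have p0 : RtoC p <> 0 by apply: RtoC_neq0; lra.
have pk k : RtoC p ^ k <> 0 by apply: RtoC_pow_neq0; lra.
have e : (fun z => fw p M s x (c * z)) = fun z =>
  qpoch p (s * M * x) * qpoch p (s * M / x) * qpoch p ((c * (s * p / M)) * z)
  * (qpoch p ((c / s) * z) * qpoch p ((p * s / c) / z))
  * (/ qpoch p ((c * x) * z) * / qpoch p ((c / x) * z) * / qpoch p ((s * M / c) / z)).
  apply: functional_extensionality => z; rewrite /fw /Cdiv Cinv_mult_total.
  rewrite (_ : c * z * (s * p * / M) = c * (s * p * / M) * z); last by ring.
  rewrite (_ : c * z * / s = c * / s * z); last by ring.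
  rewrite (_ : c * z * / x = c * / x * z); last by ring.
  rewrite (_ : c * z * x = c * x * z); last by ring.
  by rewrite !Cmult_assoc.
rewrite e; repeat apply: tame_mult; try exact: tame_const.
- exact: tame_qpoch_lin.
- exact: tame_qpoch_lin.
- exact: tame_qpoch_div.
- apply: tame_iqpoch_lin => //; first exact: Cmult_neq_0.
  move=> k; have -> : / (c * x * p ^ k) = / x / c / p ^ k by field; repeat split=> //; apply: pk.
  exact: outside_same.
- apply: tame_iqpoch_lin => //; first by apply: Cmult_neq_0 => //; apply: Cinv_neq0.
  move=> k; have -> : / (c / x * p ^ k) = x / c / p ^ k by field; repeat split=> //; apply: pk.
  exact: outside_same.
- apply: tame_iqpoch_div => // k; exact: inside_same.
Qed.

(** The mean of F over the curve with respect to dz / z. *)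
Definition bracket (g : curve) (F : C -> C) : C := / (2 * PI * Ci) * contour_int g (fun z => F z / z).

Lemma tame_inv g1 g2 (p : R) (c : C) : (0 < p < 1)%R -> pointed_loop g1 -> pointed_loop g2 ->
  inside_seq p g1 c -> inside_seq p g2 c -> tame g1 g2 (fun z => / z).
Proof.
move=> hp [h1 n1] [h2 n2] i1 i2.
have w0 : same_winding g1 g2 0.
  by apply: (@same_winding_zero p _ _ c) => // k; apply: inside_same.
have -> : (fun z : C => / z) = fun z => / (z - 0).
  by apply: functional_extensionality => z; congr Cinv; ring.
exact: tame_pole.
Qed.

Ltac fld := field; repeat split; assumption.

(** * Linearity of the bracket, and room around the poles *)

Lemma pointed_neq0 g z : pointed_loop g -> on_curve g z -> z <> 0.
Proof. by move=> [_ h] hz e; apply: h; rewrite -e. Qed.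

Lemma bracket_ext g F G : (forall z, on_curve g z -> F z = G z) -> bracket g F = bracket g G.
Proof.
move=> h; rewrite /bracket; congr (_ * _); apply: contour_int_ext => t ht.
by rewrite h //; exists t.
Qed.

Lemma cont_on_divz g F : pointed_loop g -> cont_on g F -> cont_on g (fun z => F z / z).
Proof.
move=> hg hF; apply: cont_on_mult => //; apply: cont_on_inv.
  by apply: cont_on_id; case: hg.
by move=> t ht; apply: (pointed_neq0 hg); exists t.
Qed.

Lemma bracket_axpy g (a : C) F G : pointed_loop g -> cont_on g F -> cont_on g G ->
  bracket g (fun z => a * F z + G z) = a * bracket g F + bracket g G.
Proof.
move=> hg hF hG; have [hl _] := hg.
have hF' := cont_on_divz hg hF; have hG' := cont_on_divz hg hG.
rewrite /bracket.
transitivity (/ (2 * PI * Ci) * contour_int g (fun z => a * (F z / z) + G z / z)).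
  by congr (_ * _); apply: contour_int_ext => t _; rewrite /Cdiv; ring.
rewrite contour_int_plus // ?contour_int_scal //; first by ring.
by apply: cont_on_mult => //; apply: cont_on_const.
Qed.

Lemma bracket_scal g (a : C) F : pointed_loop g -> cont_on g F ->
  bracket g (fun z => a * F z) = a * bracket g F.
Proof.
move=> hg hF; have [hl _] := hg.
rewrite /bracket.
transitivity (/ (2 * PI * Ci) * contour_int g (fun z => a * (F z / z))).
  by congr (_ * _); apply: contour_int_ext => t _; rewrite /Cdiv; ring.
by rewrite contour_int_scal //; [ring|apply: cont_on_divz].
Qed.

Lemma pointed_scale (r : R) g : r <> 0%R -> pointed_loop g -> pointed_loop (scale_curve r g).
Proof.
move=> hr [h1 h2]; split; first exact: C1_loop_scale.
move/(on_curve_scale g 0 hr); rewrite (_ : 0 / r = 0) //.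
by rewrite /Cdiv; ring.
Qed.

(** There is room for one more factor p on both sides, so [separates] persists when s
   and x are multiplied by 1 / p, 1 or p, and when c is divided or the curve is
   multiplied by p. *)
Definition wide (p : R) (M s x c : C) (g : curve) : Prop :=
  inside_seq p g (s * M / c / p) /\
  (outside_seq p g (x / c * p) /\ outside_seq p g (/ x / c * p)).

Lemma wide_separates (p : R) (M s x c : C) g sg nu : (0 < p < 1)%R -> x <> 0 -> c <> 0 ->
  wide p M s x c g -> separates p M (s * qshift p sg) (x * qshift p nu) c g.
Proof.
move=> hp hx hc [hi [h1 h2]].
have p0 : RtoC p <> 0 by apply: RtoC_neq0; lra.
have pk k := @RtoC_pow_neq0 p k ltac:(lra).
have O (d : C) n : outside_seq p g (d * p) -> outside_seq p g (d * p / p ^ n).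
  by apply: outside_seq_div; lra.
split; [|split].
- case: sg => [|n|n] /=.
  + rewrite (_ : s * 1 * M / c = s * M / c / p * p ^ 1); first exact: inside_seq_mul.
    by fld.
  + rewrite (_ : s * p * M / c = s * M / c / p * p ^ 2); first exact: inside_seq_mul.
    by fld.
  + rewrite (_ : s * / p * M / c = s * M / c / p * p ^ 0); first exact: inside_seq_mul.
    by fld.
- case: nu => [|n|n] /=.
  + rewrite (_ : x * 1 / c = x / c * p / p ^ 1); first exact: O.
    by fld.
  + rewrite (_ : x * p / c = x / c * p / p ^ 0); first exact: O.
    by fld.
  + rewrite (_ : x * / p / c = x / c * p / p ^ 2); first exact: O.
    by fld.
- case: nu => [|n|n] /=.
  + rewrite (_ : / (x * 1) / c = / x / c * p / p ^ 1); first exact: O.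
    by fld.
  + rewrite (_ : / (x * p) / c = / x / c * p / p ^ 2); first exact: O.
    by fld.
  + rewrite (_ : / (x * / p) / c = / x / c * p / p ^ 0); first exact: O.
    by fld.
Qed.

Lemma wide_separates_id (p : R) (M s x c : C) g : (0 < p < 1)%R -> x <> 0 -> c <> 0 ->
  wide p M s x c g -> separates p M s x c g.
Proof.
move=> hp hx hc h; have := wide_separates 0 0 hp hx hc h.
have es : s * 1 = s by ring.
have ex : x * 1 = x by ring.
by rewrite /qshift es ex.
Qed.

Lemma wide_separates_down (p : R) (M s x c : C) g : (0 < p < 1)%R -> x <> 0 -> c <> 0 ->
  wide p M s x c g -> separates p M s x (c / p) g.
Proof.
move=> hp hx hc [hi [h1 h2]].
have p0 : RtoC p <> 0 by apply: RtoC_neq0; lra.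
split; [|split].
- rewrite (_ : s * M / (c / p) = s * M / c / p * p ^ 2); first exact: inside_seq_mul.
  by fld.
- by rewrite (_ : x / (c / p) = x / c * p); last by fld.
- by rewrite (_ : / x / (c / p) = / x / c * p); last by fld.
Qed.

Lemma wide_separates_scale_down (p : R) (M s x c : C) g : (0 < p < 1)%R -> x <> 0 -> c <> 0 ->
  wide p M s x c g -> separates p M s x (c / p) (scale_curve p g).
Proof.
move=> hp hx hc h; have [hi [h1 h2]] := wide_separates_id hp hx hc h.
have p0 : RtoC p <> 0 by apply: RtoC_neq0; lra.
split; [|split].
- apply/inside_seq_scale; first lra.
  by rewrite (_ : s * M / (c / p) / p = s * M / c); last by fld.
- apply/outside_seq_scale; first lra.
  by rewrite (_ : x / (c / p) / p = x / c); last by fld.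
- apply/outside_seq_scale; first lra.
  by rewrite (_ : / x / (c / p) / p = / x / c); last by fld.
Qed.

Lemma wide_separates_scale (p : R) (M s x c : C) g : (0 < p < 1)%R -> x <> 0 -> c <> 0 ->
  wide p M s x c g -> separates p M s x c (scale_curve p g).
Proof.
move=> hp hx hc [hi [h1 h2]].
have p0 : RtoC p <> 0 by apply: RtoC_neq0; lra.
have O (d : C) n : outside_seq p g (d * p) -> outside_seq p g (d * p / p ^ n).
  by apply: outside_seq_div; lra.
split; [|split].
- by apply/inside_seq_scale; first lra.
- apply/outside_seq_scale; first lra.
  by rewrite (_ : x / c / p = x / c * p / p ^ 2); [exact: O|fld].
- apply/outside_seq_scale; first lra.
  by rewrite (_ : / x / c / p = / x / c * p / p ^ 2); [exact: O|fld].
Qed.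

Lemma inside_seq_off p g (c z : C) (k : nat) : inside_seq p g c -> on_curve g z -> z <> c * p ^ k.
Proof. by move=> h hz e; case: (h k) => h1 _; apply: h1; rewrite -e. Qed.

Lemma outside_seq_off p g (c z : C) (k : nat) : outside_seq p g c -> on_curve g z -> z <> c / p ^ k.
Proof. by move=> h hz e; case: (h k) => h1 _; apply: h1; rewrite -e. Qed.

Lemma Csub_eq0 (a b : C) : a - b = 0 -> a = b.
Proof. by move=> h; apply/Ceq_minus. Qed.

Lemma wide_generic_point (p : R) (M s x c : C) g z : (0 < p < 1)%R -> x <> 0 -> c <> 0 ->
  wide p M s x c g -> on_curve g z -> generic_point p M s x (c * z).
Proof.
move=> hp hx hc [hi [h1 h2]] hz.
have p0 : RtoC p <> 0 by apply: RtoC_neq0; lra.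
have a1 := @outside_seq_off _ _ _ _ 1%N h2 hz; have a0 := @outside_seq_off _ _ _ _ 0%N h2 hz.
have b1 := @outside_seq_off _ _ _ _ 1%N h1 hz; have b0 := @outside_seq_off _ _ _ _ 0%N h1 hz.
have c1 := @inside_seq_off _ _ _ _ 1%N hi hz; have c0 := @inside_seq_off _ _ _ _ 0%N hi hz.
have S (u d : C) : c * z - u = 0 -> d = u / c -> z = d.
  by move=> /Csub_eq0 e ->; rewrite -e; field.
split; [split; [|split; [|split]]|split] => e.
- apply: a1; transitivity ((1 - (1 - c * z * x)) / (c * x)); first by fld.
  by rewrite e; field; repeat split.
- apply: b1; transitivity ((x - (x - c * z)) / c); first by field.
  by rewrite e; field; repeat split.
- apply: a0; transitivity ((p - (p - c * z * x)) / (c * x)); first by fld.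
  by rewrite e; field; repeat split.
- apply: b0; transitivity ((p * x - (p * x - c * z)) / c); first by field.
  by rewrite e; field; repeat split.
- apply: c1; apply: (S _ _ e); fld.
- apply: c0; transitivity ((p * (c * z) - s * M + s * M) / (p * c)); first by fld.
  by rewrite e; field; repeat split.
Qed.

Lemma wide_generic_pair (p : R) (M s x c : C) g : (0 < p < 1)%R -> x <> 0 -> c <> 0 ->
  wide p M s x c g -> 1 - x ^ 2 <> 0 -> p - x ^ 2 <> 0 -> 1 - p * x ^ 2 <> 0 ->
  generic_pair p M s x.
Proof.
move=> hp hx hc [hi [h1 h2]] x1 x2 x3; split; first by [].
have p0 : RtoC p <> 0 by apply: RtoC_neq0; lra.
have key n : 1 - s / p * p ^ n * M * x <> 0 /\ x - s / p * p ^ n * M <> 0.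
  have pn := @RtoC_pow_neq0 p n ltac:(lra).
  split=> /Csub_eq0 e.
    apply: (inside_outside_neq (hi n) (h2 1%N)).
    transitivity ((s / p * p ^ n * M * x) / (c * x)); first by fld.
    by rewrite -e; field; repeat split.
  apply: (inside_outside_neq (hi n) (h1 1%N)).
  transitivity ((s / p * p ^ n * M) / c); first by fld.
  by rewrite -e; field; repeat split.
case=> [|n|n] /=.
- by have := key 1%N; rewrite (_ : s / p * p ^ 1 = s * 1); last by field.
- by have := key 2%N; rewrite (_ : s / p * p ^ 2 = s * p); last by field.
- by have := key 0%N; rewrite (_ : s / p * p ^ 0 = s * / p); last by field.
Qed.

(** * Relations between the brackets of one variable *)

(** The data of one variable: f(z) = fw p M s x (c z) and g(z) = fw p M' t y (c' z). *)
Record setting (p : R) (M s x c M' t y c' : C) (g : curve) : Prop := Setting {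
  st_p : (0 < p < 1)%R;
  st_M : M <> 0; st_s : s <> 0; st_x : x <> 0; st_c : c <> 0;
  st_M' : M' <> 0; st_t : t <> 0; st_y : y <> 0; st_c' : c' <> 0;
  st_g : pointed_loop g;
  st_f : wide p M s x c g;
  st_h : wide p M' t y c' g
}.

Lemma tame_cont g F : tame g g F -> cont_on g F.
Proof. by case=> -[]. Qed.

Lemma qshift_neq0 p sg : (0 < p)%R -> qshift p sg <> 0.
Proof.
move=> hp; have p0 : RtoC p <> 0 by apply: RtoC_neq0; lra.
case: sg => [|n|n] /=; [by apply: RtoC_neq0; lra|by []|exact: Cinv_neq0].
Qed.

Section Brackets.
Variables (p : R) (M s x c M' t y c' : C) (g : curve).
Hypothesis D : setting p M s x c M' t y c' g.

Let f_ z := fw p M s x (c * z).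
Let fd z := fw p M s x (c * z / p).
Let g_ z := fw p M' t y (c' * z).

Lemma setting_p_neq0 : RtoC p <> 0.
Proof. by apply: RtoC_neq0; have := st_p D; lra. Qed.

Lemma tame_fd g1 g2 : pointed_loop g1 -> pointed_loop g2 -> separates p M s x (c / p) g1 ->
  separates p M s x (c / p) g2 -> tame g1 g2 fd.
Proof.
move=> h1 h2 s1 s2; case: D => hp hM hs hx hc _ _ _ _ _ _ _.
have p0 := setting_p_neq0.
have -> : fd = fun z => fw p M s x (c / p * z).
  by apply: functional_extensionality => z; rewrite /fd (_ : c * z / p = c / p * z) //; field.
apply: tame_fw => //; apply: Cmult_neq_0 => //; exact: Cinv_neq0.
Qed.

Lemma cont_fd : cont_on g fd.
Proof.
case: D => hp hM hs hx hc hM' ht hy hc' hg wf wg.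
by apply: tame_cont; apply: tame_fd => //; apply: wide_separates_down.
Qed.

Lemma cont_g : cont_on g g_.
Proof.
case: D => hp hM hs hx hc hM' ht hy hc' hg wf wg.
by apply: tame_cont; apply: tame_fw => //; apply: wide_separates_id.
Qed.

Lemma cont_shifted sg nu : cont_on g (fun z => fw p M (s * qshift p sg) (x * qshift p nu) (c * z)).
Proof.
case: D => hp hM hs hx hc hM' ht hy hc' hg wf wg.
apply: tame_cont; apply: tame_fw => //.
- by apply: Cmult_neq_0 => //; apply: qshift_neq0; lra.
- by apply: Cmult_neq_0 => //; apply: qshift_neq0; lra.
- exact: wide_separates.
- exact: wide_separates.
Qed.

Lemma cont_f : cont_on g f_.
Proof.
case: D => hp hM hs hx hc hM' ht hy hc' hg wf wg.
by apply: tame_cont; apply: tame_fw => //; apply: wide_separates_id.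
Qed.

Lemma cont_invz : cont_on g (fun z => / z).
Proof.
case: D => hp hM hs hx hc hM' ht hy hc' hg wf wg.
apply: cont_on_inv; first by apply: cont_on_id; case: hg.
by move=> r hr; apply: (pointed_neq0 hg); exists r.
Qed.

Lemma cont_z : cont_on g (fun z => z).
Proof. by apply: cont_on_id; case: (st_g D). Qed.

(** The adjoint of the shift z -> p z is its inverse: the substitution carries the
   curve g to p g, and no pole lies between the two curves. *)
Lemma contour_shift T :
  tame g (scale_curve p g) T ->
  bracket g (fun z => f_ z * g_ (p * z) * T (p * z)) = bracket g (fun z => fd z * g_ z * T z).
Proof.
move=> hT; case: D => hp hM hs hx hc hM' ht hy hc' hg wf wg.
have p0 := setting_p_neq0.
have hpr : p <> 0%R by lra.
have hg2 := pointed_scale hpr hg.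
rewrite /bracket; congr (_ * _); symmetry.
have : same_int g (scale_curve p g) (fun z => fd z * g_ z * T z * / z).
  apply: tame_same_int; [by case: hg|by case: hg2|].
  apply: tame_mult; first apply: tame_mult => //; first apply: tame_mult.
  - apply: tame_fd => //; [exact: wide_separates_down|exact: wide_separates_scale_down].
  - apply: tame_fw => //; [exact: wide_separates_id|exact: wide_separates_scale].
  - apply: (@tame_inv _ _ p (s * M / c)) => //.
      by case: (wide_separates_id hp hx hc wf).
    by case: (wide_separates_scale hp hx hc wf).
rewrite /same_int contour_int_scale => e.
transitivity (contour_int g (fun z => fd z * g_ z * T z * / z)); first by [].
rewrite e; apply: contour_int_ext => r hr.
have hz : g r <> 0 by apply: (pointed_neq0 hg); exists r.
rewrite /fd (_ : c * (p * g r) / p = c * g r); last by fld.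
rewrite /f_; set A := fw _ _ _ _ _; set B := g_ _; set C := T _.
by fld.
Qed.

(** The functions f_ and fd stand for f(z) and f(z / p). *)
Definition bracket_f := bracket g (fun z => f_ z * g_ z).
Definition bracket_d := bracket g (fun z => fd z * g_ z).
Definition bracket_f_z := bracket g (fun z => f_ z * g_ z * z).
Definition bracket_f_invz := bracket g (fun z => f_ z * g_ z * / z).
Definition bracket_d_z := bracket g (fun z => fd z * g_ z * z).
Definition bracket_d_invz := bracket g (fun z => fd z * g_ z * / z).

Lemma cont_fg : cont_on g (fun z => f_ z * g_ z).
Proof. by apply: cont_on_mult; [apply: cont_f|apply: cont_g]. Qed.
Lemma cont_dg : cont_on g (fun z => fd z * g_ z).
Proof. by apply: cont_on_mult; [apply: cont_fd|apply: cont_g]. Qed.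
Lemma cont_fg_z : cont_on g (fun z => f_ z * g_ z * z).
Proof. by apply: cont_on_mult; [apply: cont_fg|apply: cont_z]. Qed.
Lemma cont_fg_invz : cont_on g (fun z => f_ z * g_ z * / z).
Proof. by apply: cont_on_mult; [apply: cont_fg|apply: cont_invz]. Qed.
Lemma cont_dg_z : cont_on g (fun z => fd z * g_ z * z).
Proof. by apply: cont_on_mult; [apply: cont_dg|apply: cont_z]. Qed.
Lemma cont_dg_invz : cont_on g (fun z => fd z * g_ z * / z).
Proof. by apply: cont_on_mult; [apply: cont_dg|apply: cont_invz]. Qed.

Lemma cont_axpy (a : C) F G : cont_on g F -> cont_on g G -> cont_on g (fun z => a * F z + G z).
Proof.
move=> hF hG; apply: cont_on_plus => //; apply: cont_on_mult => //; exact: cont_on_const.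
Qed.

Lemma bracket_comb3 (a1 a2 a3 : C) F1 F2 F3 : cont_on g F1 -> cont_on g F2 -> cont_on g F3 ->
  bracket g (fun z => a1 * F1 z + (a2 * F2 z + a3 * F3 z)) = a1 * bracket g F1 + (a2 * bracket g F2 + a3 * bracket g F3).
Proof.
move=> h1 h2 h3; have hg := st_g D.
have h3' : cont_on g (fun z => a3 * F3 z) by apply: cont_on_mult => //; apply: cont_on_const.
by rewrite (bracket_axpy _ hg h1 (cont_axpy _ h2 h3')) (bracket_axpy _ hg h2 h3') (bracket_scal _ hg h3).
Qed.

Lemma bracket_comb5 (a1 a2 a3 a4 a5 : C) F1 F2 F3 F4 F5 : cont_on g F1 -> cont_on g F2 ->
  cont_on g F3 -> cont_on g F4 -> cont_on g F5 ->
  bracket g (fun z => a1 * F1 z + (a2 * F2 z + (a3 * F3 z + (a4 * F4 z + a5 * F5 z)))) =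
  a1 * bracket g F1 + (a2 * bracket g F2 + (a3 * bracket g F3 + (a4 * bracket g F4 + a5 * bracket g F5))).
Proof.
move=> h1 h2 h3 h4 h5; have hg := st_g D.
have h5' : cont_on g (fun z => a5 * F5 z) by apply: cont_on_mult => //; apply: cont_on_const.
have h45 := cont_axpy a4 h4 h5'; have h345 := cont_axpy a3 h3 h45.
rewrite (bracket_axpy _ hg h1 (cont_axpy _ h2 h345)) (bracket_axpy _ hg h2 h345).
by rewrite bracket_comb3.
Qed.

Lemma bracket_recurrence sg : generic_pair p M s x ->
  let ph nu := bracket g (fun z => fw p M (s * qshift p sg) (x * qshift p nu) (c * z) * g_ z) in
  coefA p M sg s x * ph 1%Z + (coefB p M sg s x * ph 0%Z + coefA p M sg s (/ x) * ph (-1)%Z) = bracket_d.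
Proof.
move=> hpair ph; case: D => hp hM hs hx hc hM' ht hy hc' hg wf wg.
have cc nu : cont_on g (fun z => fw p M (s * qshift p sg) (x * qshift p nu) (c * z) * g_ z).
  by apply: cont_on_mult; [apply: cont_shifted|apply: cont_g].
rewrite -(bracket_comb3 _ _ _ (cc _) (cc _) (cc _)); apply: bracket_ext => z hz.
have hw : c * z <> 0 by apply: Cmult_neq_0 => //; apply: (pointed_neq0 hg).
have [e _] := fw_recurrences sg hp hx hs hw hM hpair (wide_generic_point hp hx hc wf hz).
rewrite /fd -e /=.
have -> : x * 1 = x by ring.
rewrite -/(Cdiv x p); ring.
Qed.

Lemma bracket_recurrence_weighted sg : generic_pair p M s x ->
  let ph nu := bracket g (fun z => fw p M (s * qshift p sg) (x * qshift p nu) (c * z) * g_ z) in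
  coefA p M sg s x * xi (x * p) * ph 1%Z + (coefB p M sg s x * xi x * ph 0%Z
    + coefA p M sg s (/ x) * xi (x / p) * ph (-1)%Z) =
  c * bracket_d_z + (/ c * bracket_d_invz + (- (c * p / M) * bracket_f_z + (- (M / (p * c)) * bracket_f_invz + xi (s * qshift p sg) * bracket_f))).
Proof.
move=> hpair ph; case: D => hp hM hs hx hc hM' ht hy hc' hg wf wg.
have p0 := setting_p_neq0.
have cc nu : cont_on g (fun z => fw p M (s * qshift p sg) (x * qshift p nu) (c * z) * g_ z).
  by apply: cont_on_mult; [apply: cont_shifted|apply: cont_g].
rewrite -(bracket_comb3 _ _ _ (cc _) (cc _) (cc _)) -(bracket_comb5 _ _ _ _ _ cont_dg_z cont_dg_invz cont_fg_z cont_fg_invz cont_fg).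
apply: bracket_ext => z hz.
have hz0 := pointed_neq0 hg hz.
have hw : c * z <> 0 by apply: Cmult_neq_0.
have [_ e] := fw_recurrences sg hp hx hs hw hM hpair (wide_generic_point hp hx hc wf hz).
rewrite /= -/(Cdiv x p).
have -> : x * 1 = x by ring.
set G := g_ z; rewrite -/(f_ z) -/(fd z) in e *.
move: e; set h1 := fw _ _ _ _ _; set h2 := fw _ _ _ _ _; set h3 := fw _ _ _ _ _ => e.
set L := (X in X = _).
have -> : L = (coefA p M sg s x * xi (x * p) * h1 + coefB p M sg s x * xi x * h2 +
   coefA p M sg s (/ x) * xi (x / p) * h3) * G by rewrite /L; ring.
rewrite e; set X := xi _; set F := f_ _; set E := fd _.
by fld.
Qed.

Lemma bracket_eigen_x :
  xi x * bracket_d = c / p * bracket_d_z + (p / c * bracket_d_invz + (- (c / M) * bracket_f_z + (- (M / c) * bracket_f_invz + xi s * bracket_f))).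
Proof.
case: D => hp hM hs hx hc hM' ht hy hc' hg wf wg.
have p0 := setting_p_neq0.
rewrite -(bracket_comb5 _ _ _ _ _ cont_dg_z cont_dg_invz cont_fg_z cont_fg_invz cont_fg) -(bracket_scal _ hg cont_dg).
apply: bracket_ext => z hz.
have hz0 := pointed_neq0 hg hz.
have hw : c * z / p <> 0 by apply: Cmult_neq_0; [apply: Cmult_neq_0|apply: Cinv_neq0].
have [[_ [_ [n1 n2]]] [n3 _]] := wide_generic_point hp hx hc wf hz.
have e := @fw_eigen p M s x (c * z / p) hp hx hs hw hM.
rewrite (_ : p * (c * z / p) = c * z) in e; last by fld.
rewrite Cmult_assoc e -/(fd z) -/(f_ z).
- by set X := xi _; set F := f_ _; set E := fd _; set G := g_ _; fld.
- move=> e'; apply: n1; transitivity (p * (1 - c * z / p * x)); first by fld.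
  by rewrite e'; ring.
- move=> e'; apply: n2; transitivity (p * x * (1 - c * z / p / x)); first by fld.
  by rewrite e'; ring.
- move=> e'; apply: n3; transitivity (c * z * (1 - s * M / (c * z))); first by fld.
  by rewrite e'; ring.
Qed.

(** The eigenvalue equation of g in y, where the terms with g(p z) are turned into
   terms with f(z / p) by the contour shift. *)
Lemma bracket_eigen_y :
  xi y * bracket_f = c' * bracket_f_z + (/ c' * bracket_f_invz + (xi t * bracket_d + (- (c' / M') * bracket_d_z + - (M' / c') * bracket_d_invz))).
Proof.
case: D => hp hM hs hx hc hM' ht hy hc' hg wf wg.
have p0 := setting_p_neq0.
have hpr : p <> 0%R by lra.
have hg2 := pointed_scale hpr hg.
have l1 : C1_loop g by case: hg.
have l2 : C1_loop (scale_curve p g) by case: hg2.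
pose U z := f_ z * g_ (p * z).
have cku : cont_on g (fun z => g_ (p * z)).
  have -> : (fun z => g_ (p * z)) = fun z => fw p M' t y (c' * p * z).
    by apply: functional_extensionality => z; rewrite /g_ Cmult_assoc.
  have hcp : c' * p <> 0 by apply: Cmult_neq_0.
  have sep : separates p M' t y (c' * p) g.
    have [hi [o1 o2]] := wg.
    split; [|split].
    - by rewrite (_ : t * M' / (c' * p) = t * M' / c' / p); last by fld.
    - rewrite (_ : y / (c' * p) = y / c' * p / p ^ 2); last by fld.
      by apply: outside_seq_div => //; lra.
    - rewrite (_ : / y / (c' * p) = / y / c' * p / p ^ 2); last by fld.
      by apply: outside_seq_div => //; lra.
  exact: tame_cont (tame_fw hp hcp hy ht hM' hg hg sep sep).
have cU : cont_on g U := cont_on_mult cont_f cku.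
have cU1 : cont_on g (fun z => U z * z) := cont_on_mult cU cont_z.
have cU2 : cont_on g (fun z => U z * / z) := cont_on_mult cU cont_invz.
have e0 : bracket g U = bracket_d.
  transitivity (bracket g (fun z => f_ z * g_ (p * z) * 1)); first by apply: bracket_ext => z _; rewrite /U; ring.
  rewrite (contour_shift (T := fun _ => 1)); last exact: tame_const.
  by apply: bracket_ext => z _; ring.
have e1 : bracket g (fun z => U z * z) = / p * bracket_d_z.
  transitivity (bracket g (fun z => / p * (f_ z * g_ (p * z) * (p * z)))).
    by apply: bracket_ext => z _; rewrite /U; fld.
  rewrite (bracket_scal _ hg).
    by congr (_ * _); apply: contour_shift; apply: tame_id.
  apply: (cont_on_mult cU); apply: cont_on_mult; [exact: cont_on_const|exact: cont_z].
have e2 : bracket g (fun z => U z * / z) = p * bracket_d_invz.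
  transitivity (bracket g (fun z => p * (f_ z * g_ (p * z) * / (p * z)))).
    by apply: bracket_ext => z hz; have hz0 := pointed_neq0 hg hz; rewrite /U; fld.
  rewrite (bracket_scal _ hg).
    congr (_ * _); apply: (contour_shift (T := fun z => / z)).
    apply: (@tame_inv _ _ p (s * M / c) hp hg hg2).
      by case: (wide_separates_id hp hx hc wf).
    by case: (wide_separates_scale hp hx hc wf).
  have -> : (fun z => f_ z * g_ (p * z) * / (p * z)) = fun z => / p * (U z * / z).
    by apply: functional_extensionality => z; rewrite Cinv_mult_total // /U; ring.
  by apply: (cont_on_mult (@cont_on_const g (/ p)) cU2).
have -> : c' * bracket_f_z + (/ c' * bracket_f_invz + (xi t * bracket_d + (- (c' / M') * bracket_d_z + - (M' / c') * bracket_d_invz))) =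
  c' * bracket_f_z + (/ c' * bracket_f_invz + (xi t * bracket g U + (- (p * c' / M') * bracket g (fun z => U z * z)
     + - (M' / (p * c')) * bracket g (fun z => U z * / z)))).
  rewrite e0 e1 e2; set X := xi _; set Y1 := bracket_f_z; set Y2 := bracket_f_invz; set Y3 := bracket_d; set Y4 := bracket_d_z; set Y5 := bracket_d_invz.
  by fld.
rewrite -(bracket_comb5 _ _ _ _ _ cont_fg_z cont_fg_invz cU cU1 cU2) -(bracket_scal _ hg cont_fg).
apply: bracket_ext => z hz.
have hz0 := pointed_neq0 hg hz.
have hw : c' * z <> 0 by apply: Cmult_neq_0.
have [[n1 [n2 _]] [_ n3]] := wide_generic_point hp hy hc' wg hz.
have e := @fw_eigen p M' t y (c' * z) hp hy ht hw hM'.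
have -> : xi y * (f_ z * g_ z) = f_ z * (xi y * g_ z) by ring.
rewrite e /U.
- rewrite (_ : p * (c' * z) = c' * (p * z)); last by ring.
  rewrite -/(g_ z) -/(g_ (p * z)).
  by set X := xi _; set F := f_ _; set G := g_ _; set E := g_ _; fld.
- by move=> e'; apply: n1; rewrite e'; ring.
- move=> e'; apply: n2; transitivity (y * (1 - c' * z / y)); first by fld.
  by rewrite e'; ring.
- move=> e'; apply: n3; transitivity (p * (c' * z) * (1 - t * M' / (p * (c' * z)))); first by fld.
  by rewrite e'; ring.
Qed.

End Brackets.

(** * Sums over sign vectors *)

Definition zcons (n : Z) (f : nat -> Z) (i : nat) : Z := if i is i'.+1 then f i' else n.

(** Sign vectors are built by adding a first sign. *)
Definition scons m (e : 'I_3) (mu : signs m) : signs m.+1 :=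
  [ffun i => if unlift ord0 i is Some k then mu k else e].

Lemma nuat_scons m (e : 'I_3) (mu : signs m) :
  nuat (scons e mu) = zcons (Z.of_nat e - 1)%Z (nuat mu).
Proof.
apply: functional_extensionality => -[|i] /=; rewrite /nuat.
  case: insubP => [k _ hk|]; last by rewrite ltn0Sn.
  rewrite ffunE; case: unliftP => [j ej|//].
  by move: hk; rewrite ej.
case: (insubP 'I_m i) => [k hi hk|hi].
  have hi' : (i.+1 < m.+1)%N by [].
  rewrite (insubT (fun j => (j < m.+1)%N) hi') ffunE.
  case: unliftP => [j ej|ej].
    have : nat_of_ord j = nat_of_ord k.
      by have := congr1 (@nat_of_ord _) ej; rewrite /= hk => -[].
    by move/ord_inj => ->.
  by have := congr1 (@nat_of_ord _) ej.
by rewrite insubN.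
Qed.

Lemma scons_bij m : bijective (fun pr : 'I_3 * signs m => scons pr.1 pr.2).
Proof.
exists (fun nu : signs m.+1 => (nu ord0, [ffun i => nu (lift ord0 i)] : signs m)).
  move=> [e mu] /=; congr (_, _); first by rewrite ffunE unlift_none.
  by apply/ffunP => i; rewrite !ffunE liftK.
move=> nu; apply/ffunP => i; rewrite ffunE /=.
by case: unliftP => [j ->|->] //; rewrite ffunE.
Qed.

Lemma sum_signsS m (F : (nat -> Z) -> C) :
  \big[Cplus/RtoC 0]_(nu : signs m.+1) F (nuat nu) =
  \big[Cplus/RtoC 0]_(mu : signs m)
     (F (zcons 1 (nuat mu)) + (F (zcons 0 (nuat mu)) + F (zcons (-1) (nuat mu)))).
Proof.
rewrite (reindex (fun pr : 'I_3 * signs m => scons pr.1 pr.2)) /=; last first.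
  exact: onW_bij (scons_bij m).
rewrite -(pair_bigA _ (fun e mu => F (nuat (scons e mu)))) exchange_big /=.
apply: eq_bigr => mu _.
rewrite !big_ord_recl big_ord0 !nuat_scons /=.
ring.
Qed.

Lemma sum_signs0 (F : (nat -> Z) -> C) :
  \big[Cplus/RtoC 0]_(nu : signs 0) F (nuat nu) = F (fun _ => 0%Z).
Proof.
have e (nu : signs 0) : nuat nu = fun _ => 0%Z.
  by apply: functional_extensionality => i; rewrite /nuat insubN.
rewrite (eq_bigr (fun _ => F (fun _ => 0%Z))); last by move=> nu _; rewrite e.
rewrite big_const card_ffun !card_ord expn0 /=; ring.
Qed.

Definition chain (T : nat -> Z -> Z -> C) (m : nat) (f : nat -> Z) : C :=
  \big[Cmult/RtoC 1]_(i < m) T i (f i) (f i.+1).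

Lemma chainS T m n f :
  chain T m.+1 (zcons n f) = T 0%N n (f 0%N) * chain (fun i => T i.+1) m f.
Proof. by rewrite /chain big_ord_recl. Qed.

Lemma big_prodS (b : nat -> C) m :
  \big[Cmult/RtoC 1]_(i < m.+1) b i = b 0%N * \big[Cmult/RtoC 1]_(i < m) b i.+1.
Proof. by rewrite big_ord_recl. Qed.

(** The first sign is summed first: for a fixed second sign the result is a constant
   which does not depend on that sign. *)
Lemma sum_chain m (T : nat -> Z -> Z -> C) (b : nat -> C) :
  (forall i sg, (i < m)%N -> T i 1%Z sg + (T i 0%Z sg + T i (-1)%Z sg) = b i) ->
  \big[Cplus/RtoC 0]_(nu : signs m) chain T m (nuat nu) = \big[Cmult/RtoC 1]_(i < m) b i.
Proof.
elim: m T b => [|m IH] T b h.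
  by rewrite (sum_signs0 (chain T 0)) /chain !big_ord0.
rewrite (sum_signsS m (chain T m.+1)) big_prodS.
rewrite -(IH (fun i => T i.+1) (fun i => b i.+1)); last by move=> i sg hi; apply: h.
rewrite big_distrr /=; apply: eq_bigr => mu _.
rewrite !chainS -(h 0%N (nuat mu 0%N)) //; ring.
Qed.

(** Here a, b, rho, rho' are brackets of one variable, X and eta are the eigenvalues in
   the x's and in the y's, and T collects the terms of the recurrence. Peeling off
   the first index replaces X 0 by X 1 and eta 0 by eta 1, at the cost of the terms
   rho and rho'; the last hypothesis says that these cancel for the weights al
   and ga. *)
Lemma chain_telescope m (al ga : C) (T : nat -> Z -> Z -> C) (a b rho rho' eta : nat -> C)
    (X : nat -> Z -> C) :
  (forall i sg, (i < m)%N -> T i 1%Z sg + (T i 0%Z sg + T i (-1)%Z sg) = b i) ->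
  (forall i sg, (i < m)%N ->
     X i 1%Z * T i 1%Z sg + (X i 0%Z * T i 0%Z sg + X i (-1)%Z * T i (-1)%Z sg) =
     rho' i + X i.+1 sg * a i) ->
  (forall i, (i < m)%N -> X i 0%Z * b i = rho i + X i.+1 0%Z * a i) ->
  (forall i, (i < m)%N -> eta i.+1 * a i = al * rho i + ga * rho' i + eta i * b i) ->
  eta m * \big[Cmult/RtoC 1]_(i < m) a i =
  (eta 0%N + al * X 0%N 0%Z) * \big[Cmult/RtoC 1]_(i < m) b i
  + ga * \big[Cplus/RtoC 0]_(nu : signs m) (X 0%N (nuat nu 0%N) * chain T m (nuat nu))
  - (al + ga) * X m 0%Z * \big[Cmult/RtoC 1]_(i < m) a i.
Proof.
elim: m T a b rho rho' eta X => [|m IH] T a b rho rho' eta X h3 h4 h2 h1.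
  rewrite (sum_signs0 (fun f => X 0%N (f 0%N) * chain T 0 f)) /chain !big_ord0; ring.
rewrite (sum_signsS m (fun f => X 0%N (f 0%N) * chain T m.+1 f)) !big_prodS.
have IH' := IH (fun i => T i.+1) (fun i => a i.+1) (fun i => b i.+1) (fun i => rho i.+1)
  (fun i => rho' i.+1) (fun i => eta i.+1) (fun i => X i.+1).
have {}IH' := IH' (fun i sg hi => h3 i.+1 sg hi) (fun i sg hi => h4 i.+1 sg hi)
  (fun i hi => h2 i.+1 hi) (fun i hi => h1 i.+1 hi).
have hs : \big[Cplus/RtoC 0]_(nu : signs m) chain (fun i => T i.+1) m (nuat nu) =
   \big[Cmult/RtoC 1]_(i < m) b i.+1.
  by apply: (@sum_chain m _ (fun i => b i.+1)) => i sg hi; apply: h3.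
have e : \big[Cplus/RtoC 0]_(mu : signs m)
   (X 0%N (zcons 1 (nuat mu) 0%N) * chain T m.+1 (zcons 1 (nuat mu)) +
    (X 0%N (zcons 0 (nuat mu) 0%N) * chain T m.+1 (zcons 0 (nuat mu)) +
     X 0%N (zcons (-1) (nuat mu) 0%N) * chain T m.+1 (zcons (-1) (nuat mu)))) =
  rho' 0%N * \big[Cmult/RtoC 1]_(i < m) b i.+1 +
  a 0%N * \big[Cplus/RtoC 0]_(mu : signs m) (X 1%N (nuat mu 0%N) * chain (fun i => T i.+1) m (nuat mu)).
  rewrite -hs !big_distrr -big_split /=; apply: eq_bigr => mu _.
  rewrite !chainS.
  have := h4 0%N (nuat mu 0%N) isT.
  set c := chain _ _ _ => h.
  transitivity ((rho' 0%N + X 1%N (nuat mu 0%N) * a 0%N) * c); last by ring.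
  by rewrite -h; ring.
rewrite e.
have g2 := h2 0%N isT; have g1 := h1 0%N isT.
move: IH'.
set PA := \big[Cmult/RtoC 1]_(i < m) a i.+1.
set PB := \big[Cmult/RtoC 1]_(i < m) b i.+1.
set S := \big[Cplus/RtoC 0]_(_ : _) _ => IH'.
have -> : eta m.+1 * (a 0%N * PA) = a 0%N * (eta m.+1 * PA) by ring.
rewrite IH'.
have -> : (eta 0%N + al * X 0%N 0%Z) * (b 0%N * PB) = (eta 0%N * b 0%N) * PB + al * (X 0%N 0%Z * b 0%N) * PB by ring.
rewrite g2.
have -> : eta 0%N * b 0%N = eta 1%N * a 0%N - al * rho 0%N - ga * rho' 0%N by rewrite g1; ring.
ring.
Qed.

(** * Powers of q, and the functions in terms of them *)

Lemma qpow_add q (a b : C) : qpow q (a + b) = qpow q a * qpow q b.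
Proof.
rewrite /qpow.
have -> : Re (a + b) = (Re a + Re b)%R by [].
have -> : Im (a + b) = (Im a + Im b)%R by [].
rewrite !Rmult_plus_distr_r exp_plus cos_plus sin_plus RtoC_mult.
apply: C_ext; rewrite /Re /Im /=; ring.
Qed.

Lemma qpow_R q (r : R) : qpow q r = exp (r * ln q).
Proof.
rewrite /qpow /= Rmult_0_l cos_0 sin_0.
by apply: C_ext; rewrite /Re /Im /=; ring.
Qed.

Lemma qpow_0 q : qpow q 0 = 1.
Proof. by rewrite qpow_R Rmult_0_l exp_0. Qed.

Lemma qpow_1 q : (0 < q)%R -> qpow q 1 = q.
Proof. by move=> hq; rewrite qpow_R Rmult_1_l exp_ln. Qed.

Lemma qpow_neq0 q a : qpow q a <> 0.
Proof.
move=> e; have := qpow_add q a (- a).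
rewrite (_ : a + - a = 0); last by ring.
by rewrite qpow_0 e Cmult_0_l => /RtoC_inj; lra.
Qed.

Lemma qpow_opp q a : qpow q (- a) = / qpow q a.
Proof.
have h := @qpow_neq0 q a.
have e : qpow q (- a) * qpow q a = 1.
  by rewrite -qpow_add (_ : - a + a = 0) ?qpow_0 //; ring.
by transitivity (qpow q (- a) * qpow q a / qpow q a); [field|rewrite e; field].
Qed.

Lemma qpow_conj q a : Cconj (qpow q a) = qpow q (Cconj a).
Proof.
rewrite /qpow Cmult_conj Cconj_R re_conj im_conj.
congr (_ * _).
by rewrite Ropp_mult_distr_l_reverse cos_neg sin_neg.
Qed.

Definition qilam (q lam : R) : C := qpow q (Ci * lam).

Lemma qilam_neq0 q lam : qilam q lam <> 0.
Proof. exact: qpow_neq0. Qed.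

Lemma qilam_conj q lam : Cconj (qilam q lam) = / qilam q lam.
Proof.
rewrite /qilam qpow_conj -qpow_opp; congr (qpow q _).
by apply: C_ext; rewrite /Re /Im /=; ring.
Qed.

Section Powers.
Variables (q lam : R).
Hypothesis hq : (0 < q < 1)%R.
Let l := qilam q lam.

Lemma qpow_m : qpow q (- (Ci * lam)) = / l.
Proof. exact: qpow_opp. Qed.
Lemma qpow_1p : qpow q (1 + Ci * lam) = q * l.
Proof. by rewrite qpow_add qpow_1 //; lra. Qed.
Lemma qpow_1m : qpow q (1 - Ci * lam) = q / l.
Proof. by rewrite qpow_add qpow_1 ?qpow_m //; lra. Qed.
Lemma qpow_12m : qpow q (1 - 2 * Ci * lam) = q / l ^ 2.
Proof.
have h := @qilam_neq0 q lam.
rewrite (_ : 1 - 2 * Ci * lam = 1 + (- (Ci * lam) + - (Ci * lam))); last by ring.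
by rewrite !qpow_add qpow_1 ?qpow_m; [rewrite /l; field|lra].
Qed.
Lemma qpow_12p : qpow q (1 + 2 * Ci * lam) = q * l ^ 2.
Proof.
rewrite (_ : 1 + 2 * Ci * lam = 1 + (Ci * lam + Ci * lam)); last by ring.
by rewrite !qpow_add qpow_1 -/(qilam q lam) -/l; [ring|lra].
Qed.
Lemma qpow_2 : qpow q 2 = q ^ 2.
Proof.
rewrite (_ : RtoC 2 = 1 + 1); last by rewrite -RtoC_plus; congr RtoC; lra.
by rewrite qpow_add qpow_1; [ring|lra].
Qed.
Lemma qpow_32m : qpow q (3 - 2 * Ci * lam) = q / l ^ 2 * q ^ 2.
Proof.
rewrite (_ : 3 - 2 * Ci * lam = (1 - 2 * Ci * lam) + 2); last by rewrite (_ : RtoC 3 = 1 + 2) ?/Cminus; [ring|rewrite -RtoC_plus; congr RtoC; lra].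
by rewrite qpow_add qpow_12m qpow_2.
Qed.
Lemma qpow_32p : qpow q (3 + 2 * Ci * lam) = q * l ^ 2 * q ^ 2.
Proof.
rewrite (_ : 3 + 2 * Ci * lam = (1 + 2 * Ci * lam) + 2); last by rewrite (_ : RtoC 3 = 1 + 2) ?/Cminus; [ring|rewrite -RtoC_plus; congr RtoC; lra].
by rewrite qpow_add qpow_12p qpow_2.
Qed.
Lemma qpow_eps0m : qpow q (2 * 0%R - Ci * lam) = / l.
Proof. by rewrite (_ : 2 * 0%R - Ci * lam = - (Ci * lam)) ?qpow_m //; ring. Qed.
Lemma qpow_eps0p : qpow q (- (2 * 0%R) + Ci * lam) = l.
Proof. by rewrite (_ : - (2 * 0%R) + Ci * lam = Ci * lam) //; ring. Qed.
End Powers.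

(** The values of M in [fw] for f and for the conjugate of f^theta. *)
Definition Mf (q lam : R) : C := q / qilam q lam ^ 2.
Definition Mg (q lam : R) : C := q * qilam q lam ^ 2.
Definition qsq (q : R) : R := (q ^ 2)%R.

Lemma qsq_C q : RtoC q ^ 2 = qsq q.
Proof. by rewrite RtoC_pow. Qed.

Lemma qsq_bounds q : (0 < q < 1)%R -> (0 < qsq q < 1)%R.
Proof. by move=> hq; rewrite /qsq /=; nra. Qed.

Lemma f1_rearrange (a1 a2 a3 t1 t2 d1 d2 d3 : C) :
  a1 * (a2 * 1) * (a3 * 1) * (t1 * (t2 * 1)) / (d1 * (d2 * 1) * (d3 * 1)) =
  a1 * a2 * a3 * (t1 * t2) * (/ d1 * / d2 * / d3).
Proof. by rewrite /Cdiv !Cmult_1_r !Cinv_mult_total; ring. Qed.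

Lemma f1_fw (q : R) (x s u : C) lam (z : C) : (0 < q < 1)%R -> s <> 0 -> u <> 0 -> z <> 0 ->
  f1 q x s u lam 0 z = fw (qsq q) (Mf q lam) s x (u / qilam q lam * z).
Proof.
move=> hq hs hu hz; have hl := @qilam_neq0 q lam.
have q0 : RtoC q <> 0 by apply: RtoC_neq0; lra.
rewrite /f1 /theta /qpochs /pm qsq_C !big_cat /= !big_cons !big_nil.
rewrite (qpow_12m _ hq) (qpow_1p _ hq) (qpow_1m _ hq) qpow_eps0m qpow_m /fw -!qsq_C /Mf.
set l := qilam q lam in hl *.
rewrite (_ : u / l * z * (s * RtoC q ^ 2 / (q / l ^ 2)) = u * s * z * (q * l)); last by fld.
rewrite (_ : / l * u * z / s = u / l * z / s); last by fld.
rewrite (_ : q ^ 2 / (u / l * z / s) = q ^ 2 * s / (u / l * z)); last by fld.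
rewrite (_ : u * z * / l = u / l * z); last by fld.
rewrite (_ : s * (q / l) / (u * z) = s * (q / l ^ 2) / (u / l * z)); last by fld.
exact: f1_rearrange.
Qed.

Lemma Cconj_inv_all (a : C) : Cconj (/ a) = / Cconj a.
Proof.
case: (Ceq_dec a 0) => [->|h]; last exact: Cinv_conj.
by rewrite (_ : Cconj 0 = 0) ?Cinv_0 ?Cconj_R.
Qed.

Lemma Cconj_div_all (a b : C) : Cconj (a / b) = Cconj a / Cconj b.
Proof. by rewrite /Cdiv Cmult_conj Cconj_inv_all. Qed.

Lemma Cconj_neq0 (a : C) : a <> 0 -> Cconj a <> 0.
Proof. by move=> h e; apply: h; rewrite -(Cconj_conj a) e Cconj_R. Qed.

Lemma fw_conj (p : R) (M s x w : C) : (0 < p < 1)%R ->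
  Cconj (fw p M s x w) = fw p (Cconj M) (Cconj s) (Cconj x) (Cconj w).
Proof.
move=> hp; rewrite /fw !Cmult_conj !Cconj_inv_all !(qpoch_conj _ hp).
by rewrite !(Cconj_div_all, Cmult_conj, Cconj_R).
Qed.

Lemma Mf_conj q lam : Cconj (Mf q lam) = Mg q lam.
Proof.
have hl := @qilam_neq0 q lam.
by rewrite /Mf /Mg Cconj_div_all Cpow_conj qilam_conj Cconj_R; field.
Qed.

Lemma Mg_conj q lam : Cconj (Mg q lam) = Mf q lam.
Proof. by rewrite -Mf_conj Cconj_conj. Qed.

Lemma star_f1 (q : R) (y t v : C) lam (z : C) : (0 < q < 1)%R -> t <> 0 -> v <> 0 -> z <> 0 ->
  Cconj (f1 q (Cconj y) (Cconj t) (Cconj v) lam 0 (/ / Cconj z)) =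
  fw (qsq q) (Mg q lam) t y (v * qilam q lam * z).
Proof.
move=> hq ht hv hz; have hl := @qilam_neq0 q lam.
have hz' := Cconj_neq0 hz.
rewrite (_ : / / Cconj z = Cconj z); last by field.
rewrite f1_fw //; try exact: Cconj_neq0.
rewrite fw_conj; last exact: qsq_bounds.
rewrite Mf_conj !Cconj_conj Cmult_conj Cconj_div_all !Cconj_conj qilam_conj.
by congr (fw _ _ _ _ _); field.
Qed.

Lemma uintegrand_rearrange (P1 P2 P3 P4 a1 a2 t1 t2 t3 t4 d1 d2 d3 d4 d5 d6 : C) :
  P1 <> 0 -> P2 <> 0 -> P3 <> 0 -> P4 <> 0 ->
  a1 * (a2 * 1) * (t1 * (t2 * 1)) * (t3 * (t4 * 1)) /
   (d1 * (d2 * 1) * (d3 * 1 * (d4 * (d5 * 1) * (d6 * 1)))) =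
  / (P1 * (P2 * 1) * (P3 * (P4 * 1))) * (
  P1 * P2 * a1 * (t1 * t2) * (/ d1 * / d2 * / d3) *
  (P3 * P4 * a2 * (t3 * t4) * (/ d4 * / d5 * / d6))).
Proof.
move=> h1 h2 h3 h4; rewrite /Cdiv !Cmult_1_r !Cinv_mult_total.
set i1 := / d1; set i2 := / d2; set i3 := / d3; set i4 := / d4; set i5 := / d5; set i6 := / d6.
by field.
Qed.

Lemma uintegrand_fw (q : R) (x y s u t v : C) lam (z : C) : (0 < q < 1)%R ->
  s <> 0 -> u <> 0 -> t <> 0 -> v <> 0 -> z <> 0 ->
  qpoch (qsq q) (s * Mf q lam * x) <> 0 -> qpoch (qsq q) (s * Mf q lam / x) <> 0 ->
  qpoch (qsq q) (t * Mg q lam * y) <> 0 -> qpoch (qsq q) (t * Mg q lam / y) <> 0 ->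
  uintegrand q (UParams s u t v lam 0) x y z =
  / qpochs (q ^ 2) (pm (s * qpow q (1 - 2 * Ci * lam)) x ++
                  pm (t * qpow q (1 + 2 * Ci * lam)) y) *
  (fw (qsq q) (Mf q lam) s x (u / qilam q lam * z) * fw (qsq q) (Mg q lam) t y (v * qilam q lam * z)).
Proof.
move=> hq hs hu ht hv hz n1 n2 n3 n4; have hl := @qilam_neq0 q lam.
have q0 : RtoC q <> 0 by apply: RtoC_neq0; lra.
rewrite /uintegrand /theta /qpochs /pm qsq_C !big_cat /= !big_cons !big_nil.
rewrite (qpow_12m _ hq) (qpow_12p _ hq) (qpow_1p _ hq) (qpow_1m _ hq) qpow_eps0m qpow_eps0p qpow_m -/(qilam q lam) /fw.
move: n1 n2 n3 n4; rewrite -!qsq_C /Mf /Mg.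
move: (qilam q lam) hl => l hl.
rewrite (_ : u / l * z * (s * RtoC q ^ 2 / (q / l ^ 2)) = u * s * z * (q * l)); last by fld.
rewrite (_ : v * l * z * (t * RtoC q ^ 2 / (q * l ^ 2)) = t * v * z * (q / l)); last by fld.
rewrite (_ : u * z * / l / s = u / l * z / s); last by fld.
rewrite (_ : v * z * l / t = v * l * z / t); last by fld.
rewrite (_ : q ^ 2 / (u / l * z / s) = q ^ 2 * s / (u / l * z)); last by fld.
rewrite (_ : q ^ 2 / (v * l * z / t) = q ^ 2 * t / (v * l * z)); last by fld.
rewrite (_ : u * z * / l = u / l * z); last by fld.
rewrite (_ : v * z * l = v * l * z); last by fld.
rewrite (_ : s * (q / l) / (u * z) = s * (q / l ^ 2) / (u / l * z)); last by fld.
rewrite (_ : t * (q * l) / (v * z) = t * (q * l ^ 2) / (v * l * z)); last by fld.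
move=> n1 n2 n3 n4.

exact: uintegrand_rearrange.
Qed.

(** * Admissible contours *)

Definition overlap_kernel (q : R) (s u t v : C) (lam : R) (x y z : C) : C :=
  fw (qsq q) (Mf q lam) s x (u / qilam q lam * z) * fw (qsq q) (Mg q lam) t y (v * qilam q lam * z).

Definition admissible (q : R) (s u t v : C) (lam : R) (x y : C) (g : curve) : Prop :=
  pointed_loop g /\ (separates (qsq q) (Mf q lam) s x (u / qilam q lam) g /\
                     separates (qsq q) (Mg q lam) t y (v * qilam q lam) g).

Lemma q_neq0 (q : R) : (0 < q < 1)%R -> RtoC q <> 0.
Proof. by move=> hq; apply: RtoC_neq0; lra. Qed.

Lemma Mf_neq0 (q lam : R) : (0 < q < 1)%R -> Mf q lam <> 0.
Proof.
move=> hq; apply: Cmult_neq_0; first exact: q_neq0.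
by apply: Cinv_neq0; apply: Cpow_nz; apply: qilam_neq0.
Qed.

Lemma Mg_neq0 (q lam : R) : (0 < q < 1)%R -> Mg q lam <> 0.
Proof.
move=> hq; apply: Cmult_neq_0; first exact: q_neq0.
by apply: Cpow_nz; apply: qilam_neq0.
Qed.

Lemma f_scale_neq0 q lam (u : C) : u <> 0 -> u / qilam q lam <> 0.
Proof. by move=> hu; apply: Cmult_neq_0 => //; apply: Cinv_neq0; apply: qilam_neq0. Qed.

Lemma g_scale_neq0 q lam (v : C) : v <> 0 -> v * qilam q lam <> 0.
Proof. by move=> hu; apply: Cmult_neq_0 => //; apply: qilam_neq0. Qed.

Lemma tame_overlap_kernel (q : R) (s u t v : C) (lam : R) (x y : C) g1 g2 : (0 < q < 1)%R ->
  s <> 0 -> u <> 0 -> t <> 0 -> v <> 0 -> x <> 0 -> y <> 0 ->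
  admissible q s u t v lam x y g1 -> admissible q s u t v lam x y g2 ->
  tame g1 g2 (overlap_kernel q s u t v lam x y).
Proof.
move=> hq hs hu ht hv hx hy [a1 [a2 a3]] [b1 [b2 b3]].
have hp := qsq_bounds hq.
apply: (@tame_mult g1 g2 (fun z => fw (qsq q) (Mf q lam) s x (u / qilam q lam * z))
  (fun z => fw (qsq q) (Mg q lam) t y (v * qilam q lam * z))).
  exact: (tame_fw hp (@f_scale_neq0 q lam _ hu) hx hs (@Mf_neq0 q lam hq) a1 b1 a2 b2).
exact: (tame_fw hp (@g_scale_neq0 q lam _ hv) hy ht (@Mg_neq0 q lam hq) a1 b1 a3 b3).
Qed.

Lemma bracket_contour_indep (q : R) (s u t v : C) (lam : R) (x y : C) g1 g2 : (0 < q < 1)%R ->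
  s <> 0 -> u <> 0 -> t <> 0 -> v <> 0 -> x <> 0 -> y <> 0 ->
  admissible q s u t v lam x y g1 -> admissible q s u t v lam x y g2 ->
  bracket g1 (overlap_kernel q s u t v lam x y) = bracket g2 (overlap_kernel q s u t v lam x y).
Proof.
move=> hq hs hu ht hv hx hy ha hb.
have ht1 := tame_overlap_kernel hq hs hu ht hv hx hy ha hb.
case: ha => p1 [[i1 _] _]; case: hb => p1' [[i1' _] _].
rewrite /bracket; congr (_ * _).
apply: (@tame_same_int _ _ (fun z => overlap_kernel q s u t v lam x y z * / z));
  [by case: p1|by case: p1'|].
by apply: (tame_mult ht1); apply: (tame_inv (qsq_bounds hq) p1 p1' i1 i1').
Qed.

Lemma qpoch_inside_outside (p : R) g (c d x : C) : (0 < p < 1)%R -> c <> 0 -> x <> 0 ->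
  inside_seq p g (d / c) -> outside_seq p g (/ x / c) -> qpoch p (d * x) <> 0.
Proof.
move=> hp hc hx hi ho; apply: qpoch_neq0 => // k e.
apply: (inside_outside_neq (hi k) (ho 0%N)).
transitivity (d * x * p ^ k / (x * c)); first by fld.
rewrite e; field; repeat split=> //; exact: RtoC_neq0.
Qed.

(** The prefactor of [uPhi] is not 0, since a zero would give a pole which is both
   inside and outside the contour; so it can be moved under the integral. *)
Lemma uPhi_bracket (q : R) (k : uselection) (s u t v : C) (lam : R) (x y : C) : (0 < q < 1)%R ->
  s <> 0 -> u <> 0 -> t <> 0 -> v <> 0 -> x <> 0 -> y <> 0 ->
  let a := UParams s u t v lam 0 in
  admissible q s u t v lam x y (k a x y) ->
  uPhi q k a x y = bracket (k a x y) (overlap_kernel q s u t v lam x y).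
Proof.
move=> hq hs hu ht hv hx hy a ha.
have hk := tame_cont (tame_overlap_kernel hq hs hu ht hv hx hy ha ha).
have hp := qsq_bounds hq.
have [hg [[fi [fo fo']] [gi [go go']]]] := ha.
have cf := @f_scale_neq0 q lam _ hu; have cg := @g_scale_neq0 q lam _ hv.
have inv_inv (w : C) : w <> 0 -> / / w = w by move=> hw; field.
have n1 := qpoch_inside_outside hp cf hx fi fo'.
have n2 : qpoch (qsq q) (s * Mf q lam / x) <> 0.
  apply: (qpoch_inside_outside hp cf (Cinv_neq0 hx) fi).
  by rewrite inv_inv.
have n3 := qpoch_inside_outside hp cg hy gi go'.
have n4 : qpoch (qsq q) (t * Mg q lam / y) <> 0.
  apply: (qpoch_inside_outside hp cg (Cinv_neq0 hy) gi).
  by rewrite inv_inv.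
rewrite /uPhi; set P := qpochs _ _.
rewrite (_ : us a = s) // (_ : ut a = t) // (_ : ulam a = lam) // in P *.
have hP : P <> 0.
  rewrite /P qsq_C /qpochs /pm !big_cat /= !big_cons !big_nil (qpow_12m _ hq) (qpow_12p _ hq) !Cmult_1_r.
  by apply: Cmult_neq_0; apply: Cmult_neq_0.
have -> : contour_int (k a x y) (fun z => uintegrand q a x y z / z) =
   contour_int (k a x y) (fun z => / P * (overlap_kernel q s u t v lam x y z / z)).
  apply: contour_int_ext => r hr.
  have hz : k a x y r <> 0 by apply: (pointed_neq0 hg); exists r.
  by rewrite uintegrand_fw // -/P /overlap_kernel /Cdiv; ring.
rewrite contour_int_scal; [|by case: hg|exact: cont_on_divz].
rewrite /bracket; set I := contour_int _ _; set kk := / (2 * PI * Ci).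
by field.
Qed.

Lemma Cpow_even q k : RtoC q ^ (2 * k) = qsq q ^ k.
Proof. by rewrite Cpow_mult_r qsq_C. Qed.

Lemma ucontour_admissible (q : R) (s u t v : C) (lam : R) (x y : C) g : (0 < q < 1)%R -> u <> 0 -> v <> 0 -> x <> 0 -> y <> 0 ->
  ucontour q (UParams s u t v lam 0) x y g <-> deformed_circle g /\ admissible q s u t v lam x y g.
Proof.
move=> hq hu hv hx hy; have hl := @qilam_neq0 q lam; have q0 := q_neq0 hq.
have E1 : / u * s * qpow q (1 - Ci * lam) = s * Mf q lam / (u / qilam q lam).
  by rewrite (qpow_1m _ hq) /Mf; fld.
have E2 : / v * t * qpow q (1 + Ci * lam) = t * Mg q lam / (v * qilam q lam).
  by rewrite (qpow_1p _ hq) /Mg; fld.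
have E3 : / u * qpow q (Ci * lam) * x = x / (u / qilam q lam) by rewrite -/(qilam q lam); fld.
have E4 : / u * qpow q (Ci * lam) * / x = / x / (u / qilam q lam) by rewrite -/(qilam q lam); fld.
have E5 : / v * qpow q (- (Ci * lam)) * y = y / (v * qilam q lam) by rewrite qpow_m; fld.
have E6 : / v * qpow q (- (Ci * lam)) * / y = / y / (v * qilam q lam) by rewrite qpow_m; fld.
rewrite /ucontour /= E1 E2 E3 E4 E5 E6; split.
  move=> [hd hi ho]; split=> //; split; first exact: deformed_pointed.
  split; (split; [|split]) => k; rewrite -Cpow_even.
  - by case: (hi k).
  - by case: (ho k).
  - by case: (ho k).
  - by case: (hi k).
  - by case: (ho k).
  - by case: (ho k).
move=> [hd [_ [[f1 [f2 f3]] [g1 [g2 g3]]]]]; split=> // k; rewrite Cpow_even; split.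
- exact: f1.
- exact: g1.
- exact: f2.
- exact: f3.
- exact: g2.
- exact: g3.
Qed.

Definition admissible_wide (q : R) (s u t v : C) (lam : R) (x y : C) (g : curve) : Prop :=
  wide (qsq q) (Mf q lam) s x (u / qilam q lam) g /\ wide (qsq q) (Mg q lam) t y (v * qilam q lam) g.

(** The factors q^2 and q^(-2) of the curves are moved to the poles, where they give the
   room required by [wide]. *)
Lemma contours_wide (q : R) N (a : params N) (x y : vec N) G : (0 < q < 1)%R ->
  pu a <> 0 -> pv a <> 0 -> (forall j, x j <> 0) -> (forall j, y j <> 0) ->
  contours q a x y G <->
  forall j : 'I_N, deformed_circle (G j) /\
    admissible_wide q (vext x (ps a) j.+1) (pu a) (vprev y (pt a) j) (pv a) (plam a j) (x j) (y j) (G j).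
Proof.
move=> hq hu hv hx hy.
have q0 := q_neq0 hq.
have hp := qsq_bounds hq.
have hp0 : (0 < qsq q)%R by lra.
have hpi : (/ qsq q <> 0)%R by apply: Rinv_neq_0_compat; lra.
have p0 : RtoC (qsq q) <> 0 by apply: RtoC_neq0; lra.
have O g (c : C) : outside_seq (qsq q) (scale_curve (/ q ^ 2) g) c <-> outside_seq (qsq q) g (c * qsq q).
  have pk k := @RtoC_pow_neq0 (qsq q) k hp0.
  rewrite qsq_C -RtoC_inv; last lra.
  by split=> h k; [have /(outside_scale g _ hpi) := h k|apply/(outside_scale g _ hpi); have := h k];
    rewrite (_ : c / qsq q ^ k / (/ qsq q)%R = c * qsq q / qsq q ^ k) //;
    rewrite RtoC_inv; try lra; field; split=> //; apply: pk.
have I g (c : C) : inside_seq (qsq q) (scale_curve (q ^ 2) g) c <-> inside_seq (qsq q) g (c / qsq q).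
  by rewrite qsq_C; apply: inside_seq_scale.
have main j : [/\ deformed_circle (G j),
      forall k : nat,
        inside (scale_curve (q ^ 2) (G j))
          (/ pu a * vext x (ps a) j.+1 * qpow q (1 - Ci * plam a j) * q ^ (2 * k)) /\
        inside (scale_curve (q ^ 2) (G j))
          (/ pv a * vprev y (pt a) j * qpow q (1 + Ci * plam a j) * q ^ (2 * k))
    & forall k : nat,
        [/\ outside (scale_curve (/ q ^ 2) (G j))
              (/ pu a * qpow q (Ci * plam a j) * x j * / q ^ (2 * k)),
            outside (scale_curve (/ q ^ 2) (G j))
              (/ pu a * qpow q (Ci * plam a j) * / x j * / q ^ (2 * k)),
            outside (scale_curve (/ q ^ 2) (G j))
              (/ pv a * qpow q (- (Ci * plam a j)) * y j * / q ^ (2 * k))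
          & outside (scale_curve (/ q ^ 2) (G j))
              (/ pv a * qpow q (- (Ci * plam a j)) * / y j * / q ^ (2 * k))]] <->
   (deformed_circle (G j) /\
    admissible_wide q (vext x (ps a) j.+1) (pu a) (vprev y (pt a) j) (pv a) (plam a j) (x j) (y j) (G j)).
  move: (vext _ _ _) (vprev _ _ _) (plam a j) (x j) (hx j) (y j) (hy j) (pu a) hu (pv a) hv (G j).
  move=> s t lam xj hxj yj hyj u hu' v hv' g {hx hy}.
  have hl := @qilam_neq0 q lam.
  have E1 : / u * s * qpow q (1 - Ci * lam) = s * Mf q lam / (u / qilam q lam).
    by rewrite (qpow_1m _ hq) /Mf; fld.
  have E2 : / v * t * qpow q (1 + Ci * lam) = t * Mg q lam / (v * qilam q lam).
    by rewrite (qpow_1p _ hq) /Mg; fld.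
  have E3 : / u * qpow q (Ci * lam) * xj = xj / (u / qilam q lam) by rewrite -/(qilam q lam); fld.
  have E4 : / u * qpow q (Ci * lam) * / xj = / xj / (u / qilam q lam) by rewrite -/(qilam q lam); fld.
  have E5 : / v * qpow q (- (Ci * lam)) * yj = yj / (v * qilam q lam) by rewrite qpow_m; fld.
  have E6 : / v * qpow q (- (Ci * lam)) * / yj = / yj / (v * qilam q lam) by rewrite qpow_m; fld.
  rewrite E1 E2 E3 E4 E5 E6 /admissible_wide /wide; split.
    move=> [hd hi ho]; split=> //.
    split; (split; [apply/I|split; apply/O]) => k; rewrite -Cpow_even.
    - by case: (hi k).
    - by case: (ho k).
    - by case: (ho k).
    - by case: (hi k).
    - by case: (ho k).
    - by case: (ho k).
  move=> [hd [[/I f1 [/O f2 /O f3]] [/I g1 [/O g2 /O g3]]]]; split=> // k; rewrite Cpow_even; split.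
  - exact: f1.
  - exact: g1.
  - exact: f2.
  - exact: f3.
  - exact: g2.
  - exact: g3.
by split=> h j; apply/main.
Qed.

(** * Factorization of the multivariate integral *)

Lemma iter_int_prod N (G : 'I_N -> curve) (h : 'I_N -> C -> C) (F : vec N -> C) (c : C) :
  (forall j, pointed_loop (G j)) -> (forall j, cont_on (G j) (h j)) ->
  (forall z : vec N, (forall j, on_curve (G j) (z j)) ->
     F z = c * \big[Cmult/RtoC 1]_(j < N) h j (z j)) ->
  iter_int G F = c * \big[Cmult/RtoC 1]_(j < N) contour_int (G j) (fun z => h j z / z).
Proof.
elim: N G h F c => [|N IH] G h F c hG wg hF.
  rewrite /= hF; last by case.
  by rewrite !big_ord0.
rewrite big_ord_recl /=.
set P := \big[Cmult/RtoC 1]_(i < N) _.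
transitivity (contour_int (G ord0) (fun z => (c * P) * (h ord0 z / z))).
  apply: contour_int_ext => r hr.
  rewrite (IH _ (fun i => h (lift ord0 i)) _ (c * h ord0 (G ord0 r))) //.
    by rewrite -/P /Cdiv; ring.
  move=> w hw; rewrite hF.
    rewrite big_ord_recl /vcons unlift_none Cmult_assoc; congr (_ * _).
    by apply: eq_bigr => i _; rewrite liftK.
  move=> j; rewrite /vcons; case: unliftP => [i ->|->]; first exact: hw.
  by exists r.
have [hl _] := hG ord0.
rewrite contour_int_scal //; last exact: cont_on_divz.
ring.
Qed.

Lemma prod_scal N (k : C) (F : 'I_N -> C) :
  \big[Cmult/RtoC 1]_(j < N) (k * F j) = k ^ N * \big[Cmult/RtoC 1]_(j < N) F j.
Proof.
elim: N F => [|N IH] F; first by rewrite !big_ord0 /=; ring.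
by rewrite !big_ord_recl IH /=; ring.
Qed.

Definition kernel_at (q : R) N (a : params N) (x y : vec N) (j : 'I_N) : C -> C :=
  overlap_kernel q (vext x (ps a) j.+1) (pu a) (vprev y (pt a) j) (pv a) (plam a j) (x j) (y j).

Definition admissible_at (q : R) N (a : params N) (x y : vec N) (j : 'I_N) (g : curve) : Prop :=
  admissible q (vext x (ps a) j.+1) (pu a) (vprev y (pt a) j) (pv a) (plam a j) (x j) (y j) g.

Lemma vext_neq0 N (x : vec N) (s : C) i : s <> 0 -> (forall j, x j <> 0) -> vext x s i <> 0.
Proof. by move=> hs hx; rewrite /vext; case: insub. Qed.

Lemma vprev_neq0 N (x : vec N) (s : C) i : s <> 0 -> (forall j, x j <> 0) -> vprev x s i <> 0.
Proof. by move=> hs hx; case: i => [|i] //=; apply: vext_neq0. Qed.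

Lemma vext_conj N (x : vec N) (s : C) i : vext (vconj x) (Cconj s) i = Cconj (vext x s i).
Proof. by rewrite /vext; case: insub. Qed.

Lemma vprev_conj N (x : vec N) (s : C) i : vprev (vconj x) (Cconj s) i = Cconj (vprev x s i).
Proof. by case: i => [|i] //=; apply: vext_conj. Qed.

Lemma admissible_wide_admissible q (s u t v : C) lam (x y : C) g : (0 < q < 1)%R -> u <> 0 -> v <> 0 -> x <> 0 -> y <> 0 ->
  deformed_circle g -> admissible_wide q s u t v lam x y g -> admissible q s u t v lam x y g.
Proof.
move=> hq hu hv hx hy hd [h1 h2]; split; first exact: deformed_pointed.
by split; apply: wide_separates_id => //; [exact: qsq_bounds|exact: f_scale_neq0|exact: qsq_bounds|exact: g_scale_neq0].
Qed.

(** The curves chosen by the selection can be replaced by any admissible ones. *)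
Lemma Phi_prod (q : R) N (a : params N) (x y : vec N) (K : selection N) (G : 'I_N -> curve) :
  (0 < q < 1)%R -> ps a <> 0 -> pu a <> 0 -> pt a <> 0 -> pv a <> 0 ->
  (forall i, x i <> 0) -> (forall i, y i <> 0) ->
  contours q a x y (K a x y) -> (forall j, admissible_at q a x y j (G j)) ->
  Phi q K a x y = \big[Cmult/RtoC 1]_(j < N) bracket (G j) (kernel_at q a x y j).
Proof.
move=> hq hs hu ht hv hx hy hKc hG.
have hc := proj1 (@contours_wide q N a x y _ hq hu hv hx hy) hKc.
have ha j : admissible_at q a x y j (K a x y j).
  by have [h1 h2] := hc j; apply: admissible_wide_admissible.
have hext i : vext x (ps a) i <> 0 by apply: vext_neq0.
have hprev i : vprev y (pt a) i <> 0 by apply: vprev_neq0.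
have hp j : pointed_loop (K a x y j) by case: (ha j).
rewrite /Phi /pairing (@iter_int_prod N (K a x y) (kernel_at q a x y) _ 1) //.
- transitivity (\big[Cmult/RtoC 1]_(j < N) bracket (K a x y j) (kernel_at q a x y j)).
    rewrite /bracket prod_scal Cpow_inv; first by ring.
    apply: Cmult_neq_0; last by case; lra.
    by apply: Cmult_neq_0; apply: RtoC_neq0; have := PI_RGT_0; lra.
  apply: eq_bigr => j _; apply: bracket_contour_indep => //; [exact: ha|exact: hG].
- move=> j; apply: tame_cont; apply: (tame_overlap_kernel hq _ hu _ hv _ _ (ha j) (ha j)) => //.
move=> z hz; rewrite Cmult_1_l /fN /star /fNtheta Cconj_prod -big_split /=.
apply: eq_bigr => j _.
have hzj : z j <> 0 := pointed_neq0 (hp j) (hz j).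
by rewrite f1_fw // vprev_conj star_f1.
Qed.

(** * Conjugation of contours *)

(** Conjugation reverses the orientation, so the parameter is reversed as well. *)
Definition crev (g : curve) : curve := fun t => Cconj (g (1 - t)%R).

Lemma is_derive_rev (f : R -> R) t d : is_derive f (1 - t)%R d ->
  is_derive (fun r => f (1 - r)%R) t (- d)%R.
Proof.
move=> h; evar_last.
  apply: (is_derive_comp f (fun r => (1 - r)%R)); first exact: h.
  apply: (is_derive_minus (fun _ : R => 1%R) (fun r => r)).
    exact: is_derive_const.
  exact: is_derive_id.
by rewrite /scal /minus /plus /opp /zero /one /= /mult /=; ring.
Qed.

Lemma cderiv_crev g t d : cderiv g (1 - t)%R d -> cderiv (crev g) t (- Cconj d).
Proof.
case=> h1 h2; split.
  apply: (@is_derive_ext _ _ (fun r => Re (g (1 - r)%R))); first by move=> r; rewrite /crev re_conj.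
  exact: (is_derive_rev (f := fun r => Re (g r)) h1).
apply: (@is_derive_ext _ _ (fun r => (- Im (g (1 - r)%R))%R)); first by move=> r; rewrite /crev im_conj.
evar_last.
  exact: (is_derive_opp _ _ _ (is_derive_rev (f := fun r => Im (g r)) h2)).
by rewrite /opp /Im /=; ring.
Qed.

Lemma cderiv_velocity g t d : cderiv g t d -> velocity g t = d.
Proof. by case=> h1 h2; apply: C_ext; [exact: is_derive_unique h1|exact: is_derive_unique h2]. Qed.

Lemma velocity_crev g t : C1_loop g -> velocity (crev g) t = - Cconj (velocity g (1 - t)%R).
Proof. by move=> hg; apply: cderiv_velocity; apply: cderiv_crev; apply: loop_cderiv. Qed.

Lemma ccont_conj f t : ccont f t -> ccont (fun r => Cconj (f r)) t.
Proof. by case=> a b; split=> //; apply: cont_oppR. Qed.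

Lemma cont_rev (f : R -> R) t : continuous f (1 - t)%R -> continuous (fun r => f (1 - r)%R) t.
Proof.
move=> h; apply: (continuous_comp (fun r => (1 - r)%R) f) => //.
apply: (cont_plusR (f := fun _ => 1%R)); first exact: continuous_const.
by apply: cont_oppR; apply: continuous_id.
Qed.

Lemma ccont_rev f t : ccont f (1 - t)%R -> ccont (fun r => f (1 - r)%R) t.
Proof. by case=> a b; split; [apply: (cont_rev (f := fun r => Re (f r)))|apply: (cont_rev (f := fun r => Im (f r)))]. Qed.

Lemma C1_loop_crev g : C1_loop g -> C1_loop (crev g).
Proof.
move=> hg; split.
- move=> t; have [a b] := cderiv_crev (loop_cderiv (1 - t) hg).
  by split; [exists (Re (- Cconj (velocity g (1 - t)%R)))|exists (Im (- Cconj (velocity g (1 - t)%R)))].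
- move=> t.
  have c : ccont (velocity (crev g)) t.
    apply: (@ccont_ext (fun r => - Cconj (velocity g (1 - r)%R))).
      by move=> r; rewrite velocity_crev.
    by apply: ccont_opp; apply: ccont_conj; apply: ccont_rev; apply: velocity_ccont.
  by case: c.
- case: hg => _ _ h; rewrite /crev (_ : (1 - 0 = 1)%R); last by ring.
  by rewrite (_ : (1 - 1 = 0)%R); [rewrite h|ring].
Qed.

Lemma is_RInt_rev (f : R -> R) I : is_RInt f 0 1 I -> is_RInt (fun r => f (1 - r)%R) 0 1 I.
Proof.
move=> h.
have h1 : is_RInt f (-1 * 0 + 1) (-1 * 1 + 1) (opp I).
  rewrite (_ : (-1 * 0 + 1 = 1)%R); last by ring.
  rewrite (_ : (-1 * 1 + 1 = 0)%R); last by ring.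
  exact: is_RInt_swap.
have h2 := is_RInt_opp _ _ _ _ (is_RInt_comp_lin f (-1) 1 0 1 _ h1).
rewrite opp_opp in h2.
apply: is_RInt_ext h2 => r _.
rewrite /opp /scal /= /mult /= (_ : (-1 * r + 1 = 1 - r)%R); [ring|ring].
Qed.

Lemma contour_int_crev g F : C1_loop g -> cont_on g (fun z => Cconj (F (Cconj z))) ->
  contour_int (crev g) F = - Cconj (contour_int g (fun z => Cconj (F (Cconj z)))).
Proof.
move=> hg hF.
have [h1 h2] := is_contour_int hg hF.
set I := contour_int g _ in h1 h2 *.
have h : is_cint (fun t => F (crev g t) * velocity (crev g) t) (- Cconj I).
  split.
    have := is_RInt_opp _ _ _ _ (is_RInt_rev h1).
    apply: is_RInt_ext => r _; rewrite velocity_crev // /crev.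
    by rewrite /opp /Re /Im /=; ring.
  have := is_RInt_rev h2; rewrite (_ : Im (- Cconj I) = Im I); last by rewrite /Im /=; ring.
  apply: is_RInt_ext => r _; rewrite velocity_crev // /crev.
  by rewrite /Re /Im /=; ring.
exact: is_cint_unique h.
Qed.

Lemma twopii_conj : Cconj (/ (2 * PI * Ci)) = - / (2 * PI * Ci).
Proof.
rewrite Cconj_inv_all !Cmult_conj !Cconj_R.
have -> : Cconj Ci = - Ci by apply: C_ext => /=; ring.
have hP : RtoC PI <> 0 by apply: RtoC_neq0; have := PI_RGT_0; lra.
have hi : Ci <> 0 by case; lra.
by field.
Qed.

Lemma bracket_crev g F : pointed_loop g -> cont_on g (fun z => Cconj (F (Cconj z))) ->
  bracket (crev g) F = Cconj (bracket g (fun z => Cconj (F (Cconj z)))).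
Proof.
move=> hg hF; rewrite /bracket.
have e : (fun z => Cconj (F (Cconj z) / Cconj z)) = fun z => Cconj (F (Cconj z)) / z.
  by apply: functional_extensionality => z; rewrite Cconj_div_all Cconj_conj.
rewrite contour_int_crev; [|by case: hg|by rewrite e; apply: cont_on_divz].
by rewrite e Cmult_conj twopii_conj; ring.
Qed.

Lemma on_curve_crev g a : on_curve (crev g) (Cconj a) <-> on_curve g a.
Proof.
split=> -[t [ht e]]; exists (1 - t)%R; split; try lra.
  by rewrite -(Cconj_conj a) -e /crev Cconj_conj.
by rewrite /crev (_ : (1 - (1 - t) = t)%R) ?e //; ring.
Qed.

Lemma winding_crev g a : C1_loop g -> ~ on_curve g a ->
  winding (crev g) (Cconj a) = Cconj (winding g a).
Proof.
move=> hg ha; rewrite /winding.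
have e : (fun z => Cconj (/ (Cconj z - Cconj a))) = fun z => / (z - a).
  by apply: functional_extensionality => z; rewrite -Cminus_conj Cconj_inv_all Cconj_conj.
rewrite contour_int_crev //; last by rewrite e; apply: cont_on_pole.
by rewrite e Cmult_conj twopii_conj; ring.
Qed.

Lemma inside_crev g a : C1_loop g -> inside g a -> inside (crev g) (Cconj a).
Proof.
move=> hg [h1 h2]; split; first by move/on_curve_crev.
by rewrite winding_crev // h2 Cconj_R.
Qed.

Lemma outside_crev g a : C1_loop g -> outside g a -> outside (crev g) (Cconj a).
Proof.
move=> hg [h1 h2]; split; first by move/on_curve_crev.
by rewrite winding_crev // h2 Cconj_R.
Qed.

Lemma inside_seq_crev p g (c d : C) : C1_loop g -> d = Cconj c ->
  inside_seq p g c -> inside_seq p (crev g) d.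
Proof.
move=> hg -> h k; have := inside_crev hg (h k).
by rewrite Cmult_conj Cpow_conj Cconj_R.
Qed.

Lemma outside_seq_crev p g (c d : C) : C1_loop g -> d = Cconj c ->
  outside_seq p g c -> outside_seq p (crev g) d.
Proof.
move=> hg -> h k; have := outside_crev hg (h k).
by rewrite Cconj_div_all Cpow_conj Cconj_R.
Qed.

Lemma wide_crev (p : R) (M s x c M' s' x' c' : C) g : C1_loop g ->
  M' = Cconj M -> s' = Cconj s -> x' = Cconj x -> c' = Cconj c ->
  wide p M s x c g -> wide p M' s' x' c' (crev g).
Proof.
move=> hg -> -> -> -> [h1 [h2 h3]]; split; [|split].
- by apply: inside_seq_crev h1 => //; rewrite !(Cconj_div_all, Cmult_conj, Cconj_R).
- by apply: outside_seq_crev h2 => //; rewrite !(Cconj_div_all, Cmult_conj, Cconj_R).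
- by apply: outside_seq_crev h3 => //; rewrite !(Cconj_div_all, Cconj_inv_all, Cmult_conj, Cconj_R).
Qed.

Lemma deformed_circle_crev g : deformed_circle g -> deformed_circle (crev g).
Proof.
case=> hg [H [h1 h2 h3 h4 h5]]; split; first exact: C1_loop_crev.
exists (fun s t => Cconj (H s (1 - t)%R)); split.
- move=> [s t]; apply/filterlim_locally => eps.
  have [d hd] := proj1 (@filterlim_locally _ _ _ (@filter_filter _ _ (locally_filter (s, (1 - t)%R))) _ _) (h1 (s, (1 - t)%R)) eps.
  exists d => -[s' t'] [/= b1 b2].
  have [c1 c2] : ball (H s (1 - t)%R) eps (H s' (1 - t')%R).
    apply: (hd (s', (1 - t')%R)); split=> //=.
    move: b2; rewrite /ball /= /AbsRing_ball /= /abs /minus /plus /opp /=.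
    by rewrite -Rabs_Ropp (_ : (- (t' + - t) = 1 - t' + - (1 - t))%R); last by ring.
  split=> /=; first exact: c1.
  move: c2; rewrite /ball /= /AbsRing_ball /= /abs /minus /plus /opp /=.
  rewrite -Rabs_Ropp /Im; set A := (H s' _).2; set B := (H s _).2.
  by rewrite (_ : (- (A + - B) = - A + - - B)%R); last by ring.
- move=> s t hs ht; apply: Cconj_neq0; apply: h2 => //; lra.
- move=> s hs; have e0 : (1 - 0 = 1)%R by ring.
  have e1 : (1 - 1 = 0)%R by ring.
  by rewrite e0 e1 h3.
- move=> t ht; rewrite h4; last lra.
  rewrite /unit_circle (_ : (2 * PI * (1 - t) = - (2 * PI * t) + 2 * INR 1 * PI)%R); last by rewrite /=; ring.
  by rewrite cos_period sin_period cos_neg sin_neg; apply: C_ext; rewrite /Re /Im /=; ring.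
- by move=> t ht; rewrite h5 /crev //; lra.
Qed.

(** * Factorization and conjugation symmetry *)

(** Each factor of [Phi_prod] is moved to the contour selected for the univariate coefficient. *)
Lemma Phi_factorization (q : R) (hq : (0 < q < 1)%R) (N : nat)
    (a : params N) (x y : vec N)
    (hs : ps a <> 0) (hu : pu a <> 0) (ht : pt a <> 0) (hv : pv a <> 0)
    (hx : forall i, x i <> 0) (hy : forall i, y i <> 0)
    (K : selection N) (hK : selection_ok q K)
    (k : uselection) (hk : uselection_ok q k) :
  Phi_defined q a x y ->
  Phi q K a x y =
  \big[Cmult/RtoC 1]_(j < N)
     uPhi q k (UParams (vext x (ps a) j.+1) (pu a) (vprev y (pt a) j) (pv a) (plam a j) 0)
       (x j) (y j).
Proof.
move=> hd; have hc := hK _ _ _ hd.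
have hw := proj1 (@contours_wide q N a x y _ hq hu hv hx hy) hc.
have hext i : vext x (ps a) i <> 0 by apply: vext_neq0.
have hprev i : vprev y (pt a) i <> 0 by apply: vprev_neq0.
pose A (j : 'I_N) := UParams (vext x (ps a) j.+1) (pu a) (vprev y (pt a) j) (pv a) (plam a j) 0.
have hA j : admissible_at q a x y j (k (A j) (x j) (y j)).
  have hex : exists g, ucontour q (A j) (x j) (y j) g.
    have [d w] := hw j; exists (K a x y j).
    apply: (proj2 (@ucontour_admissible q _ _ _ _ _ _ _ _ hq hu hv (hx j) (hy j))).
    by split=> //; apply: admissible_wide_admissible.
  by case: (proj1 (@ucontour_admissible q _ _ _ _ _ _ _ _ hq hu hv (hx j) (hy j)) (hk _ _ _ hex)).
rewrite (Phi_prod hq hs hu ht hv hx hy hc hA).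
by apply: eq_bigr => j _; rewrite uPhi_bracket //; apply: hA.
Qed.

Lemma vext_ord N (f : vec N) s (k : 'I_N) : vext f s k = f k.
Proof. by rewrite /vext valK. Qed.

Lemma vext_ge N (f : vec N) s i : (N <= i)%N -> vext f s i = s.
Proof. by move=> h; rewrite /vext insubN // -leqNgt. Qed.

Lemma vext_vrev N (y : vec N) t (j : 'I_N) : vext (vrev y) t j.+1 = vprev y t (rev_ord j).
Proof.
have hj := ltn_ord j.
case: (ltnP j.+1 N) => h; last first.
  rewrite vext_ge // /= (_ : N - j.+1 = 0)%N //.
  by apply/eqP; rewrite subn_eq0.
rewrite (_ : j.+1 = Ordinal h :> nat) // vext_ord /vrev /=.
have h2 : (N - j.+2 < N)%N by rewrite -subSn // subSS; apply: leq_subr.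
rewrite (_ : (N - j.+1)%N = (N - j.+2).+1); last by rewrite -subSn.
rewrite /= (_ : (N - j.+2)%N = Ordinal h2) // vext_ord.
by congr y; apply: val_inj.
Qed.

Lemma vprev_vrev N (x : vec N) s (j : 'I_N) : vprev (vrev x) s j = vext x s (rev_ord j).+1.
Proof. by rewrite -{1}(rev_ordK j) -vext_vrev; congr vext; apply: functional_extensionality => i; rewrite /vrev rev_ordK. Qed.

(** Conjugation exchanges q^(1 - 2 i lambda) and q^(1 + 2 i lambda), hence the two factors
   of each integrand; the conjugated and reversed contours are admissible for the
   parameters alpha^theta. *)
Lemma Phi_conjugation (q : R) (hq : (0 < q < 1)%R) (N : nat)
    (a : params N) (x y : vec N)
    (hs : ps a <> 0) (hu : pu a <> 0) (ht : pt a <> 0) (hv : pv a <> 0)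
    (hx : forall i, x i <> 0) (hy : forall i, y i <> 0)
    (K : selection N) (hK : selection_ok q K) :
  Phi_defined q (pconj a) (vconj x) (vconj y) ->
  Cconj (Phi q K (pconj a) (vconj x) (vconj y)) =
  Phi q K (ptheta a) (vrev y) (vrev x).
Proof.
move=> hd; have hc := hK _ _ _ hd.
have hp := qsq_bounds hq.
have hxc i : vconj x i <> 0 by apply: Cconj_neq0.
have hyc i : vconj y i <> 0 by apply: Cconj_neq0.
have hsc := Cconj_neq0 hs; have huc := Cconj_neq0 hu.
have htc := Cconj_neq0 ht; have hvc := Cconj_neq0 hv.
set G := K (pconj a) (vconj x) (vconj y) in hc *.
have hw := proj1 (@contours_wide q N (pconj a) (vconj x) (vconj y) _ hq huc hvc hxc hyc) hc.
have hA j : admissible_at q (pconj a) (vconj x) (vconj y) j (G j).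
  by have [d w] := hw j; apply: (admissible_wide_admissible hq huc hvc (hxc j) (hyc j) d w).
have hxr i : vrev x i <> 0 by apply: hx.
have hyr i : vrev y i <> 0 by apply: hy.
pose G' (j : 'I_N) := crev (G (rev_ord j)).
have hw' j : deformed_circle (G' j) /\
    admissible_wide q (vext (vrev y) (ps (ptheta a)) j.+1) (pu (ptheta a)) (vprev (vrev x) (pt (ptheta a)) j)
      (pv (ptheta a)) (plam (ptheta a) j) (vrev y j) (vrev x j) (G' j).
  have [d [w1 w2]] := hw (rev_ord j).
  have hl : C1_loop (G (rev_ord j)) by case: d.
  split; first exact: deformed_circle_crev.
  rewrite vext_vrev vprev_vrev /=; split.
    apply: (wide_crev hl _ _ _ _ w2).
    - by rewrite Mg_conj.
    - by rewrite vprev_conj Cconj_conj.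
    - by rewrite /vconj Cconj_conj.
    - by rewrite Cmult_conj qilam_conj Cconj_conj.
  apply: (wide_crev hl _ _ _ _ w1).
  - by rewrite Mf_conj.
  - by rewrite vext_conj Cconj_conj.
  - by rewrite /vconj Cconj_conj.
  - rewrite Cconj_div_all qilam_conj Cconj_conj /=.
    by have hl0 := @qilam_neq0 q (plam a (rev_ord j)); field.
have hc' := proj2 (@contours_wide q N (ptheta a) (vrev y) (vrev x) G' hq hv hu hyr hxr) hw'.
have hA' j : admissible_at q (ptheta a) (vrev y) (vrev x) j (G' j).
  by have [d w] := hw' j; apply: (admissible_wide_admissible hq hv hu (hyr j) (hxr j) d w).
have hKc : contours q (ptheta a) (vrev y) (vrev x) (K (ptheta a) (vrev y) (vrev x)).
  by apply: hK; exists G'.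
rewrite (Phi_prod (a := pconj a) hq hsc huc htc hvc hxc hyc hc hA).
rewrite (Phi_prod (a := ptheta a) hq ht hv hs hu hyr hxr hKc hA').
rewrite Cconj_prod (reindex_inj rev_ord_inj) /=; apply: eq_bigr => j _.
set r := rev_ord j.
have e : (fun z => Cconj (kernel_at q (ptheta a) (vrev y) (vrev x) j (Cconj z))) =
   kernel_at q (pconj a) (vconj x) (vconj y) r.
  apply: functional_extensionality => z; rewrite /kernel_at /overlap_kernel Cmult_conj !fw_conj // Mf_conj Mg_conj.
  rewrite vext_vrev vprev_vrev /= -/r !vext_conj vprev_conj Cmult_lawC.
  rewrite !(qilam_conj, Cconj_div_all, Cmult_conj, Cconj_conj).
  have hl0 := @qilam_neq0 q (plam a r).
  by congr (fw _ _ _ _ _ * fw _ _ _ _ _); field.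
have hg : pointed_loop (G r) by case: (hA r).
rewrite /G' -/r bracket_crev ?e //.
apply: tame_cont; apply: (tame_overlap_kernel hq _ huc _ hvc _ _ (hA r) (hA r)).
- by apply: vext_neq0.
- by apply: vprev_neq0.
- exact: hxc.
- exact: hyc.
Qed.

(** * The difference equations *)

Definition is_sign (n : Z) : Prop := n = 1%Z \/ (n = 0%Z \/ n = (-1)%Z).

Lemma nuat_sign j (nu : signs j) i : is_sign (nuat nu i).
Proof.
rewrite /nuat; case: insub => [k|]; last by right; left.
case: (nu k) => [[|[|[|m]]] hm] //=; [right; right|right; left|left]; reflexivity.
Qed.

Lemma Cpowz_qshift (q : R) n : is_sign n -> Cpowz q (2 * n) = qshift (qsq q) n.
Proof.
move=> [->|[->|->]] //=; rewrite ?qsq_C //.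
- by rewrite -qsq_C.
- by rewrite -qsq_C.
Qed.

Lemma nuat_out j (nu : signs j) i : (j <= i)%N -> nuat nu i = 0%Z.
Proof. by move=> h; rewrite /nuat insubN // -leqNgt. Qed.

Lemma vext_vshift (q : R) N j (nu : signs j) (x : vec N) s i : (j <= N)%N ->
  vext (vshift q nu x) s i = vext x s i * qshift (qsq q) (nuat nu i).
Proof.
move=> hj; case: (ltnP i N) => h.
  rewrite (_ : i = Ordinal h) // !vext_ord /vshift Cpowz_qshift //; exact: nuat_sign.
rewrite !vext_ge // nuat_out; last exact: leq_trans hj h.
by rewrite /=; ring.
Qed.

Definition coefC (p : R) (M : C) (sg : Z) (s x : C) (n : Z) : C :=
  match n with
  | Z0 => coefB p M sg s x
  | Zpos _ => coefA p M sg s x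
  | Zneg _ => coefA p M sg s (/ x)
  end.

Lemma p_over_Mf q lam : (0 < q < 1)%R -> qsq q / Mf q lam = q * qilam q lam ^ 2.
Proof.
move=> hq; have q0 := q_neq0 hq; have hl := @qilam_neq0 q lam.
by rewrite -qsq_C /Mf; fld.
Qed.

Lemma Asel_coefA (q : R) sg (s : C) lam (x : C) : (0 < q < 1)%R ->
  Asel sg q s lam x = coefA (qsq q) (Mf q lam) sg s x.
Proof.
move=> hq; have e := p_over_Mf lam hq.
have E (w : C) : s * qsq q / Mf q lam * w = s * w * (q * qilam q lam ^ 2).
  by rewrite -e /Cdiv; ring.
have E2 (w : C) : s * qsq q * qsq q / Mf q lam * w = s * w * (q * qilam q lam ^ 2 * q ^ 2).
  by rewrite -e qsq_C /Cdiv; ring.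
case: sg => [|n|n]; rewrite /Asel /coefA ?E ?E2.
- rewrite /A0 (qpow_12m _ hq) (qpow_12p _ hq) -/(Mf q lam) qsq_C /Cdiv.
  by rewrite (_ : s * Mf q lam * x = s * x * Mf q lam) //; ring.
- rewrite /Aplus (qpow_12m _ hq) (qpow_12p _ hq) (qpow_32m _ hq) (qpow_32p _ hq) -/(Mf q lam) qsq_C /Cdiv.
  by ring.
- by rewrite /Aminus qsq_C.
Qed.

Lemma Bsel_coefB (q : R) sg (s : C) lam (x : C) : (0 < q < 1)%R ->
  Bsel sg q s lam x = coefB (qsq q) (Mf q lam) sg s x.
Proof.
move=> hq; have e := p_over_Mf lam hq; have q0 := q_neq0 hq.
have E (w : C) : s * qsq q / Mf q lam * w = s * w * (q * qilam q lam ^ 2).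
  by rewrite -e /Cdiv; ring.
have E3 : / q * (/ q + q) = (1 + qsq q) / qsq q by rewrite -qsq_C; field.
case: sg => [|n|n]; rewrite /Bsel /coefB.
- by rewrite /B0 -!(Asel_coefA 0 _ _ _ hq).
- rewrite /Bplus E3 (qpow_12m _ hq) (qpow_12p _ hq) -/(Mf q lam) qsq_C /Cdiv -!/(Cdiv _ _).
  rewrite -e /Cdiv; ring.
- by rewrite /Bminus E3 qsq_C.
Qed.

Lemma Cfactor_coefC (q : R) N (a : params N) (x : vec N) j (nu : signs j) (i : 'I_N) : (0 < q < 1)%R ->
  Cfactor q a x nu i =
  coefC (qsq q) (Mf q (plam a i)) (nuat nu i.+1) (vext x (ps a) i.+1) (x i) (nuat nu i).
Proof.
move=> hq; rewrite /Cfactor (Asel_coefA _ _ _ _ hq) (Bsel_coefB _ _ _ _ hq).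
have e (z : C) : z * 1 = z by ring.
by case: (nuat_sign nu i) => [->|[->|->]] //=; rewrite e.
Qed.

(** The solution of alpha + gamma / p = - u / (v q), alpha + gamma p = - v q / u. *)
Definition gammaM (q : R) (u v : C) : C := (u / (v * q) - v * q / u) / (qsq q - / qsq q).
Definition alphaM (q : R) (u v : C) : C := - (u / (v * q)) - gammaM q u v / qsq q.

Lemma qsq_consts (q : R) : (0 < q < 1)%R ->
  [/\ RtoC q <> 0, RtoC (qsq q) <> 0, 1 - RtoC (qsq q) <> 0 & 1 + RtoC (qsq q) <> 0].
Proof.
move=> hq; have hp := qsq_bounds hq; split.
- exact: q_neq0.
- by apply: RtoC_neq0; lra.
- by rewrite -RtoC_minus; apply: RtoC_neq0; lra.
- by rewrite -RtoC_plus; apply: RtoC_neq0; lra.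
Qed.

Lemma alphaM_gammaM_eqs (q : R) (u v : C) : (0 < q < 1)%R -> u <> 0 -> v <> 0 ->
  alphaM q u v + gammaM q u v / qsq q = - (u / (v * q)) /\
  alphaM q u v + gammaM q u v * qsq q = - (v * q / u).
Proof.
move=> hq hu hv; have [q0 p0 p1 p1'] := qsq_consts hq.
rewrite /alphaM; split; first by ring.
have h : qsq q - / qsq q <> 0.
  have -> : qsq q - / qsq q = - ((1 - qsq q) * (1 + qsq q)) * / qsq q by field.
  by apply: Cmult_neq_0; [apply: neq0_opp; apply: Cmult_neq_0|apply: Cinv_neq0].
have -> : - (u / (v * q)) - gammaM q u v / qsq q + gammaM q u v * qsq q =
  - (u / (v * q)) + gammaM q u v * (qsq q - / qsq q) by rewrite /Cdiv; ring.
have -> : gammaM q u v * (qsq q - / qsq q) = u / (v * q) - v * q / u.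
  rewrite /gammaM; move: h; set d := qsq q - / qsq q => h; set e := u / (v * q) - v * q / u.
  by field.
ring.
Qed.

Lemma alphaM_gammaM_sum (q : R) (u v : C) : (0 < q < 1)%R -> u <> 0 -> v <> 0 ->
  alphaM q u v + gammaM q u v = - ((u / v + v / u) / (/ q + q)).
Proof.
move=> hq hu hv; have [q0 p0 p1 p1'] := qsq_consts hq.
have [e1 e2] := alphaM_gammaM_eqs hq hu hv.
have h : / q + q <> 0.
  have -> : / q + q = (1 + qsq q) * / q by rewrite -qsq_C; field.
  by apply: Cmult_neq_0 => //; apply: Cinv_neq0.
(* a combination of the two equations which define alpha and gamma *)
have e : (1 + qsq q) * (alphaM q u v + gammaM q u v) =
  qsq q * (alphaM q u v + gammaM q u v / qsq q) + (alphaM q u v + gammaM q u v * qsq q).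
  by field.
rewrite e1 e2 in e.
have -> : alphaM q u v + gammaM q u v = (1 + qsq q) * (alphaM q u v + gammaM q u v) / (1 + qsq q).
  by field.
rewrite e -qsq_C; rewrite -qsq_C in p1'.
field; repeat split=> //.
by rewrite (_ : 1 + q * q = 1 + q ^ 2) //; ring.
Qed.

(** The factor of the coefficients which depends on nu_1 comes from three operators on f:
   the scalar xi t, the eigenvalue xi x_1 taken before the recurrences are
   applied, and the shifted eigenvalue taken after. *)
Lemma Mfactor_xi (q : R) N (a : params N) n (x : C) : (0 < q < 1)%R ->
  pu a <> 0 -> pt a <> 0 -> pv a <> 0 -> x <> 0 -> is_sign n ->
  Mfactor q a n x * (/ q - q) =
  xi (pt a) + alphaM q (pu a) (pv a) * xi x + gammaM q (pu a) (pv a) * xi (x * qshift (qsq q) n).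
Proof.
move=> hq hu ht hv hx hn; have [q0 p0 p1 p1'] := qsq_consts hq.
have [e1 e2] := alphaM_gammaM_eqs hq hu hv; have e3 := alphaM_gammaM_sum hq hu hv.
have hd : / q - q <> 0.
  have -> : / q - q = (1 - qsq q) * / q by rewrite -qsq_C; field.
  by apply: Cmult_neq_0 => //; apply: Cinv_neq0.
have hs : / q + q <> 0.
  have -> : / q + q = (1 + qsq q) * / q by rewrite -qsq_C; field.
  by apply: Cmult_neq_0 => //; apply: Cinv_neq0.
have hds : / q ^ 2 - q ^ 2 = (/ q - q) * (/ q + q) by field.
rewrite /Mfactor; move: hds; set D := / q ^ 2 - q ^ 2 => hds.
move: (pu a) (pv a) (pt a) hu hv ht (alphaM _ _ _) (gammaM _ _ _) e1 e2 e3 => u v t hu hv ht al ga e1 e2 e3.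
case: hn => [->|[->|->]] /=.
- transitivity (xi t + (al + ga / qsq q) * / x + (al + ga * qsq q) * x).
    rewrite e1 e2 /xi; move: hd; set d := / q - q => hd; fld.
  by rewrite /xi; fld.
- transitivity (xi t + (al + ga) * xi x); last by rewrite /xi (_ : x * 1 = x); [ring|ring].
  rewrite e3 hds /xi; move: hd hs; set d := / q - q; set e := / q + q => hd hs; fld.
- transitivity (xi t + (al + ga / qsq q) * x + (al + ga * qsq q) * / x).
    rewrite e1 e2 /xi; move: hd; set d := / q - q => hd; fld.
  by rewrite /xi; fld.
Qed.

Lemma vshift_zero (q : R) N j (x : vec N) :
  exists nu : signs j, vshift q nu x = x.
Proof.
exists [ffun _ => inord 1]; apply: functional_extensionality => i.
rewrite /vshift /nuat; case: insubP => [k _ _|_]; last by rewrite /=; ring.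
by rewrite ffunE inordK //= Cmult_1_r.
Qed.

Lemma big_ord_lt N m (F : nat -> C) : (m <= N)%N ->
  \big[Cmult/RtoC 1]_(k < N | (k < m)%N) F k = \big[Cmult/RtoC 1]_(i < m) F i.
Proof. by move=> h; rewrite (big_ord_widen _ F h). Qed.

(** All shifted overlap coefficients are written over the contours selected for the
   unshifted one. The variables beyond index j contribute the same factor R to all
   terms, and the others are treated by [chain_telescope]. *)
Lemma Phi_recurrence (q : R) (hq : (0 < q < 1)%R) (N : nat)
    (a : params N) (x y : vec N)
    (hs : ps a <> 0) (hu : pu a <> 0) (ht : pt a <> 0) (hv : pv a <> 0)
    (hx : forall i, x i <> 0) (hy : forall i, y i <> 0)
    (K : selection N) (hK : selection_ok q K) (j : 'I_N) :
   (forall i : 'I_N, (i <= j)%N ->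
      x i ^ 2 <> 1 /\ x i ^ 2 <> RtoC q ^ 2 /\ x i ^ 2 <> / RtoC q ^ 2) ->
   (forall nu : signs j.+1, Phi_defined q a (vshift q nu x) y) ->
   mu q (y j) * Phi q K a x y =
   \big[Cplus/RtoC 0]_(nu : signs j.+1)
     (Ccoef q a x nu * Tshift q nu (fun x' => Phi q K a x' y) x)
   + (pu a / pv a + pv a / pu a)
     * (vext x (ps a) j.+1 + / vext x (ps a) j.+1) / (/ RtoC q ^ 2 - RtoC q ^ 2)
     * Phi q K a x y.
Proof.
move=> hxj hdef.
have hp := qsq_bounds hq; have [q0 p0 p1 p1'] := qsq_consts hq.
have hjN : (j.+1 <= N)%N := ltn_ord j.
set m := j.+1 in hdef hjN *.
have hd0 : Phi_defined q a x y by have [nu e] := vshift_zero q m x; rewrite -e; apply: hdef.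
have hc0 := hK _ _ _ hd0.
set G := K a x y in hc0.
have hw := proj1 (@contours_wide q N a x y _ hq hu hv hx hy) hc0.
have hext i : vext x (ps a) i <> 0 by apply: vext_neq0.
have hprev i : vprev y (pt a) i <> 0 by apply: vprev_neq0.
pose M (k : 'I_N) := Mf q (plam a k).
pose s_ (k : 'I_N) := vext x (ps a) k.+1.
pose c_ (k : 'I_N) := pu a / qilam q (plam a k).
pose M' (k : 'I_N) := Mg q (plam a k).
pose t_ (k : 'I_N) := vprev y (pt a) k.
pose c' (k : 'I_N) := pv a * qilam q (plam a k).
have S k : setting (qsq q) (M k) (s_ k) (x k) (c_ k) (M' k) (t_ k) (y k) (c' k) (G k).
  have [d [w1 w2]] := hw k.
  exact: (Setting hp (@Mf_neq0 q (plam a k) hq) (hext k.+1) (hx k) (@f_scale_neq0 q (plam a k) _ hu)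
    (@Mg_neq0 q (plam a k) hq) (hprev k) (hy k) (@g_scale_neq0 q (plam a k) _ hv)
    (deformed_pointed d) w1 w2).
pose ph k n sg := bracket (G k) (fun z => fw (qsq q) (M k) (s_ k * qshift (qsq q) sg) (x k * qshift (qsq q) n) (c_ k * z)
   * fw (qsq q) (M' k) (t_ k) (y k) (c' k * z)).
(* [wide] leaves room for the shifts, so the contours of the unshifted coefficient serve all *)
have hPhi nu : Phi q K a (vshift q (nu : signs m) x) y =
   \big[Cmult/RtoC 1]_(k < N) ph k (nuat nu k) (nuat nu k.+1).
  have hxs i : vshift q nu x i <> 0.
    rewrite /vshift (Cpowz_qshift _ (nuat_sign nu i)); apply: Cmult_neq_0 => //; apply: qshift_neq0; lra.
  have hA k : admissible_at q a (vshift q nu x) y k (G k).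
    have [hp' hM hs' hx' hc hM' ht' hy' hc' hg wf wg] := S k.
    split=> //; rewrite vext_vshift // /vshift (Cpowz_qshift _ (nuat_sign nu k)); split.
      exact: wide_separates.
    exact: wide_separates_id.
  rewrite (Phi_prod hq hs hu ht hv hxs hy (hK _ _ _ (hdef nu)) hA).
  apply: eq_bigr => k _; rewrite /kernel_at /overlap_kernel /ph.
  by rewrite vext_vshift // /vshift (Cpowz_qshift _ (nuat_sign nu k)).
pose a_ k := bracket_f (qsq q) (M k) (s_ k) (x k) (c_ k) (M' k) (t_ k) (y k) (c' k) (G k).
pose b_ k := bracket_d (qsq q) (M k) (s_ k) (x k) (c_ k) (M' k) (t_ k) (y k) (c' k) (G k).
pose b1 k := bracket_f_z (qsq q) (M k) (s_ k) (x k) (c_ k) (M' k) (t_ k) (y k) (c' k) (G k).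
pose b2 k := bracket_f_invz (qsq q) (M k) (s_ k) (x k) (c_ k) (M' k) (t_ k) (y k) (c' k) (G k).
pose d1 k := bracket_d_z (qsq q) (M k) (s_ k) (x k) (c_ k) (M' k) (t_ k) (y k) (c' k) (G k).
pose d2 k := bracket_d_invz (qsq q) (M k) (s_ k) (x k) (c_ k) (M' k) (t_ k) (y k) (c' k) (G k).
have ph0 k : ph k 0%Z 0%Z = a_ k.
  have es : s_ k * 1 = s_ k by ring.
  have ex : x k * 1 = x k by ring.
  by rewrite /ph /= es ex.
have hPhi0 : Phi q K a x y = \big[Cmult/RtoC 1]_(k < N) a_ k.
  rewrite (@Phi_prod q N a x y K G) // => k.
  have [d w] := hw k; exact: admissible_wide_admissible.
pose T i n sg := vext (fun k : 'I_N => coefC (qsq q) (M k) sg (s_ k) (x k) n * ph k n sg) 0 i.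
pose an i := vext a_ 0 i.
pose bn i := vext b_ 0 i.
pose rho i := vext (fun k : 'I_N => c_ k / qsq q * d1 k + (qsq q / c_ k * d2 k
   + (- (c_ k / M k) * b1 k + - (M k / c_ k) * b2 k))) 0 i.
pose rho' i := vext (fun k : 'I_N => c_ k * d1 k + (/ c_ k * d2 k
   + (- (c_ k * qsq q / M k) * b1 k + - (M k / (qsq q * c_ k)) * b2 k))) 0 i.
pose eta i := xi (vprev y (pt a) i).
pose X i n := xi (vext x (ps a) i * qshift (qsq q) n).
pose al := alphaM q (pu a) (pv a).
pose ga := gammaM q (pu a) (pv a).
have at_ i (hi : (i < m)%N) : exists k : 'I_N, i = k /\ (k <= j)%N.
  by exists (Ordinal (leq_trans hi hjN)).
have hpair (k : 'I_N) : (k <= j)%N -> generic_pair (qsq q) (M k) (s_ k) (x k).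
  move=> /hxj [e1 [e2 e3]].
  have [hp' hM hs' hx' hc hM' ht' hy' hc' hg wf wg] := S k.
  apply: (wide_generic_pair hp' hx' hc wf).
  - by move=> /Csub_eq0 e; apply: e1.
  - by move=> /Csub_eq0 e; apply: e2; rewrite qsq_C.
  - move=> /Csub_eq0 e; apply: e3; rewrite qsq_C.
    transitivity (qsq q * x k ^ 2 / qsq q); first by field.
    by rewrite -e; field.
have E3 i sg : (i < m)%N -> T i 1%Z sg + (T i 0%Z sg + T i (-1)%Z sg) = bn i.
  move=> /at_ [k [-> hk]]; rewrite /T /bn !vext_ord.
  exact: (bracket_recurrence (S k) sg (hpair k hk)).
have E4 i sg : (i < m)%N ->
     X i 1%Z * T i 1%Z sg + (X i 0%Z * T i 0%Z sg + X i (-1)%Z * T i (-1)%Z sg) =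
     rho' i + X i.+1 sg * an i.
  move=> /at_ [k [-> hk]]; rewrite /T /an /rho' /X !vext_ord.
  have e := bracket_recurrence_weighted (S k) sg (hpair k hk).
  rewrite /= -/(ph k 1%Z sg) -/(ph k 0%Z sg) -/(ph k (-1)%Z sg) in e *.
  rewrite (_ : x k * 1 = x k); last by ring.
  transitivity (c_ k * d1 k + (/ c_ k * d2 k + (- (c_ k * qsq q / M k) * b1 k +
      (- (M k / (qsq q * c_ k)) * b2 k + xi (s_ k * qshift (qsq q) sg) * a_ k)))); last by rewrite /s_; ring.
  by rewrite -e /Cdiv; ring.
have E2 i : (i < m)%N -> X i 0%Z * bn i = rho i + X i.+1 0%Z * an i.
  move=> /at_ [k [-> hk]]; rewrite /bn /an /rho /X !vext_ord /=.
  have e := bracket_eigen_x (S k).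
  rewrite (_ : x k * 1 = x k); last by ring.
  rewrite (_ : vext x (ps a) k.+1 * 1 = s_ k); last by rewrite /s_; ring.
  rewrite -/(b_ k) -/(d1 k) -/(d2 k) -/(b1 k) -/(b2 k) -/(a_ k) in e.
  by rewrite e; ring.
have E1 i : (i < m)%N -> eta i.+1 * an i = al * rho i + ga * rho' i + eta i * bn i.
  move=> /at_ [k [-> hk]]; rewrite /bn /an /rho /rho' /eta !vext_ord /=.
  have e := bracket_eigen_y (S k).
  rewrite -/(b_ k) -/(d1 k) -/(d2 k) -/(b1 k) -/(b2 k) -/(a_ k) -/(t_ k) in e *.
  rewrite vext_ord e.
  have [g1 g2] := alphaM_gammaM_eqs hq hu hv.
  have hl := @qilam_neq0 q (plam a k).
  (* r = alpha rho + gamma rho' holds coefficient by coefficient *)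
  have f1 : c' k = - (c_ k / M k) * (al + ga * qsq q).
    by rewrite g2 /c' /c_ /M /Mf; fld.
  have f2 : / c' k = - (M k / c_ k) * (al + ga / qsq q).
    by rewrite g1 /c' /c_ /M /Mf; fld.
  have f3 : - (c' k / M' k) = c_ k / qsq q * (al + ga * qsq q).
    by rewrite g2 /c' /c_ /M' /Mg -qsq_C; fld.
  have f4 : - (M' k / c' k) = qsq q / c_ k * (al + ga / qsq q).
    by rewrite g1 /c' /c_ /M' /Mg -qsq_C; fld.
  rewrite f3 f4 f2 f1.
  have hck : c_ k <> 0 by apply: f_scale_neq0.
  have hMk : M k <> 0 by apply: Mf_neq0.
  move: (c_ k) (M k) (b_ k) (d1 k) (d2 k) (b1 k) (b2 k) (a_ k) al ga hck hMk {f1 f2 f3 f4 g1 g2 e hPhi0 ph0}.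
  move=> cc MM bb dd1 dd2 bb1 bb2 aa al' ga' hck hMk.
  by set Y := xi _; fld.
have tele := chain_telescope E3 E4 E2 E1.
have hsum := sum_chain E3.
set R := \big[Cmult/RtoC 1]_(k < N | ~~ (k < m)%N) a_ k.
have hsplit0 : Phi q K a x y = \big[Cmult/RtoC 1]_(i < m) an i * R.
  rewrite hPhi0 (bigID (fun k : 'I_N => (k < m)%N)) /=; congr (_ * _).
  rewrite -(@big_ord_lt N m an hjN); apply: eq_bigr => k _.
  by rewrite /an vext_ord.
have hterm (nu : signs m) : Ccoef q a x nu * Tshift q nu (fun x' => Phi q K a x' y) x =
   Mfactor q a (nuat nu 0) (vext x (ps a) 0) * chain T m (nuat nu) * R.
  have e1 : \big[Cmult/RtoC 1]_(k < N) ph k (nuat nu k) (nuat nu k.+1) =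
      \big[Cmult/RtoC 1]_(k < N | (k < m)%N) ph k (nuat nu k) (nuat nu k.+1) * R.
    rewrite (bigID (fun k : 'I_N => (k < m)%N)) /=; congr (_ * _).
    apply: eq_bigr => k; rewrite -leqNgt => hk.
    by rewrite nuat_out // nuat_out; [exact: ph0|exact: leqW].
  have e2 : chain T m (nuat nu) = \big[Cmult/RtoC 1]_(k < N | (k < m)%N) Cfactor q a x nu k *
      \big[Cmult/RtoC 1]_(k < N | (k < m)%N) ph k (nuat nu k) (nuat nu k.+1).
    rewrite /chain -(@big_ord_lt N m (fun i => T i (nuat nu i) (nuat nu i.+1)) hjN) -big_split /=.
    by apply: eq_bigr => k _; rewrite /T vext_ord (Cfactor_coefC _ _ _ _ hq).
  rewrite /Tshift hPhi e1 e2 /Ccoef; ring.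
have hd : / q - q <> 0.
  have -> : / q - q = (1 - qsq q) * / q by rewrite -qsq_C; field.
  by apply: Cmult_neq_0 => //; apply: Cinv_neq0.
have hsm : / q + q <> 0.
  have -> : / q + q = (1 + qsq q) * / q by rewrite -qsq_C; field.
  by apply: Cmult_neq_0 => //; apply: Cinv_neq0.
have hds : / q ^ 2 - q ^ 2 = (/ q - q) * (/ q + q) by field.
have hSum : \big[Cplus/RtoC 0]_(nu : signs m)
     (Ccoef q a x nu * Tshift q nu (fun x' => Phi q K a x' y) x) =
   R / (/ q - q) * ((xi (pt a) + al * X 0%N 0%Z) * \big[Cmult/RtoC 1]_(i < m) bn i
     + ga * \big[Cplus/RtoC 0]_(nu : signs m) (X 0%N (nuat nu 0%N) * chain T m (nuat nu))).
  rewrite -hsum !big_distrr -big_split big_distrr /=; apply: eq_bigr => nu _.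
  rewrite hterm.
  have e := @Mfactor_xi q N a (nuat nu 0) (vext x (ps a) 0) hq hu ht hv (hext 0%N) (nuat_sign nu 0).
  have -> : Mfactor q a (nuat nu 0) (vext x (ps a) 0) =
     (Mfactor q a (nuat nu 0) (vext x (ps a) 0) * (/ q - q)) / (/ q - q).
    by move: hd; set d := / q - q => hd; field.
  rewrite e -/al -/ga -/(X 0%N (nuat nu 0%N)) /X /= Cmult_1_r /Cdiv; ring.
rewrite hSum hsplit0 /mu -/(xi (y j)) -/(xi (vext x (ps a) m)).
have eX : X m 0%Z = xi (vext x (ps a) m) by rewrite /X /= Cmult_1_r.
have eeta : eta m = xi (y j) by rewrite /eta /m /= vext_ord.
have eeta0 : eta 0%N = xi (pt a) by [].
rewrite eX eeta eeta0 in tele.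
have hag : al + ga = - ((pu a / pv a + pv a / pu a) / (/ q + q)) := alphaM_gammaM_sum hq hu hv.
rewrite hag in tele.
rewrite hds.
move: tele hd hsm.
set PA := \big[Cmult/RtoC 1]_(i < m) an i.
set A := (xi (pt a) + al * X 0%N 0%Z) * _ + ga * _.
set d := / q - q; set e := / q + q; set Y := xi (y j); set Z := xi (vext x (ps a) m).
set W := pu a / pv a + pv a / pu a.
move=> tele hd hsm.
have -> : A = Y * PA - W / e * Z * PA by rewrite tele; ring.
by field.
Qed.

Theorem theorem4p6 (q : R) (hq : (0 < q < 1)%R) (N : nat) (hN : (2 <= N)%N)
    (a : params N) (x y : vec N)
    (hs : ps a <> 0) (hu : pu a <> 0) (ht : pt a <> 0) (hv : pv a <> 0)
    (hx : forall i, x i <> 0) (hy : forall i, y i <> 0)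
    (K : selection N) (hK : selection_ok q K)
    (k : uselection) (hk : uselection_ok q k) :
  (Phi_defined q a x y ->
   Phi q K a x y =
   \big[Cmult/RtoC 1]_(j < N)
     uPhi q k (UParams (vext x (ps a) j.+1) (pu a) (vprev y (pt a) j) (pv a) (plam a j) 0)
       (x j) (y j))
  /\
  (Phi_defined q (pconj a) (vconj x) (vconj y) ->
   Cconj (Phi q K (pconj a) (vconj x) (vconj y)) =
   Phi q K (ptheta a) (vrev y) (vrev x))
  /\
  (* indices are 0-based: j : 'I_N stands for the index j + 1 in {1, ..., N} *)
  (forall j : 'I_N,
   (forall i : 'I_N, (i <= j)%N ->
      x i ^ 2 <> 1 /\ x i ^ 2 <> RtoC q ^ 2 /\ x i ^ 2 <> / RtoC q ^ 2) ->
   (forall nu : signs j.+1, Phi_defined q a (vshift q nu x) y) ->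
   mu q (y j) * Phi q K a x y =
   \big[Cplus/RtoC 0]_(nu : signs j.+1)
     (Ccoef q a x nu * Tshift q nu (fun x' => Phi q K a x' y) x)
   + (pu a / pv a + pv a / pu a)
     * (vext x (ps a) j.+1 + / vext x (ps a) j.+1) / (/ RtoC q ^ 2 - RtoC q ^ 2)
     * Phi q K a x y).
Proof.
split; [exact: Phi_factorization|split; [exact: Phi_conjugation|]].
by move=> j; apply: Phi_recurrence.
Qed.
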